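(* Let $0<\alpha\le 1$ and $w\in A_1$. Assume that $\theta$ satisfies the $\mathcal D_\kappa$ condition with $0\le\kappa<1$. Then there is a constant $C>0$ such that for every sequence $\vec f=(f_1,f_2,\ldots)$ of locally integrable functions on $\mathbb R^n$, $$\bigg\|\bigg(\sum_{j}\big|\mathcal S_\alpha(f_j)\big|^2\bigg)^{1/2}\bigg\|_{W\mathcal M^{1,\theta}(w)}\leq C \bigg\|\bigg(\sum_{j}|f_j|^2\bigg)^{1/2}\bigg\|_{\mathcal M^{1,\theta}(w)}.$$
   Context: Intrinsic square function: for $0<\alpha\le1$ let $\mathcal C_\alpha$ be the family of functions $\varphi:\mathbb R^n\to\mathbb R$ supported in $\{|x|\le1\}$ with $\int_{\mathbb R^n}\varphi\,dx=0$ and $|\varphi(x)-\varphi(x')|\le|x-x'|^\alpha$ for all $x,x'\in\mathbb R^n$. Put $\varphi_t(y)=t^{-n}\varphi(y/t)$, $\Gamma(x)=\{(y,t)\in\mathbb R^n\times(0,\infty):|x-y|<t\}$, and for $f\in L^1_{loc}(\mathbb R^n)$ $$\mathcal S_\alpha(f)(x)=\left(\iint_{\Gamma(x)}\Big(\sup_{\varphi\in\mathcal C_\alpha}\Big|\int_{\mathbb R^n}\varphi_t(y-z)f(z)\,dz\Big|\Big)^2\frac{dy\,dt}{t^{n+1}}\right)^{1/2}.$$ Weights: a weight is a positive locally integrable function on $\mathbb R^n$; $w(E)=\int_E w\,dx$. $w\in A_1$ means $\frac1{|B|}\int_B w\,dx\le C\,\mathrm{ess\,inf}_{x\in B}w(x)$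 for all balls $B$. $\mathcal D_\kappa$ condition: $\theta$ is a positive increasing function on $(0,+\infty)$ (increasing in the weak sense; $\theta\equiv1$ is allowed) for which there is a constant $C>0$ with $\theta(\xi)/\xi^\kappa\le C\,\theta(\xi')/(\xi')^\kappa$ for all $0<\xi'<\xi<\infty$. Norms (suprema over all balls $B\subset\mathbb R^n$): $\|f\|_{\mathcal M^{1,\theta}(w)}=\sup_B\frac1{\theta(w(B))}\int_B|f(x)|w(x)\,dx$ and $\|f\|_{W\mathcal M^{1,\theta}(w)}=\sup_B\sup_{\sigma>0}\frac1{\theta(w(B))}\,\sigma\cdot w(\{x\in B:|f(x)|>\sigma\})$. *)

(* Defs.v *)
(* R^n is 'rV[R]_n, over an arbitrary realType R. *)
From HB Require Import structures.
From mathcomp Require Import all_boot all_order all_algebra.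
From mathcomp Require Import all_classical all_reals all_analysis.
From mathcomp Require Import ess_sup_inf.

Set Implicit Arguments.
Unset Strict Implicit.
Unset Printing Implicit Defensive.

Import Order.TTheory GRing.Theory Num.Theory.
Import numFieldNormedType.Exports.

Local Open Scope classical_set_scope.
Local Open Scope ring_scope.

Definition measure_rV_display : measure_display -> measure_display.
Proof. exact. Qed.

(* The Borel sigma-algebra of 'rV[T]_n, generated by the coordinates (the same
   construction as the library's instance on n.-tuple T). *)
Section measurable_rV.
Context {d} {T : measurableType d} (n : nat).

Let coors : 'I_n -> 'rV[T]_n -> T := fun i v => v ord0 i.

Let rV_set0 : g_sigma_preimage coors set0.
Proof. exact: sigma_algebra0. Qed.

Let rV_setC A : g_sigma_preimage coors A -> g_sigma_preimage coors (~` A).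
Proof. exact: sigma_algebraC. Qed.

Let rV_bigcup (F : _^nat) : (forall i, g_sigma_preimage coors (F i)) ->
  g_sigma_preimage coors (\bigcup_i (F i)).
Proof. exact: sigma_algebra_bigcup. Qed.

HB.instance Definition _ := @isMeasurable.Build (measure_rV_display d)
  'rV[T]_n (g_sigma_preimage coors) rV_set0 rV_setC rV_bigcup.

End measurable_rV.

Lemma measurable_coord d (T : measurableType d) n (i : 'I_n) :
  measurable_fun [set: 'rV[T]_n] (fun v => v ord0 i).
Proof.
move=> _ Y mY; rewrite setTI; apply: sub_sigma_algebra => /=.
rewrite -bigcup_seq/=; exists i => /=; first by rewrite mem_index_enum.
by exists Y => //; rewrite setTI.
Qed.

Lemma measurable_fun_coordP d1 d2 (T1 : measurableType d1)
    (T2 : measurableType d2) n (f : T1 -> 'rV[T2]_n) :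
  (forall i, measurable_fun [set: T1] (fun x => f x ord0 i)) ->
  measurable_fun [set: T1] f.
Proof.
move=> mf _ A mA; rewrite setTI.
move: A mA; apply: smallest_sub.
  split => /=.
  - by rewrite preimage_set0.
  - by move=> A mA; rewrite setTD preimage_setC; apply: measurableC.
  - move=> F mF; rewrite preimage_bigcup.
    exact: bigcupT_measurable.
rewrite -bigcup_seq => A [i _ [B mB <-]] /=.
by rewrite setTI -comp_preimage -[X in measurable X]setTI; exact: mf.
Qed.

Section lebesgue_measure_rV.
Context {R : realType}.
Local Open Scope ereal_scope.

Definition cons_rV n (p : R * 'rV[R]_n) : 'rV[R]_n.+1 :=
  \row_i (if unlift ord0 i is Some j then p.2 ord0 j else p.1).

Let uncons_rV n (v : 'rV[R]_n.+1) : R * 'rV[R]_n :=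
  (v ord0 ord0, \row_j v ord0 (lift ord0 j)).

Let cons_rVK n : cancel (@cons_rV n) (@uncons_rV n).
Proof.
move=> [x v]; rewrite /uncons_rV /cons_rV; congr pair.
  by rewrite mxE unlift_none.
by apply/rowP => j; rewrite !mxE liftK.
Qed.

Lemma measurable_cons_rV n :
  measurable_fun [set: (measurableTypeR R * 'rV[R]_n)%type] (@cons_rV n).
Proof.
apply: measurable_fun_coordP => i.
under [X in measurable_fun _ X]funext do rewrite mxE.
case: unlift => [j|]; last exact: measurable_fst.
apply: (measurableT_comp (measurable_coord j)); exact: measurable_snd.
Qed.

Let measurable_uncons_rV n : measurable_fun setT (@uncons_rV n).
Proof.
apply/measurable_fun_pairP; split; first exact: measurable_coord.
apply: measurable_fun_coordP => i /=.
under [X in measurable_fun _ X]funext do rewrite mxE.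
exact: measurable_coord.
Qed.


Section lebesgue_rV_succ.
Context n (mu : {sigma_finite_measure set 'rV[R]_n -> \bar R}).

Definition lebesgue_rV_succ : set 'rV[R]_n.+1 -> \bar R :=
  pushforward (lebesgue_measure \x mu) (@cons_rV n).

Let succ0 : lebesgue_rV_succ set0 = 0.
Proof. by rewrite /lebesgue_rV_succ /pushforward preimage_set0 measure0. Qed.

Let succ_ge0 A : 0 <= lebesgue_rV_succ A.
Proof. exact: (@measure_ge0 _ _ _ (lebesgue_measure \x mu)). Qed.

Let succ_sigma_additive : semi_sigma_additive lebesgue_rV_succ.
Proof.
move=> F mF tF mUF; rewrite /lebesgue_rV_succ /pushforward preimage_bigcup.
apply: measure_semi_sigma_additive.
- by move=> i; rewrite -[X in measurable X]setTI; exact: measurable_cons_rV.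
- apply/trivIsetP => /= i j _ _ ij; rewrite -preimage_setI.
  by move/trivIsetP : tF => /(_ _ _ _ _ ij) ->//; rewrite preimage_set0.
- rewrite -preimage_bigcup -[X in measurable X]setTI.
  exact: measurable_cons_rV.
Qed.

HB.instance Definition _ := isMeasure.Build _ _ _ lebesgue_rV_succ
  succ0 succ_ge0 succ_sigma_additive.

Let succ_sigma_finite : sigma_finite setT lebesgue_rV_succ.
Proof.
have /sigma_finiteP[F [FT ndF Foo]] := @sigma_finiteT _ _ _ (@lebesgue_measure R).
have /sigma_finiteP[G [GT ndG Goo]] := sigma_finiteT mu.
exists (fun i => @uncons_rV n @^-1` (F i `*` G i)).
  rewrite -preimage_bigcup -(preimage_setT (@uncons_rV n)) -setXTT FT GT.
  congr (_ @^-1` _); rewrite predeqE => -[x y]; split.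
    move=> [/= [i _ Fix] [k _ Gky]]; exists (maxn i k) => //; split.
    - by move: x Fix; exact/subsetPset/ndF/leq_maxl.
    - by move: y Gky; exact/subsetPset/ndG/leq_maxr.
  by move=> [i _ []/= ? ?]; split; exists i.
move=> i; have [mF F_oo] := Foo i; have [mG G_oo] := Goo i; split.
  rewrite -[X in measurable X]setTI; apply: measurable_uncons_rV => //.
  exact: measurableX.
rewrite /lebesgue_rV_succ /pushforward -comp_preimage.
rewrite (_ : _ \o _ = id) ?preimage_id//.
  by rewrite product_measure1E// lte_mul_pinfty// ge0_fin_numE.
by apply/funext => p /=; exact: cons_rVK.
Qed.

HB.instance Definition _ := @Measure_isSigmaFinite.Build _ _ _
  lebesgue_rV_succ succ_sigma_finite.

End lebesgue_rV_succ.

(* Lebesgue measure on the Borel sets of R^n: the n-fold product of the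
   library's Lebesgue measure on R, 'rV[R]_0 being a single point. *)
Fixpoint borel_lebesgue n : {sigma_finite_measure set 'rV[R]_n -> \bar R} :=
  match n with
  | 0%N => @dirac _ 'rV[R]_0 0%R R
  | n'.+1 => lebesgue_rV_succ (borel_lebesgue n')
  end.

Lemma borel_lebesgue_box n (A : 'I_n -> set R) :
  (forall i, measurable (A i)) ->
  borel_lebesgue n [set v | forall i, A i (v ord0 i)] =
  \prod_(i < n) lebesgue_measure (A i).
Proof.
elim: n A => [|n IHn] A mA /=.
  rewrite big_ord0 diracE mem_set//= => -[].
  by [].
rewrite big_ord_recl /lebesgue_rV_succ /pushforward.
rewrite -(IHn (fun i => A (lift ord0 i)))//.
pose S := [set v : 'rV[R]_n | forall i, A (lift ord0 i) (v ord0 i)].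
have mS : measurable S.
  rewrite (_ : S = \bigcap_(i in [set: 'I_n])
    ((fun v : 'rV[R]_n => v ord0 i) @^-1` A (lift ord0 i))).
    apply: fin_bigcap_measurable => // i _.
    by rewrite -[X in measurable X]setTI; exact: measurable_coord.
  by apply/seteqP; split => [v Av i _|v Av i] /=; [exact: Av|exact: (Av i)].
rewrite -[RHS](product_measure1E lebesgue_measure (borel_lebesgue n) (mA ord0) mS).
congr (_ _).
apply/seteqP; split => [[x v] /= Av|[x v] /= [Ax Av] i].
  split; first by have := Av ord0; rewrite mxE unlift_none.
  by move=> i; have := Av (lift ord0 i); rewrite mxE liftK.
by rewrite mxE; case: unliftP => [k ->|->]; [exact: Av|].
Qed.

(* The Caratheodory sets of the outer measure of borel_lebesgue n are exactly
   the Lebesgue-measurable subsets of R^n. *)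
Definition lebesgue_type n : measurableType _ :=
  caratheodory_type (borel_lebesgue n)^*%mu.

Definition lebesgue_rV n : set (lebesgue_type n) -> \bar R :=
  @completed_measure_extension _ _ _ (borel_lebesgue n).

HB.instance Definition _ n := Measure.on (@lebesgue_rV n).

Let lebesgue_rV_sigma_finite n : sigma_finite setT (@lebesgue_rV n).
Proof. exact/completed_measure_extension_sigma_finite/sigma_finiteT. Qed.

HB.instance Definition _ n := @Measure_isSigmaFinite.Build _ _ _
  (@lebesgue_rV n) (@lebesgue_rV_sigma_finite n).

End lebesgue_measure_rV.
Arguments lebesgue_rV {R n}.

Section morrey.
Context {R : realType} {n : nat}.
Local Notation "'Rn'" := 'rV[R]_n.
Local Notation lam := (@lebesgue_rV R n).
Implicit Types (x y z : Rn) (r t sigma : R) (B E : set Rn) (w : Rn -> R).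

(* The library's norm on 'rV[R]_n is the sup norm. *)
Definition eucl_norm x : R := Num.sqrt (\sum_(i < n) x ord0 i ^+ 2).

Definition eball x r : set Rn := [set y | eucl_norm (y - x) < r].

Definition eucl_balls : set (set Rn) :=
  [set B | exists x r, 0 < r /\ B = eball x r].

Definition locally_integrable_rV (f : Rn -> R) :=
  measurable_fun [set: lebesgue_type n] f /\
  forall K : set Rn, compact K -> (\int[lam]_(x in K) `|f x|%:E < +oo)%E.

Definition weight w := (forall x, 0 < w x) /\ locally_integrable_rV w.

Definition wmeas w E : \bar R := \int[lam]_(x in E) (w x)%:E.

(* Setting w to +oo outside B turns the global essential infimum into the one
   over B. *)
Definition ess_inf_on B w : \bar R :=
  ess_inf lam (patch (cst +oo%E) B (EFin \o w)).

Definition A1 w := exists2 C : R, 0 < C & forall B, eucl_balls B ->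
  ((fine (lam B))^-1%:E * wmeas w B <= C%:E * ess_inf_on B w)%E.

Definition D_kappa (kappa : R) (theta : R -> R) := [/\
  forall xi : R, 0 < xi -> 0 < theta xi,
  forall xi' xi : R, 0 < xi' -> xi' <= xi -> theta xi' <= theta xi &
  exists2 C : R, 0 < C & forall xi' xi : R, 0 < xi' -> xi' < xi ->
    theta xi / xi `^ kappa <= C * (theta xi' / xi' `^ kappa)].

Definition C_alpha (alpha : R) : set (Rn -> R) := [set phi |
  [/\ forall x, 1 < eucl_norm x -> phi x = 0,
      (\int[lam]_x (phi x)%:E = 0)%E &
      forall x x', `|phi x - phi x'| <= eucl_norm (x - x') `^ alpha]].

Definition dilate (phi : Rn -> R) t y : R := (t ^+ n)^-1 * phi (t^-1 *: y).

Definition cone x : set (Rn * R) :=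
  [set p | 0 < p.2 /\ eucl_norm (x - p.1) < p.2].

(* (y, t) |-> sup over phi of |(phi_t * f)(y)|. *)
Definition A_alpha alpha (f : Rn -> R) y t : \bar R :=
  ereal_sup [set `| \int[lam]_z (dilate phi t (y - z) * f z)%:E |%E
            | phi in C_alpha alpha].

Definition S_alpha alpha (f : Rn -> R) x : \bar R :=
  ((\int[lam \x lebesgue_measure]_(p in cone x)
     (A_alpha alpha f p.1 p.2 ^+ 2 * (p.2 ^+ n.+1)^-1%:E)) `^ 2^-1)%E.

Definition l2_norm (g : nat -> Rn -> \bar R) x : \bar R :=
  ((\sum_(0 <= j <oo) `| g j x | ^+ 2) `^ 2^-1)%E.

(* Both norms take extended-real functions because l2_norm can be infinite;
   w(B) is positive and finite when w is a weight, so fine loses nothing. *)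
Definition morrey_norm (theta : R -> R) w (g : Rn -> \bar R) : \bar R :=
  ereal_sup [set ((theta (fine (wmeas w B)))^-1%:E *
                  \int[lam]_(x in B) (`|g x| * (w x)%:E))%E
            | B in eucl_balls].

Definition weak_morrey_norm (theta : R -> R) w (g : Rn -> \bar R) : \bar R :=
  ereal_sup [set
    ereal_sup [set ((theta (fine (wmeas w B)))^-1%:E *
                    (sigma%:E *
                     wmeas w [set x | B x /\ sigma%:E < `|g x|]))%E
              | sigma in [set sigma | (0 < sigma)%R]]
  | B in eucl_balls].

End morrey.

(* Main.v *)
(* The cone integral is cut along the dyadic boxes (2^k, 2^(k+1)] x (cubes of
   radius 2^k centred on 2^k Z^n).  On each box the supremum over C_alpha of the
   convolutions is at most twice one pairing of f_j with a function adapted to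
   the box, so S_alpha(f_j)^2 is dominated by a dyadic sum of squared pairings;
   it suffices to bound its finite partial sums uniformly.
   Unweighted L^2 bounds for such sums follow from almost orthogonality and a
   Schur test.  For an A_1 weight one decomposes according to the size of the
   averages of w over the boxes: where that average is about 2^k, w is at least
   c 2^k on the box, which reduces to the unweighted bound.
   The weak type (1,1) bound comes from a Calderon-Zygmund decomposition of
   |f|_{l^2} that starts from one large cube and stops after finitely many
   subdivisions.  For the Morrey norms, f is split at a fixed multiple of the
   ball: the near part uses weak type (1,1), the far part is bounded pointwise,
   its dyadic series converging because w is reverse doubling and kappa < 1. *)
Require Import Defs.
From HB Require Import structures.
From mathcomp Require Import all_boot all_order all_algebra.
From mathcomp Require Import all_classical all_reals all_analysis.
From mathcomp Require Import measurable_realfun ess_sup_inf ring lra zify.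

Set Implicit Arguments.
Unset Strict Implicit.
Unset Printing Implicit Defensive.

Import Order.TTheory GRing.Theory Num.Theory.
Import numFieldNormedType.Exports.

Local Open Scope classical_set_scope.
Local Open Scope ring_scope.

(** * Real-valued integrals *)

(** The supremum over [C_alpha] is not linear in f, which blocks orthogonality; one test function
    per box and per j makes it a linear pairing. Every estimate must therefore be uniform over all
    families satisfying [adapted], and over the finite list of boxes and the number of functions.
    Cubes are half-open: they subdivide into exact partitions, have explicit volume, and reduce
    containments to inequalities on coordinates. Balls occur only where the A_1 condition and the
    norms are translated. A_1 is used as the inequality w(Q) <= A r^n w(z) for almost every z in Q.
    Multiplied by |f| and integrated, it replaces both the maximal function and the doubling of w in
    the weak type bound. In the Calderon-Zygmund step the mean is subtracted from the test function
    on each cell, not from f. The bad part is never formed as a function, and the Hoelder regularity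
    of the test function provides the decay. Stopping at a finite depth dispenses with Lebesgue
    differentiation. The price is an error on the unselected cells; the depth that makes it small
    may depend on f and on the boxes, because it does not enter the final constant. *)

Lemma indic_le1 (T : Type) (R : realType) (E : set T) x : `|\1_E x| <= 1 :> R.
Proof. by rewrite indicE; case: (x \in E); rewrite /= ?normr1 ?normr0. Qed.

Lemma indic_le (T : Type) (R : realType) (E : set T) x : \1_E x <= 1 :> R.
Proof. by rewrite indicE; case: (x \in E). Qed.

Lemma indic_ge0 (T : Type) (R : realType) (E : set T) x : 0 <= \1_E x :> R.
Proof. by rewrite indicE. Qed.

Section real_integral.
Context d (T : measurableType d) (R : realType).
Variable mu : {measure set T -> \bar R}.
Local Notation L1 f := (mu.-integrable setT (EFin \o f)).
Implicit Types (f g h : T -> R) (k : R).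

Lemma L1_measurable f : L1 f -> measurable_fun setT f.
Proof. by move=> /integrableP[/measurable_EFinP]. Qed.

Lemma L1_le f g : measurable_fun setT f -> L1 g ->
  (forall x, `|f x| <= g x) -> L1 f.
Proof.
move=> mf ig fg; apply: (le_integrable _ _ _ ig) => //.
  exact/measurable_EFinP.
move=> x _ /=; rewrite lee_fin (le_trans (fg x))//.
by rewrite ler_norm.
Qed.

Lemma L1Z k f : L1 f -> L1 (fun x => k * f x).
Proof. by move=> /(integrableZl measurableT k). Qed.

Lemma L1D f g : L1 f -> L1 g -> L1 (fun x => f x + g x).
Proof. by move=> fi gi; have := integrableD measurableT fi gi. Qed.

Lemma L1B f g : L1 f -> L1 g -> L1 (fun x => f x - g x).
Proof. by move=> fi gi; have := integrableB measurableT fi gi. Qed.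

Lemma L1_0 : L1 (fun=> 0).
Proof. exact: integrable0. Qed.

Lemma L1_sum (I : Type) (s : seq I) (P : pred I) (h : I -> T -> R) :
  (forall i, L1 (h i)) -> L1 (fun x => \sum_(i <- s | P i) h i x).
Proof.
move=> hi; elim: s => [|i s IH].
  by under [X in _.-integrable _ X]funext do rewrite /= big_nil; exact: L1_0.
case: (boolP (P i)) => Pi.
  under [X in _.-integrable _ X]funext do rewrite /= big_cons Pi.
  exact: (L1D (hi i) IH).
by under [X in _.-integrable _ X]funext do rewrite /= big_cons (negbTE Pi).
Qed.

Lemma L1_norm f : L1 f -> L1 (fun x => `|f x|).
Proof. exact: integrable_norm. Qed.

Lemma L1M k h f : measurable_fun setT h -> (forall x, `|h x| <= k) -> L1 f ->
  L1 (fun x => h x * f x).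
Proof.
move=> mh hk fi; apply: (@L1_le _ (fun x => k * `|f x|)).
- exact: (measurable_funM mh (L1_measurable fi)).
- exact/L1Z/L1_norm.
- by move=> x; rewrite normrM ler_wpM2r.
Qed.

Lemma measurable_indicT (E : set T) : measurable E ->
  measurable_fun setT (\1_E : T -> R).
Proof. by move=> mE; exact: measurable_indic. Qed.

Lemma L1_indic (E : set T) f : measurable E -> L1 f ->
  L1 (fun x => \1_E x * f x).
Proof.
move=> mE; apply: L1M; first exact: measurable_indicT.
exact: indic_le1.
Qed.

Lemma L1_indic1 (E : set T) : measurable E -> (mu E < +oo)%E ->
  L1 (\1_E : T -> R).
Proof.
move=> mE Eoo; apply/integrableP; split.
  exact/measurable_EFinP/measurable_indicT.
under eq_integral do rewrite /= ger0_norm ?indic_ge0//.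
by rewrite integral_indic// setIT.
Qed.

Lemma IZ k f : L1 f -> \int[mu]_x (k * f x) = k * \int[mu]_x f x.
Proof. exact: RintegralZl. Qed.

Lemma ID f g : L1 f -> L1 g ->
  \int[mu]_x (f x + g x) = \int[mu]_x f x + \int[mu]_x g x.
Proof. by move=> fi gi; have := RintegralD measurableT fi gi. Qed.

Lemma IB f g : L1 f -> L1 g ->
  \int[mu]_x (f x - g x) = \int[mu]_x f x - \int[mu]_x g x.
Proof. by move=> fi gi; have := RintegralB measurableT fi gi. Qed.

Lemma I0 : \int[mu]_x 0 = 0 :> R.
Proof. by rewrite /Rintegral integral0. Qed.

Lemma eq_I f g : f =1 g -> \int[mu]_x f x = \int[mu]_x g x.
Proof. by move=> fg; apply: eq_Rintegral => x _; exact: fg. Qed.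

Lemma Isum (I : Type) (s : seq I) (P : pred I) (h : I -> T -> R) :
  (forall i, L1 (h i)) ->
  \int[mu]_x (\sum_(i <- s | P i) h i x) = \sum_(i <- s | P i) \int[mu]_x h i x.
Proof.
move=> hi; elim: s => [|i s IH].
  by rewrite big_nil -[RHS]I0; apply: eq_I => x; rewrite big_nil.
rewrite big_cons -IH; case: (boolP (P i)) => Pi.
  rewrite -ID//; last exact: L1_sum.
  by apply: eq_I => x; rewrite big_cons Pi.
by apply: eq_I => x; rewrite big_cons (negbTE Pi).
Qed.

Lemma I_le f g : L1 f -> L1 g -> (forall x, f x <= g x) ->
  \int[mu]_x f x <= \int[mu]_x g x.
Proof. by move=> fi gi fg; apply: le_Rintegral => // x _. Qed.

Lemma I_ge0 f : (forall x, 0 <= f x) -> 0 <= \int[mu]_x f x.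
Proof. by move=> f0; apply: Rintegral_ge0 => x _. Qed.

Lemma I_le_ae f g : L1 f -> L1 g -> (forall x, 0 <= f x) ->
  (forall x, 0 <= g x) -> {ae mu, forall x, f x <= g x} ->
  \int[mu]_x f x <= \int[mu]_x g x.
Proof.
move=> fi gi f0 g0 fg; rewrite /Rintegral; apply: fine_le.
- exact: integrable_fin_num.
- exact: integrable_fin_num.
apply: ae_ge0_le_integral => //.
- by move=> x _; rewrite lee_fin.
- exact/measurable_EFinP/L1_measurable.
- by move=> x _; rewrite lee_fin.
- exact/measurable_EFinP/L1_measurable.
- by move: fg; apply: filterS => x fg _; rewrite lee_fin.
Qed.

Lemma I_eq_ae f g : L1 f -> L1 g -> {ae mu, forall x, f x = g x} ->
  \int[mu]_x f x = \int[mu]_x g x.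
Proof.
move=> fi gi fg; congr fine; apply: ae_eq_integral => //.
- exact/measurable_EFinP/L1_measurable.
- exact/measurable_EFinP/L1_measurable.
- by move: fg; apply: filterS => x /= -> _.
Qed.

Lemma I_abs f : L1 f -> `|\int[mu]_x f x| <= \int[mu]_x `|f x|.
Proof. exact: le_normr_Rintegral. Qed.

Lemma I_abs_le f g : L1 f -> L1 g -> (forall x, `|f x| <= g x) ->
  `|\int[mu]_x f x| <= \int[mu]_x g x.
Proof.
move=> fi gi fg; apply: (le_trans (I_abs fi)).
by apply: I_le => //; exact: L1_norm.
Qed.

Lemma EFin_I f : L1 f -> (\int[mu]_x f x)%:E = (\int[mu]_x (f x)%:E)%E.
Proof. by move=> fi; rewrite /Rintegral fineK//; exact: integrable_fin_num. Qed.

Lemma integral_indicM (E : set T) f :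
  (\int[mu]_(x in E) (f x)%:E = \int[mu]_x (\1_E x * f x)%:E)%E.
Proof.
rewrite integral_mkcond; apply: eq_integral => x _.
rewrite patchE indicE; case: (x \in E) => /=; first by rewrite mul1r.
by rewrite mul0r.
Qed.

End real_integral.

(** * Cubes *)

Section boxes.
Context {R : realType} {n : nat}.
Local Notation Rn := 'rV[R]_n.
Local Notation lam := (@lebesgue_rV R n).
Local Notation L1 f := (lam.-integrable setT (EFin \o f)).
Implicit Types (x y z c : Rn) (r s t l : R).

Definition cube c r : set Rn :=
  [set z | forall i, c ord0 i - r <= z ord0 i < c ord0 i + r].

Definition supdist_le r x y := forall i, `|x ord0 i - y ord0 i| <= r.

Lemma borel_lebesgue_measurable (A : set Rn) :
  measurable A -> measurable (A : set (lebesgue_type n)).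
Proof. by move=> mA; apply: sub_caratheodory; exact: sub_sigma_algebra. Qed.

Lemma measurable_lebesgue_type d (T : measurableType d) (f : Rn -> T) :
  measurable_fun setT f -> measurable_fun [set: lebesgue_type n] f.
Proof.
move=> mf _ Y mY; apply: borel_lebesgue_measurable.
exact: (mf measurableT).
Qed.

Lemma lebesgue_rVE (A : set Rn) : measurable A ->
  lam A = borel_lebesgue n A.
Proof. by move=> mA; rewrite /lebesgue_rV /completed_measure_extension measurable_mu_extE. Qed.

Lemma measurable_box (A : 'I_n -> set R) : (forall i, measurable (A i)) ->
  measurable [set v : Rn | forall i, A i (v ord0 i)].
Proof.
move=> mA; rewrite (_ : [set _ | _] = \bigcap_(i in [set: 'I_n])
    ((fun v : Rn => v ord0 i) @^-1` A i)).
  apply: fin_bigcap_measurable => // i _.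
  by rewrite -[X in measurable X]setTI; exact: measurable_coord.
by apply/seteqP; split => [v Av i _|v Av i] /=; [exact: Av|exact: (Av i)].
Qed.

Lemma cubeE c r : cube c r =
  [set z | forall i, `[c ord0 i - r, c ord0 i + r[%classic (z ord0 i)].
Proof.
by apply/seteqP; split => z /= cz i; move: (cz i); rewrite in_itv.
Qed.

Lemma measurable_cube0 c r : measurable (cube c r).
Proof.
rewrite cubeE.
apply: (@measurable_box (fun i => `[c ord0 i - r, c ord0 i + r[%classic)) => i.
exact: measurable_itv.
Qed.

Lemma measurable_cube c r : measurable (cube c r : set (lebesgue_type n)).
Proof. apply: borel_lebesgue_measurable; exact: measurable_cube0. Qed.

Lemma lam_cube c r : 0 < r -> lam (cube c r) = ((2 * r) ^+ n)%:E.
Proof.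
move=> r0; rewrite lebesgue_rVE; last exact: measurable_cube0.
rewrite cubeE.
rewrite (@borel_lebesgue_box _ n (fun i => `[c ord0 i - r, c ord0 i + r[%classic)); last first.
  by move=> i; exact: measurable_itv.
under eq_bigr => i _.
  rewrite lebesgue_measure_itv/= lte_fin.
  have -> : (c ord0 i - r < c ord0 i + r) = true by lra.
  rewrite -EFinD (_ : _ - _ = 2 * r); last by ring.
  over.
by rewrite prodEFin prodr_const card_ord.
Qed.

Lemma sub_cube c c' r s : supdist_le (s - r) c c' -> cube c r `<=` cube c' s.
Proof.
move=> cc z cz i; have := cc i; have := cz i.
by rewrite ler_norml => /andP[? ?] /andP[? ?]; apply/andP; split; lra.
Qed.

Lemma supdist_le_sym r x y : supdist_le r x y -> supdist_le r y x.
Proof. by move=> xy i; rewrite distrC. Qed.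

Lemma supdist_le_refl r x : 0 <= r -> supdist_le r x x.
Proof. by move=> r0 i; rewrite subrr normr0. Qed.

Lemma supdist_le_trans r s x y z : supdist_le r x y -> supdist_le s y z ->
  supdist_le (r + s) x z.
Proof.
move=> xy yz i; rewrite (_ : _ - _ = (x ord0 i - y ord0 i) + (y ord0 i - z ord0 i)); last by ring.
by rewrite (le_trans (ler_normD _ _))// lerD.
Qed.

Lemma supdist_le_le r s x y : r <= s -> supdist_le r x y -> supdist_le s x y.
Proof. by move=> rs xy i; exact: (le_trans (xy i)). Qed.

Lemma cube_supdist_le c r z : cube c r z -> supdist_le r c z.
Proof.
move=> cz i; have := cz i; rewrite ler_norml => /andP[? ?].
by apply/andP; split; lra.
Qed.

Lemma supdist_le_cube c r s z : r < s -> supdist_le r c z -> cube c s z.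
Proof.
move=> rs cz i; have := cz i; rewrite ler_norml => /andP[? ?].
by apply/andP; split; lra.
Qed.

Lemma sub_cube_radius c r s : r <= s -> cube c r `<=` cube c s.
Proof. by move=> rs; apply: sub_cube; apply: supdist_le_refl; rewrite subr_ge0. Qed.

Lemma cube_compact c r : exists K : set Rn,
  [/\ compact K, measurable (K : set (lebesgue_type n)) & cube c r `<=` K].
Proof.
exists [set z : Rn | forall i, `[c ord0 i - r, c ord0 i + r]%classic (z ord0 i)].
split.
- apply: (@rV_compact _ _ (fun i => `[c ord0 i - r, c ord0 i + r]%classic)) => i.
  exact: segment_compact.
- apply: borel_lebesgue_measurable.
  apply: (@measurable_box (fun i => `[c ord0 i - r, c ord0 i + r]%classic)) => i.
  exact: measurable_itv.
- by move=> z cz i /=; have := cz i; rewrite in_itv/= => /andP[-> /ltW].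
Qed.

(** Sampling [psi] at the grid of mesh 1/(N+1) gives functions constant on countably many boxes,
    hence measurable for the sigma-algebra generated by the coordinates; uniform continuity makes
    them converge to [psi]. *)
Lemma measurable_unif (psi : Rn -> R) :
  (forall e, 0 < e -> exists2 r, 0 < r &
    forall z z', supdist_le r z z' -> `|psi z - psi z'| <= e) ->
  measurable_fun setT psi.
Proof.
move=> psiU.
pose grid N z : Rn := \row_i ((Num.floor (z ord0 i * N.+1%:R))%:~R / N.+1%:R).
have gridP N z : supdist_le (N.+1%:R^-1) z (grid N z).
  move=> i; rewrite mxE; set u := z ord0 i * _.
  have -> : z ord0 i = u / N.+1%:R by rewrite /u mulfK.
  rewrite -mulrBl normrM [X in _ * X]ger0_norm ?invr_ge0//.
  rewrite ler_piMl ?invr_ge0//.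
  have /andP[] := floor_itv u; rewrite intrD => h1 h2.
  by rewrite ger0_norm; lra.
apply: (@measurable_fun_cvg _ _ _ setT (fun N z => psi (grid N z)) psi).
- move=> N _ Y mY; rewrite setTI.
  pose P (m : 'rV[int]_n) := Y (psi (\row_i ((m ord0 i)%:~R / N.+1%:R))).
  pose G (m : 'rV[int]_n) : set Rn :=
    [set v | forall i, [set t | Num.floor (t * N.+1%:R) = m ord0 i] (v ord0 i)].
  rewrite [X in measurable X](_ : _ =
      \bigcup_m [set v | P m /\ G m v]).
    apply: countable_bigcupT_measurable; first exact: countableP.
    move=> m; have [Pm|Pm] := pselect (P m); last first.
      rewrite [X in measurable X](_ : _ = set0); first exact: measurable0.
      by apply/seteqP; split => // v [].
    rewrite [X in measurable X](_ : _ = G m); last first.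
      by apply/seteqP; split => // v [].
    apply: (@measurable_box (fun i => [set t : R | Num.floor (t * N.+1%:R) = m ord0 i])) => i.
    rewrite -[X in measurable X]setTI.
    have mf : measurable_fun setT (fun t : R => t * N.+1%:R).
      by apply: measurable_funM => //.
    rewrite (_ : [set _ | _] = (fun t : R => t * N.+1%:R) @^-1`
        `[(m ord0 i)%:~R, (m ord0 i + 1)%:~R[%classic).
      exact: mf.
    apply/seteqP; split => t /=; rewrite in_itv/= -floor_eq.
      by move=> ->.
    by move=> /eqP.
  apply/seteqP; split => v /=.
    move=> Yv; exists (\row_i Num.floor (v ord0 i * N.+1%:R)) => //=.
    split => [|i /=]; last by rewrite mxE.
    by congr (Y (psi _)) : Yv; apply/rowP => i; rewrite !mxE.
  move=> [m _ [Pm mv]]; congr (Y (psi _)) : Pm.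
  by apply/rowP => i; rewrite !mxE mv.
- move=> z _; apply/cvgrPdist_le => e e0.
  have [r r0 psir] := psiU _ e0.
  near=> N; apply: psir; apply: supdist_le_le (gridP N z).
  near: N; have := near_infty_natSinv_lt (PosNum r0).
by apply: filterS => N /ltW.
Unshelve. all: by end_near. Qed.

End boxes.

(** * Reflection invariance of Lebesgue measure *)

Lemma pushforward_measureP d d' (T1 : measurableType d) (T2 : measurableType d')
    (R : realFieldType) (m : {measure set T1 -> \bar R}) (f : T1 -> T2) :
  measurable_fun setT f ->
  exists p : {measure set T2 -> \bar R}, forall A, p A = m (f @^-1` A).
Proof.
move=> mf.
by exists (measure_function_pushforward__canonical__measure_function_Measure m mf).
Qed.

Section affine.
Context {R : realType}.

Definition reflect1 (t y s : R) : measurableTypeR R := t^-1 * (y - s).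

Lemma measurable_reflect1 t y :
  measurable_fun [set: measurableTypeR R] (reflect1 t y).
Proof.
apply: measurable_funM => //; apply: measurable_funB => //.
Qed.

(** The pushforward rescaled by 1/t agrees with Lebesgue measure on half-open intervals, which
    determine it; the reflection swaps open and closed ends, invisible to length. *)
Lemma lebesgue_reflect1 (t y : R) (A : set (measurableTypeR R)) : 0 < t ->
  measurable A ->
  lebesgue_measure (reflect1 t y @^-1` A) = (t%:E * lebesgue_measure A)%E.
Proof.
move=> t0 mA.
have ti0 : 0 <= t^-1 by rewrite invr_ge0 ltW.
have [p pE] := pushforward_measureP (@lebesgue_measure R)
  (measurable_reflect1 t y).
pose m := mscale (NngNum ti0) p.
have mE : forall X, ocitv X -> lebesgue_measure X = m X.
  move=> _ [[a b]] _ <-; rewrite /m /mscale pE /=.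
  rewrite [X in (_ * lebesgue_measure X)%E](_ : _ = `[y - t * b, y - t * a[%classic).
    rewrite !lebesgue_measure_itv/= !lte_fin.
    rewrite (_ : (y - t * b < y - t * a) = (a < b)); last first.
      by rewrite ltrD2l ltrN2 ltr_pM2l.
    case: ifP => _; last by rewrite mule0.
    rewrite -!EFinB -EFinM; congr EFin; field; exact: lt0r_neq0.
  apply/seteqP; split => s /=; rewrite !in_itv/= /reflect1 => /andP[h1 h2].
    apply/andP; split.
      by move: h2; rewrite mulrC ler_pdivrMr//; lra.
    by move: h1; rewrite [X in _ < X]mulrC ltr_pdivlMr//; lra.
  apply/andP; split.
    by rewrite [X in _ < X]mulrC ltr_pdivlMr//; lra.
  by rewrite mulrC ler_pdivrMr//; lra.
have H : lebesgue_measure A = m A := lebesgue_measure_unique mE mA.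
rewrite H /m /mscale pE /= muleA.
by rewrite -EFinM divff ?lt0r_neq0// mul1e.
Qed.

Context {n : nat}.
Local Notation Rn := 'rV[R]_n.

Definition reflect (t : R) (y : Rn) (z : Rn) : Rn := t^-1 *: (y - z).

Lemma measurable_reflect t y : measurable_fun setT (reflect t y).
Proof.
apply: measurable_fun_coordP => i; rewrite /reflect.
under [X in measurable_fun _ X]funext do rewrite !mxE.
apply: measurable_funM => //; apply: measurable_funB => //.
exact: measurable_coord.
Qed.

(** Boxes are stable under intersection, unlike the preimages under single coordinates; uniqueness
    of measures requires such a generating family. *)
Lemma measurable_rVE : (@measurable _ Rn) = <<s [set B : set Rn |
  exists2 A : 'I_n -> set R, (forall i, measurable (A i)) &
    B = [set v | forall i, A i (v ord0 i)]] >>.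
Proof.
apply/seteqP; split.
  apply: smallest_sub; first exact: smallest_sigma_algebra.
  rewrite -bigcup_seq => A [i _ [B mB <-]] /=; apply: sub_sigma_algebra.
  exists (fun j => if j == i then B else setT).
    by move=> j; case: (j == i).
  rewrite setTI; apply/seteqP; split => v /=.
    by move=> Bv j; case: eqP => // ->.
  by move=> /(_ i); rewrite eqxx.
apply: smallest_sub; first exact: sigma_algebra_measurable.
by move=> _ [A mA ->]; exact: measurable_box.
Qed.

(** On boxes the claim is the product of the one-dimensional ones. The cubes [-k, k]^n exhaust the
    space with finite measure, so agreement on boxes suffices. *)
Lemma borel_lebesgue_reflect (t : R) (y : Rn) (A : set Rn) : 0 < t ->
  measurable A ->
  borel_lebesgue n (reflect t y @^-1` A) = ((t ^+ n)%:E * borel_lebesgue n A)%E.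
Proof.
move=> t0 mA.
have ti0 : 0 <= (t ^+ n)^-1 by rewrite invr_ge0 exprn_ge0// ltW.
have [p pE] := pushforward_measureP (borel_lebesgue n) (measurable_reflect t y).
pose m := mscale (NngNum ti0) p.
suff H : borel_lebesgue n A = m A.
  rewrite H /m /mscale pE /= muleA -EFinM divff ?mul1e//.
  by rewrite lt0r_neq0// exprn_gt0.
pose g (k : nat) : set Rn :=
  [set v | forall i, `[- k%:R, k%:R]%classic (v ord0 i)].
apply: (measure_unique _ g measurable_rVE) => //.
- move=> _ _ [A1 mA1 ->] [A2 mA2 ->].
  exists (fun i => A1 i `&` A2 i); first by move=> i; exact: measurableI.
  by apply/seteqP; split => v /= => [[h1 h2] i|h]; split => // i; have [] := h i.
- move=> k; exists (fun=> `[- k%:R, k%:R]%classic) => // i.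
- apply/seteqP; split => // v _.
  exists (Num.truncn (\sum_i `|v ord0 i|)).+1 => // i /=.
  rewrite in_itv/= -ler_norml.
  apply: (@le_trans _ _ (\sum_i `|v ord0 i|)).
    by rewrite (bigD1 i)//= lerDl sumr_ge0.
  by rewrite ltW// truncnS_gt.
- move=> _ [A' mA' ->]; rewrite /= /mscale pE /=.
  have -> : reflect t y @^-1` [set v | forall i, A' i (v ord0 i)] =
    [set v | forall i, (reflect1 t (y ord0 i) @^-1` A' i) (v ord0 i)].
    by apply/seteqP; split => v /= h i; have := h i; rewrite !mxE.
  rewrite (@borel_lebesgue_box _ n A' mA').
  rewrite (@borel_lebesgue_box _ n (fun i => reflect1 t (y ord0 i) @^-1` A' i)); last first.
    move=> i; rewrite -[X in measurable X]setTI; exact: (measurable_reflect1 t (y ord0 i) measurableT (mA' i)).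
  have -> : (\prod_(i < n) lebesgue_measure (reflect1 t (y ord0 i) @^-1` A' i) =
      (t ^+ n)%:E * \prod_(i < n) lebesgue_measure (A' i))%E.
    transitivity (\prod_(i < n) (t%:E * lebesgue_measure (A' i)))%E.
      by apply: eq_bigr => i _; rewrite (lebesgue_reflect1 (y ord0 i) t0 (mA' i)).
    rewrite (big_split ( *%E : Monoid.com_law 1%E)) /=.
    by rewrite prodEFin prodr_const card_ord.
  rewrite muleA -EFinM mulVf ?mul1e//.
  by rewrite lt0r_neq0// exprn_gt0.
- move=> k.
  have mI (i : 'I_n) : measurable (`[- k%:R, k%:R]%classic : set R) by [].
  have H := borel_lebesgue_box mI.
  suff Hlt : (borel_lebesgue n (g k) < +oo)%E by exact: Hlt.
  move: H; rewrite -/(g k) => ->.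
  under eq_bigr do rewrite lebesgue_measure_itv/= lte_fin.
  by case: ifP => _; rewrite -?EFinB prodEFin ltry.
Qed.

Local Notation lam := (@lebesgue_rV R n).

(* On Borel functions, integrating against the completed measure or the Borel
   one is the same. *)
Lemma ge0_integral_lebesgue_rV (f : Rn -> \bar R) : measurable_fun setT f ->
  (forall x, 0 <= f x)%E ->
  (\int[lam]_x f x = \int[borel_lebesgue n]_x f x)%E.
Proof.
move=> mf f0.
have mid : measurable_fun [set: lebesgue_type n] (id : lebesgue_type n -> Rn).
  by move=> _ Y mY; rewrite setTI; exact: borel_lebesgue_measurable.
have := ge0_integral_pushforward mid lam (D := setT) measurableT mf (fun x _ => f0 x).
rewrite preimage_setT => /= <-.
by apply: eq_measure_integral => A mA _; rewrite /pushforward /= -lebesgue_rVE.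
Qed.

Lemma ge0_integral_reflect (t : R) (y : Rn) (f : Rn -> \bar R) : 0 < t ->
  measurable_fun setT f -> (forall x, 0 <= f x)%E ->
  (\int[lam]_x f (reflect t y x) = (t ^+ n)%:E * \int[lam]_x f x)%E.
Proof.
move=> t0 mf f0; have tn0 : 0 <= t ^+ n by rewrite exprn_ge0// ltW.
rewrite ge0_integral_lebesgue_rV//; last first.
  exact: (measurableT_comp mf (measurable_reflect t y)).
have := ge0_integral_pushforward (measurable_reflect t y) (borel_lebesgue n)
  (D := setT) measurableT mf (fun x _ => f0 x).
rewrite preimage_setT /= => <-; rewrite ge0_integral_lebesgue_rV//.
have := ge0_integral_mscale (borel_lebesgue n) measurableT (NngNum tn0)
  mf (fun x _ => f0 x).
move=> <-; apply: eq_measure_integral => [|? A mA _]; first exact: measurable_reflect.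
exact: (borel_lebesgue_reflect y t0 mA).
Qed.

(** Carries the mean zero condition to dilates. Positive and negative parts scale by the same
    [t ^+ n], and a vanishing integral forces them to be finite and equal, since +oo - +oo is
    -oo. *)
Lemma integral_reflect (t : R) (y : Rn) (f : Rn -> \bar R) : 0 < t ->
  measurable_fun setT f ->
  (\int[lam]_x f x = 0)%E ->
  (\int[lam]_x f (reflect t y x) = 0)%E.
Proof.
move=> t0 mf; rewrite [in LHS]integralE [in X in _ -> X]integralE.
have -> : ((fun x => f (reflect t y x))^\+ = fun x => f^\+ (reflect t y x))%E.
  by apply/funext => x; rewrite !funeposE.
have -> : ((fun x => f (reflect t y x))^\- = fun x => f^\- (reflect t y x))%E.
  by apply/funext => x; rewrite !funenegE.
rewrite !ge0_integral_reflect//; last 2 first.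
  exact: measurable_funeneg.
  exact: measurable_funepos.
have : (0 <= \int[lam]_x f^\+ x)%E by exact: integral_ge0.
have : (0 <= \int[lam]_x f^\- x)%E by exact: integral_ge0.
case: (\int[lam]_x f^\- x)%E => // [a|]; case: (\int[lam]_x f^\+ x)%E => // b.
by move=> _ _ /eqP; rewrite -EFinB eqe subr_eq0 => /eqP ->; rewrite subee.
Qed.

End affine.

(** * Counting dyadic boxes *)

Section counting.
Context {R : realType}.
Implicit Types (y b l u rho : R).

(** A duplicate-free list sits inside an initial segment of the naturals, so a partial geometric sum
    dominates. *)
Lemma sum_expr_uniq_nat y (s : seq nat) : 0 <= y -> y < 1 -> uniq s ->
  \sum_(j <- s) y ^+ j <= (1 - y)^-1.
Proof.
move=> y0 y1 us.
set N := (\sum_(j <- s) j).+1.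
have sN j : j \in s -> (j < N)%N.
  move=> js; rewrite /N ltnS; move: js; elim: (s) => // a s' IH.
  rewrite inE big_cons => /predU1P[->|/IH]; first exact: leq_addr.
  by move=> /leq_trans; apply; exact: leq_addl.
have -> : \sum_(j <- s) y ^+ j = \sum_(j <- iota 0 N | j \in s) y ^+ j.
  rewrite -[RHS]big_filter; apply: perm_big; apply: uniq_perm => //.
    by rewrite filter_uniq// iota_uniq.
  move=> j; rewrite mem_filter mem_iota /= add0n.
  by case: (boolP (j \in s)) => // /sN ->.
have le1 : \sum_(j <- iota 0 N | j \in s) y ^+ j <= \sum_(j <- iota 0 N) y ^+ j.
  rewrite [leRHS](bigID (mem s)) /= lerDl sumr_ge0// => j _.
  exact: exprn_ge0.
apply: (le_trans le1).
have -> : \sum_(j <- iota 0 N) y ^+ j = \sum_(j < N) y ^+ j.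
  by rewrite -[N in LHS]subn0 -/(index_iota 0 N) big_mkord.
rewrite -[leRHS]mul1r ler_pdivlMr ?subr_gt0// mulrC.
by rewrite -[1 - y]opprB mulNr -subrX1 opprB lerBlDr lerDl exprn_ge0.
Qed.

Lemma sum_expr_uniq_int y (s : seq int) (k0 : int) : 0 <= y -> y < 1 ->
  uniq s -> \sum_(k <- s) y ^+ absz (k - k0) <= 2 * (1 - y)^-1.
Proof.
move=> y0 y1 us.
rewrite (bigID (fun k => k0 <= k)) /= mulr_natl mulr2n lerD//.
  rewrite -big_filter -(big_map (fun k => absz (k - k0)) xpredT (fun j => y ^+ j)).
  apply: sum_expr_uniq_nat => //; rewrite map_inj_in_uniq ?filter_uniq//.
  by move=> k k'; rewrite !mem_filter => /andP[? _] /andP[? _]; lia.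
rewrite -big_filter -(big_map (fun k => absz (k - k0)) xpredT (fun j => y ^+ j)).
apply: sum_expr_uniq_nat => //; rewrite map_inj_in_uniq ?filter_uniq//.
by move=> k k'; rewrite !mem_filter => /andP[? _] /andP[? _]; lia.
Qed.

Lemma ltr_pow2 u v : u < v -> 2 `^ u < 2 `^ v :> R.
Proof.
move=> uv; rewrite /powR !ifF ?pnatr_eq0//.
by rewrite ltr_expR ltr_pM2r// ln_gt0// ltr1n.
Qed.

Lemma powR_expr u v k : 0 <= u -> (u ^+ k) `^ v = (u `^ v) ^+ k.
Proof.
by move=> u0; rewrite -(powR_mulrn k u0) -(powR_mulrn k (powR_ge0 u v)) -!powRrM mulrC.
Qed.

Definition len (k : int) : R := 2 `^ k%:~R.

Lemma len_gt0 k : 0 < len k.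
Proof. by rewrite powR_gt0. Qed.

(** For l = 2^u and rho = 2^v this is 2^-|u - v|, the decay in the distance between two scales. *)
Definition scale_ratio l rho : R := Num.min l rho / Num.max l rho.

(** Replacing log_2 rho by its floor moves the exponent by at most 1, whence 2^b; the factor 2
    accounts for scales above and below rho. *)
Lemma sum_scale_ratio b rho (s : seq int) : 0 < b -> 0 < rho -> uniq s ->
  \sum_(k <- s) scale_ratio (len k) rho `^ b <=
  2 `^ b * (2 * (1 - 2 `^ (- b))^-1).
Proof.
move=> b0 r0 us.
have l2 : 0 < ln (2 : R) by rewrite ln_gt0 ?ltr1n.
pose u := ln rho / ln 2.
have rhoE : rho = 2 `^ u.
  by rewrite /powR gt_eqF// mulfVK ?gt_eqF// lnK.
have y0 : 0 <= (2 : R) `^ (- b) by exact: powR_ge0.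
have y1 : (2 : R) `^ (- b) < 1.
  rewrite -[ltRHS](powRr0 2); apply: ltr_pow2; lra.
apply: le_trans (_ : 2 `^ b * \sum_(k <- s) (2 `^ (- b)) ^+ absz (k - Num.floor u) <= _); last first.
  by rewrite ler_wpM2l ?powR_ge0//; exact: sum_expr_uniq_int.
rewrite big_distrr /=; apply: ler_sum => k _.
have -> : scale_ratio (len k) rho = 2 `^ (- `|k%:~R - u|).
  rewrite /scale_ratio /len rhoE; have [ku|uk] := leP k%:~R u.
    rewrite min_l ?max_r; try by apply: ler_powR => //; rewrite ler1n.
    rewrite -powRB; last by rewrite pnatr_eq0 implybT.
    by rewrite ler0_norm ?subr_le0// opprK.
  rewrite min_r ?max_l; try by apply: ler_powR; rewrite ?ler1n// ltW.
  rewrite -powRB; last by rewrite pnatr_eq0 implybT.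
  by rewrite gtr0_norm ?subr_gt0// opprB.
rewrite -powR_mulrn ?powR_ge0// -!powRrM -powRD; last by rewrite pnatr_eq0 implybT.
apply: ler_powR; first by rewrite ler1n.
have := floor_itv u; set f := Num.floor u => /andP[h1 h2].
have -> : (`|k - f|%N%:R : R) = `|k%:~R - f%:~R|.
  by rewrite -intrB -intr_norm natr_absz.
rewrite intrD in h2.
have h : `|k%:~R - f%:~R| <= `|k%:~R - u| + 1 :> R.
  have -> : k%:~R - f%:~R = (k%:~R - u) + (u - f%:~R) :> R by ring.
  apply: (le_trans (ler_normD _ _)); rewrite lerD2l.
  by rewrite ger0_norm; lra.
by have := ler_wpM2l (ltW b0) h; lra.
Qed.

Context {n : nat}.
Local Notation Rn := 'rV[R]_n.
(* (k, m) stands for the box of scale 2^k around the lattice point 2^k m. *)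
Definition idx : Type := (int * 'rV[int]_n)%type.
HB.instance Definition _ := Countable.copy idx (int * 'rV[int]_n)%type.

Definition ctr (r : idx) : Rn := \row_i (len r.1 * (r.2 ord0 i)%:~R).

(** Along each axis the coordinates of m lie within D of c / l. Counted from the floor of c / l - D
    they take at most N + 1 <= 2 D + 3 values. *)
Lemma size_lattice (s : seq 'rV[int]_n) l (D : R) (c : Rn) : uniq s -> 0 < l ->
  0 <= D ->
  (forall m, m \in s -> supdist_le (D * l) c (\row_i (l * (m ord0 i)%:~R))) ->
  (size s)%:R <= (2 * D + 3) ^+ n :> R.
Proof.
move=> us l0 D0 sP.
pose a i : int := Num.floor (c ord0 i / l - D).
pose N := (Num.truncn (2 * D + 1)).+1.
have NP : N.+1%:R <= 2 * D + 3.
  rewrite /N -addn2 natrD.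
  have : (Num.truncn (2 * D + 1))%:R <= 2 * D + 1 by rewrite truncn_le//; lra.
  lra.
have mP m i : m \in s -> 0 <= m ord0 i - a i /\ (absz (m ord0 i - a i) < N.+1)%N.
  move=> /sP /(_ i); rewrite mxE => h.
  have h' : `|c ord0 i / l - (m ord0 i)%:~R| <= D.
    rewrite -(ler_pM2r l0) -[X in _ * X <= _](gtr0_norm l0) -normrM.
    by rewrite mulrBl divfK ?gt_eqF// [X in _ - X]mulrC.
  move: h'; rewrite ler_norml => /andP[h1 h2].
  have /andP[f1 f2] := floor_itv (c ord0 i / l - D).
  rewrite -/(a i) intrD in f1 f2.
  have g0 : 0 <= m ord0 i - a i.
    rewrite -ltzD1 -(ltr_int R) intrD intrB; lra.
  split => //.
  rewrite ltnS -(ler_nat R).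
  have -> : (absz (m ord0 i - a i))%:R = (m ord0 i)%:~R - (a i)%:~R :> R.
    by rewrite -intrB -{2}(gez0_abs g0).
  have : 2 * D + 1 < N%:R by rewrite /N truncnS_gt.
  lra.
pose F (m : 'rV[int]_n) : {ffun 'I_n -> 'I_N.+1} :=
  [ffun i => inord (absz (m ord0 i - a i))].
have Finj : {in s &, injective F}.
  move=> m m' ms m's /ffunP FF; apply/rowP => i.
  have := FF i; rewrite !ffunE => /(congr1 val) /=.
  have [p1 p2] := mP _ i ms; have [p3 p4] := mP _ i m's.
  rewrite !inordK// => e; apply: (addIr (- a i)).
  by rewrite -(gez0_abs p1) -(gez0_abs p3) e.
have : (size s <= #|{: {ffun 'I_n -> 'I_N.+1}}|)%N.
  rewrite -(size_map F) -(card_uniqP _); last by rewrite map_inj_in_uniq.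
  exact: max_card.
rewrite card_ffun !card_ord -(ler_nat R) natrX => /le_trans; apply.
by apply: lerXn2r => //; rewrite nnegrE ?ler0n//; lra.
Qed.

Definition count_const (L b : R) : R :=
  (2 * L + 3) ^+ n * (2 `^ b * (2 * (1 - 2 `^ (- b))^-1)).

(** At scale [len k] of the order of (max / [len k])^n lattice points are within reach. The n-th
    power in the summand cancels this number, and a geometric sum over the scales remains. *)
Lemma lattice_sum_le (s : seq idx) (P : pred idx) (L b rho : R) (c : Rn) : uniq s ->
  0 <= L -> 0 < b -> 0 < rho ->
  (forall r, r \in s -> P r -> supdist_le (L * Num.max (len r.1) rho) c (ctr r)) ->
  \sum_(r <- s | P r) (len r.1 / Num.max (len r.1) rho) ^+ n *
    scale_ratio (len r.1) rho `^ b <= count_const L b.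
Proof.
move=> us L0 b0 rho0 sP.
set G := fun k : int => (len k / Num.max (len k) rho) ^+ n * scale_ratio (len k) rho `^ b.
have mx0 k : 0 < Num.max (len k) rho by rewrite lt_max len_gt0.
have G0 k : 0 <= G k.
  by rewrite mulr_ge0// ?powR_ge0// exprn_ge0// divr_ge0// ltW ?len_gt0.
pose ks := undup (map fst s).
have -> : \sum_(r <- s | P r) (len r.1 / Num.max (len r.1) rho) ^+ n *
    scale_ratio (len r.1) rho `^ b =
    \sum_(k <- ks) \sum_(r <- s | P r && (r.1 == k)) G k.
  rewrite [RHS](exchange_big_dep P) /=; last by move=> k r _ /andP[].
  rewrite big_seq_cond [RHS]big_seq_cond; apply: eq_bigr => r /andP[rs Pr].
  rewrite (eq_bigl (fun k => k == r.1)); last by move=> k; rewrite Pr eq_sym.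
  rewrite -big_filter filter_pred1_uniq ?undup_uniq ?big_seq1//.
  by rewrite mem_undup; exact: map_f.
apply: le_trans (_ : \sum_(k <- ks) (2 * L + 3) ^+ n * scale_ratio (len k) rho `^ b <= _);
  last first.
  rewrite -big_distrr /= /count_const ler_wpM2l ?exprn_ge0//; first lra.
  by apply: sum_scale_ratio => //; exact: undup_uniq.
apply: ler_sum => k _.
rewrite -big_filter big_const_seq iter_addr_0 count_predT.
set sk := [seq r <- s | _].
have szk : (size sk)%:R <= (2 * (L * (Num.max (len k) rho / len k)) + 3) ^+ n :> R.
  rewrite -(size_map snd); apply: (@size_lattice _ (len k) _ c).
  - rewrite map_inj_in_uniq ?filter_uniq// => -[k1 m1] [k2 m2] /=.
    by rewrite !mem_filter /= => /andP[/andP[_ /eqP ->] _] /andP[/andP[_ /eqP ->] _] ->.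
  - exact: len_gt0.
  - by rewrite mulr_ge0// divr_ge0// ltW// len_gt0.
  - move=> m /mapP[[k1 m1]]; rewrite mem_filter /= => /andP[/andP[Pr /eqP k1k] rs] ->.
    have := sP _ rs Pr; rewrite /ctr /= in k1k *; subst k1.
    by rewrite -mulrA divfK// gt_eqF// len_gt0.
rewrite -[leLHS]mulr_natl /G mulrA ler_wpM2r ?powR_ge0//.
apply: (@le_trans _ _ ((2 * (L * (Num.max (len k) rho / len k)) + 3) ^+ n *
   (len k / Num.max (len k) rho) ^+ n)).
  by rewrite ler_wpM2r// exprn_ge0// divr_ge0// ltW ?len_gt0.
rewrite -exprMn; apply: lerXn2r; rewrite ?nnegrE.
- have M0 : 0 <= Num.max (len k) rho / len k by rewrite divr_ge0// ltW// len_gt0.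
  apply: mulr_ge0; first by rewrite addr_ge0// mulr_ge0// mulr_ge0.
  by rewrite divr_ge0// ltW// len_gt0.
- by rewrite addr_ge0// mulr_ge0.
rewrite mulrDl.
have e1 : Num.max (len k) rho / len k * (len k / Num.max (len k) rho) = 1.
  by field; rewrite !gt_eqF ?len_gt0.
have -> : 2 * (L * (Num.max (len k) rho / len k)) * (len k / Num.max (len k) rho) = 2 * L.
  by rewrite -!mulrA [X in _ * (_ * X)]mulrA e1 mulr1.
rewrite lerD2l -[leRHS]mulr1 ler_wpM2l// ler_pdivrMr// mul1r.
by rewrite le_max lexx.
Qed.

End counting.

(** * Adapted functions and almost orthogonality *)

Section adapted.
Context {R : realType} {n : nat}.
Local Notation Rn := 'rV[R]_n.
Local Notation lam := (@lebesgue_rV R n).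
Local Notation L1 f := (lam.-integrable setT (EFin \o f)).
Implicit Types (x y z c : Rn) (t l : R) (f g psi : Rn -> R).

(** Properties shared by all z |-> phi_t(y - z) with y in the cube of radius l about c and l < t <=
    2 l. Their support stays within 3 l of c; the radius 4 l leaves a margin for half-open cubes. *)
Definition adapted (a K : R) c l psi := [/\
  forall z, ~ cube c (4 * l) z -> psi z = 0,
  \int[lam]_x psi x = 0,
  forall z, `|psi z| <= K / l ^+ n &
  forall z z' d, 0 < d -> supdist_le d z z' ->
    `|psi z - psi z'| <= K / l ^+ n * (d / l) `^ a].

Lemma L1_cube c (r : R) : 0 < r -> L1 (\1_(cube c r) : Rn -> R).
Proof.
move=> r0; apply: L1_indic1; first exact: measurable_cube.
suff : (lebesgue_rV (cube c r) < +oo)%E by [].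
by rewrite lam_cube// ltry.
Qed.

Lemma I_cube c (r : R) : 0 < r -> \int[lam]_x (\1_(cube c r) x) = (2 * r) ^+ n.
Proof.
move=> r0; rewrite /Rintegral integral_indic//; last exact: measurable_cube.
by have := lam_cube c r0; rewrite setIT /= => ->.
Qed.

Lemma indic_in (E : set Rn) z : E z -> \1_E z = 1 :> R.
Proof. by move=> Ez; rewrite indicE mem_set. Qed.

Lemma indic_notin (E : set Rn) z : ~ E z -> \1_E z = 0 :> R.
Proof. by move=> Ez; rewrite indicE memNset. Qed.

Lemma indic_sub (E F : set Rn) z : E `<=` F -> \1_E z <= \1_F z :> R.
Proof.
move=> EF; have [Ez|Ez] := pselect (E z).
  by rewrite !indic_in//; exact: EF.
by rewrite indic_notin ?indic_ge0.
Qed.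

Section one_function.
Variables (a K : R) (c : Rn) (l : R) (psi : Rn -> R).
Hypotheses (a0 : 0 < a) (K0 : 0 < K) (l0 : 0 < l).
Hypothesis psiP : adapted a K c l psi.

Lemma adapted_measurable : measurable_fun [set: lebesgue_type n] psi.
Proof.
apply: measurable_lebesgue_type; apply: measurable_unif => e e0.
pose B := K / l ^+ n.
have B0 : 0 < B by rewrite divr_gt0// exprn_gt0.
(* The radius d that solves B (d / l)^a = e. *)
exists (l * (e / B) `^ a^-1); first by rewrite mulr_gt0// powR_gt0// divr_gt0.
case: psiP => _ _ _ psiH z z' zz'.
apply: (le_trans (psiH _ _ _ _ zz')).
  by rewrite mulr_gt0// powR_gt0// divr_gt0.
rewrite [l * _]mulrC mulfK ?gt_eqF// -powRrM mulVf ?gt_eqF// powRr1; last first.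
  by rewrite ltW// divr_gt0.
by rewrite -/B mulrC divfK// gt_eqF.
Qed.

Lemma adapted_le z : `|psi z| <= K / l ^+ n * \1_(cube c (4 * l)) z.
Proof.
case: psiP => psi0 _ psiB _; have [cz|cz] := pselect (cube c (4 * l) z).
  by rewrite indic_in// mulr1.
by rewrite psi0// normr0 indic_notin// mulr0.
Qed.

Lemma adapted_L1 : L1 psi.
Proof.
apply: (L1_le adapted_measurable _ adapted_le).
by apply/L1Z/L1_cube; rewrite mulr_gt0.
Qed.

Lemma adapted_mul_L1 f : L1 f -> L1 (fun x => psi x * f x).
Proof.
case: psiP => _ _ psiB _.
exact: L1M adapted_measurable psiB.
Qed.

End one_function.

Section two_functions.
Variables (a K : R) (c c' : Rn) (l l' : R) (psi psi' : Rn -> R).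
Hypotheses (a0 : 0 < a) (K0 : 0 < K) (l0 : 0 < l) (l'0 : 0 < l').
Hypothesis psiP : adapted a K c l psi.
Hypothesis psi'P : adapted a K c' l' psi'.

Lemma adapted_mulL1 : L1 (fun x => psi x * psi' x).
Proof. exact/(adapted_mul_L1 a0 K0 l0 psiP)/(adapted_L1 a0 K0 l'0 psi'P). Qed.

Lemma adapted_far : ~ supdist_le (8 * Num.max l l') c c' ->
  \int[lam]_x (psi x * psi' x) = 0.
Proof.
move=> cc'; rewrite -[RHS](@I0 _ _ _ lam); apply: eq_I => z.
have [cz|cz] := pselect (cube c (4 * l) z); last first.
  by case: psiP => -> //; rewrite mul0r.
have [c'z|c'z] := pselect (cube c' (4 * l') z); last first.
  by case: psi'P => -> //; rewrite mulr0.
exfalso; apply: cc'.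
have := supdist_le_trans (cube_supdist_le cz) (supdist_le_sym (cube_supdist_le c'z)).
apply: supdist_le_le.
have h1 : l <= Num.max l l' by rewrite le_max lexx.
have h2 : l' <= Num.max l l' by rewrite le_max lexx orbT.
lra.
Qed.

(* The cancellation of the function of smaller scale is tested against the
   Hoelder continuity of the other one. *)
Lemma adapted_pair_le : l <= l' ->
  `|\int[lam]_x (psi x * psi' x)| <=
  K ^+ 2 * 8 ^+ n * 4 `^ a * ((l / l') `^ a / l' ^+ n).
Proof.
move=> ll'.
have iP := adapted_mulL1.
have psii := adapted_L1 a0 K0 l0 psiP.
have -> : \int[lam]_x (psi x * psi' x) =
    \int[lam]_x (psi x * psi' x - psi' c * psi x).
  rewrite IB//; last exact: L1Z.
  by rewrite IZ//; case: psiP => _ -> _ _; rewrite mulr0 subr0.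
pose B := K / l ^+ n * (K / l' ^+ n * (4 * l / l') `^ a).
have l40 : 0 < 4 * l by rewrite mulr_gt0.
apply: (@le_trans _ _ (\int[lam]_x (B * \1_(cube c (4 * l)) x))).
  apply: I_abs_le.
  - by apply: L1B => //; exact: L1Z.
  - exact/L1Z/L1_cube.
  move=> z; have [cz|cz] := pselect (cube c (4 * l) z); last first.
    by case: psiP => -> //; rewrite mul0r mulr0 subr0 normr0 indic_notin// mulr0.
  rewrite indic_in// mulr1 [psi' c * _]mulrC -mulrBr normrM.
  apply: ler_pM => //; first by case: psiP.
  case: psi'P => _ _ _; apply => //.
  exact/supdist_le_sym/cube_supdist_le.
rewrite IZ; last exact: L1_cube.
rewrite I_cube// /B.
have -> : (4 * l / l') `^ a = 4 `^ a * (l / l') `^ a.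
  by rewrite -mulrA powRM// divr_ge0// ltW.
rewrite (_ : 2 * (4 * l) = 8 * l); last by ring.
rewrite exprMn le_eqVlt; apply/orP; left; apply/eqP.
by field; rewrite !gt_eqF// exprn_gt0.
Qed.

End two_functions.

(** 8^n is the volume of the support of the finer function in units of its scale; 4^a arises because
    the points of this support are within 4 l of its centre. *)
Definition pair_const (a K : R) := K ^+ 2 * 8 ^+ n * 4 `^ a.

Lemma adapted_pair (a K : R) c c' l l' psi psi' : 0 < a -> 0 < K -> 0 < l ->
  0 < l' -> adapted a K c l psi -> adapted a K c' l' psi' ->
  `|\int[lam]_x (psi x * psi' x)| <=
  pair_const a K * (scale_ratio l l' `^ a / Num.max l l' ^+ n).
Proof.
move=> a0 K0 l0 l'0 psiP psi'P; rewrite /scale_ratio; have [ll'|ll'] := leP l l'.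
  exact: (@adapted_pair_le a K c c').
under eq_I do rewrite mulrC.
by apply: (@adapted_pair_le a K c' c) => //; exact: ltW.
Qed.

Section L2.
Variables (a K : R).
Hypotheses (a0 : 0 < a) (K0 : 0 < K).
Variables (s : seq (@idx n)) (psi : @idx n -> Rn -> R).
Hypothesis us : uniq s.
Hypothesis psiP : forall r, adapted a K (ctr r) (len r.1) (psi r).

Definition L2_const := pair_const a K * @count_const R n 8 a.

Lemma count_const_gt0 (L b : R) : 0 <= L -> 0 < b -> 0 < @count_const R n L b.
Proof.
move=> L0 b0; rewrite /count_const mulr_gt0 ?exprn_gt0 ?mulr_gt0 ?powR_gt0//.
  lra.
rewrite invr_gt0 subr_gt0 -[ltRHS](powRr0 2); apply: ltr_pow2; lra.
Qed.

Lemma L2_const_gt0 : 0 < L2_const.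
Proof.
rewrite /L2_const mulr_gt0 ?count_const_gt0//.
by rewrite /pair_const !mulr_gt0 ?exprn_gt0 ?powR_gt0.
Qed.

Let b (r r' : @idx n) := \int[lam]_x (psi r x * psi r' x).

(** The weights [len r'.1 ^+ n] balance the denominator in [adapted_pair] and leave the summand of
    [lattice_sum_le]. The constant 8 is 4 + 4: beyond that distance the supports are disjoint. *)
Lemma schur (r : @idx n) : \sum_(r' <- s) len r'.1 ^+ n * `|b r r'| <= L2_const.
Proof.
pose P r' := `[< supdist_le (8 * Num.max (len r'.1 : R) (len r.1)) (ctr r) (ctr r') >].
rewrite (bigID P) /= [X in _ + X]big1 ?addr0; last first.
  move=> r' /asboolPn Pr'; rewrite /b (@adapted_far a K (ctr r) (ctr r') (len r.1) (len r'.1))//.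
    by rewrite normr0 mulr0.
  by rewrite maxC.
have := @lattice_sum_le R n s P 8 a (len r.1) (ctr r) us _ a0 (len_gt0 _).
move=> /(_ ltac:(lra)) h.
rewrite /L2_const.
apply: le_trans (ler_wpM2l _ (h _)); last 2 first.
- by rewrite /pair_const !mulr_ge0 ?exprn_ge0 ?powR_ge0// ltW.
- by move=> r' _ /asboolP.
rewrite big_distrr /=; apply: ler_sum => r' _.
have := adapted_pair a0 K0 (len_gt0 _) (len_gt0 _) (psiP r) (psiP r').
move=> /(ler_wpM2l (exprn_ge0 n (ltW (len_gt0 r'.1)))) /le_trans; apply.
rewrite /scale_ratio maxC minC expr_div_n.
by rewrite le_eqVlt; apply/orP; left; apply/eqP; ring.
Qed.

Variable g : Rn -> R.
Hypothesis mg : measurable_fun [set: lebesgue_type n] g.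
Hypothesis g2 : L1 (fun x => g x ^+ 2).

Lemma L1_sqr_mul (f h : Rn -> R) : measurable_fun [set: lebesgue_type n] f ->
  measurable_fun [set: lebesgue_type n] h ->
  L1 (fun x => f x ^+ 2) -> L1 (fun x => h x ^+ 2) -> L1 (fun x => f x * h x).
Proof.
move=> mf mh f2 h2; apply: (@L1_le _ (lebesgue_type n) R lam _ (fun x => f x ^+ 2 + h x ^+ 2)).
- exact: measurable_funM.
- exact: L1D.
- move=> x; rewrite normrM -[f x ^+ 2]real_normK ?num_real//.
  rewrite -[h x ^+ 2]real_normK ?num_real//.
  have := sqr_ge0 (`|f x| - `|h x|); have := normr_ge0 (f x).
  have := normr_ge0 (h x); set u := `|f x|; set v := `|h x|; nra.
Qed.

Let mpsi r : measurable_fun [set: lebesgue_type n] (psi r).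
Proof. exact: adapted_measurable a0 K0 (len_gt0 _) (psiP r). Qed.

Let L1pp r r' : L1 (fun x => psi r x * psi r' x).
Proof. exact: adapted_mulL1 a0 K0 (len_gt0 _) (len_gt0 _) (psiP r) (psiP r'). Qed.

Lemma L1_pairing r : L1 (fun x => g x * psi r x).
Proof.
by apply: L1_sqr_mul => //; rewrite (_ : (fun _ => _) = fun x => psi r x * psi r x).
Qed.

Let q r := \int[lam]_x (g x * psi r x).

(* Expand 0 <= int (g - h / L2_const)^2 for h the sum of |r| <g, psi_r> psi_r;
   Schur bounds the quadratic term. *)
Lemma L2_bound : \sum_(r <- s) len r.1 ^+ n * q r ^+ 2 <=
  L2_const * \int[lam]_x (g x ^+ 2).
Proof.
set S := \sum_(r <- s) _.
pose h x := \sum_(r <- s) len r.1 ^+ n * q r * psi r x.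
pose k := L2_const^-1.
have C0 := L2_const_gt0.
have gh x : g x * h x = \sum_(r <- s) len r.1 ^+ n * q r * (g x * psi r x).
  by rewrite /h big_distrr /=; apply: eq_bigr => r _; ring.
have hh x : h x ^+ 2 = \sum_(r <- s) \sum_(r' <- s)
    (len r.1 ^+ n * q r * (len r'.1 ^+ n * q r')) * (psi r x * psi r' x).
  rewrite expr2 {1}/h big_distrl /=; apply: eq_bigr => r _.
  by rewrite /h big_distrr /=; apply: eq_bigr => r' _; ring.
have igh : L1 (fun x => g x * h x).
  rewrite (_ : (fun x => _) = fun x => \sum_(r <- s) len r.1 ^+ n * q r * (g x * psi r x)).
    by apply: L1_sum => r; exact/L1Z/L1_pairing.
  exact/funext.
have ihh : L1 (fun x => h x ^+ 2).
  rewrite (_ : (fun x => _) = fun x => \sum_(r <- s) \sum_(r' <- s)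
    (len r.1 ^+ n * q r * (len r'.1 ^+ n * q r')) * (psi r x * psi r' x)).
    by apply: L1_sum => r; apply: L1_sum => r'; exact/L1Z/L1pp.
  exact/funext.
have Igh : \int[lam]_x (g x * h x) = S.
  under eq_I do rewrite gh.
  rewrite Isum; last by move=> r; exact/L1Z/L1_pairing.
  apply: eq_bigr => r _; rewrite IZ; last exact: L1_pairing.
  by rewrite -/(q r) expr2 mulrA.
have Ihh : \int[lam]_x (h x ^+ 2) <= L2_const * S.
  under eq_I do rewrite hh.
  rewrite Isum; last by move=> r; apply: L1_sum => r'; exact/L1Z/L1pp.
  under eq_bigr => r _.
    rewrite Isum; last by move=> r'; exact/L1Z/L1pp.
    under eq_bigr => r' _ do rewrite IZ// -/(b r r').
    over.
  (* By Young's inequality |q r| |q r'| is at most the half sum of the squares. Each half of the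
     symmetrised double sum is then a row sum bounded by [schur]. *)
  pose T r r' := len r.1 ^+ n * len r'.1 ^+ n * `|b r r'| * q r ^+ 2.
  have bC r r' : b r r' = b r' r by apply: eq_I => x; rewrite mulrC.
  apply: (@le_trans _ _ (\sum_(r <- s) \sum_(r' <- s) 2^-1 * (T r r' + T r' r))).
    apply: ler_sum => r _; apply: ler_sum => r' _.
    rewrite /T (bC r' r).
    have p0 : 0 <= len r.1 ^+ n * len r'.1 ^+ n :> R.
      by rewrite mulr_ge0// exprn_ge0// ltW// len_gt0.
    apply: (@le_trans _ _ (len r.1 ^+ n * len r'.1 ^+ n * `|b r r'| * (`|q r| * `|q r'|))).
      apply: le_trans (ler_norm _) _; rewrite !normrM !normrX !(ger0_norm (ltW (len_gt0 _))).
      by rewrite le_eqVlt; apply/orP; left; apply/eqP; ring.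
    rewrite -[q r ^+ 2]real_normK ?num_real// -[q r' ^+ 2]real_normK ?num_real//.
    rewrite (_ : 2^-1 * _ = len r.1 ^+ n * len r'.1 ^+ n * `|b r r'| *
      (2^-1 * (`|q r| ^+ 2 + `|q r'| ^+ 2))); last by ring.
    apply: ler_wpM2l; first exact: mulr_ge0.
    have := sqr_ge0 (`|q r| - `|q r'|).
    move: (`|q r|) (`|q r'|) => u v; rewrite sqrrB; lra.
  have -> : \sum_(r <- s) \sum_(r' <- s) 2^-1 * (T r r' + T r' r) =
      \sum_(r <- s) \sum_(r' <- s) T r r'.
    under eq_bigr => r _ do rewrite -big_distrr big_split /=.
    rewrite -big_distrr big_split /= [X in _ * (_ + X)]exchange_big /=.
    by set X := (X in _ * (X + _)); rewrite -/X; lra.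
  rewrite /S big_distrr /=; apply: ler_sum => r _.
  have := ler_wpM2l (mulr_ge0 (exprn_ge0 n (ltW (len_gt0 r.1))) (sqr_ge0 (q r))) (schur r).
  rewrite big_distrr /= [X in _ <= X]mulrC; apply: le_trans.
  by rewrite le_eqVlt; apply/orP; left; apply/eqP; apply: eq_bigr => r' _; rewrite /T; ring.
have : 0 <= \int[lam]_x ((g x - k * h x) ^+ 2) by apply: I_ge0 => x; exact: sqr_ge0.
have -> : \int[lam]_x ((g x - k * h x) ^+ 2) =
    \int[lam]_x (g x ^+ 2) + \int[lam]_x (- (2 * k) * (g x * h x) + k ^+ 2 * h x ^+ 2).
  rewrite -ID//; last by apply: L1D; exact: L1Z.
  by apply: eq_I => x; ring.
rewrite ID; [|exact: L1Z|exact: L1Z].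
rewrite !IZ// Igh; set G := \int[lam]_x _; move=> Hpos.
have k0 : 0 < k by rewrite invr_gt0.
have kC : k * L2_const = 1 by rewrite mulVf// gt_eqF.
have Hk := ler_wpM2l (sqr_ge0 k) Ihh.
have e2 : k ^+ 2 * (L2_const * S) = k * S.
  by rewrite expr2 mulrA -(mulrA k) kC mulr1.
rewrite e2 in Hk.
have : k * S <= G by lra.
by rewrite /k mulrC ler_pdivrMr// mulrC.
Qed.

End L2.

End adapted.

(** * Weighted L2 bounds *)

Section layers.
Context {R : realType}.

(** Dyadic layer cake: the last level not exceeding v is already more than v / 2. *)
Lemma layer_le (e v : R) N : 0 < e -> e <= v -> v < e * 2 ^+ N ->
  v <= 2 * \sum_(k < N) e * 2 ^+ k * (e * 2 ^+ k <= v)%R%:R.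
Proof.
move=> e0 ev; elim: N => [|N IH]; first by rewrite expr0 mulr1; lra.
move=> vN; rewrite big_ord_recr /=.
have [h|h] := ltP v (e * 2 ^+ N).
  by rewrite mulr0 addr0; exact: IH.
rewrite mulr1 mulrDr.
have : 0 <= \sum_(k < N) e * 2 ^+ k * (e * 2 ^+ k <= v)%R%:R.
  by apply: sumr_ge0 => k _; rewrite mulr_ge0// mulr_ge0 ?exprn_ge0// ltW.
rewrite exprS in vN; lra.
Qed.

(** The levels not exceeding x form a geometric sum, at most twice its largest term. *)
Lemma layer_ge (e x : R) N : 0 < e -> 0 <= x ->
  \sum_(k < N) e * 2 ^+ k * (e * 2 ^+ k <= x)%R%:R <= 2 * x.
Proof.
move=> e0 x0; elim: N => [|N IH]; first by rewrite big_ord0; lra.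
rewrite big_ord_recr /=; have [h|h] := leP (e * 2 ^+ N) x; last first.
  by rewrite mulr0 addr0.
have : \sum_(k < N) e * 2 ^+ k * (e * 2 ^+ k <= x)%R%:R <= e * 2 ^+ N.
  apply: (@le_trans _ _ (\sum_(k < N) e * 2 ^+ k)).
    apply: ler_sum => k _; rewrite ler_piMr//.
      by rewrite mulr_ge0 ?exprn_ge0// ltW.
    by case: (e * 2 ^+ k <= x).
  rewrite -big_distrr /= ler_pM2l//.
  elim: N {IH h} => [|N IH]; first by rewrite big_ord0 expr0; lra.
  by rewrite big_ord_recr /= exprS; lra.
by rewrite mulr1; lra.
Qed.

(** With the next lemma, confines the averages of w over a finite list of boxes to finitely many
    dyadic levels. *)
Lemma seq_lower_bound (T : eqType) (s : seq T) (v : T -> R) :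
  (forall r, r \in s -> 0 < v r) ->
  exists2 e, 0 < e & forall r, r \in s -> e <= v r.
Proof.
elim: s => [|r s IH] h; first by exists 1.
case: IH => [r' r's|e e0 es]; first by apply: h; rewrite inE r's orbT.
exists (Num.min e (v r)).
  by rewrite lt_min e0 h// inE eqxx.
move=> r'; rewrite inE => /predU1P[->|/es h']; rewrite ge_min ?lexx ?orbT//.
by rewrite h'.
Qed.

Lemma seq_upper_bound (T : eqType) (s : seq T) (v : T -> R) (e : R) :
  0 < e -> exists N, forall r, r \in s -> v r < e * 2 ^+ N.
Proof.
move=> e0; elim: s => [|r s [N IH]]; first by exists 0%N.
exists (maxn N (Num.truncn (v r / e)).+1) => r'.
rewrite inE => /predU1P[->|/IH h].
  rewrite mulrC -ltr_pdivrMr//; apply: lt_le_trans (truncnS_gt _) _.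
  apply: (@le_trans _ _ (2 ^+ (Num.truncn (v r / e)).+1)).
    by rewrite -natrX ler_nat ltnW// ltn_expl.
  by rewrite ler_weXn2l ?ler1n// leq_maxr.
apply: (lt_le_trans h); rewrite ler_pM2l// ler_weXn2l ?ler1n//.
exact: leq_maxl.
Qed.
End layers.

Section weighted.
Context {R : realType} {n : nat}.
Local Notation Rn := 'rV[R]_n.
Local Notation lam := (@lebesgue_rV R n).
Local Notation L1 f := (lam.-integrable setT (EFin \o f)).
Implicit Types (c z : Rn) (f g psi : Rn -> R).

Lemma ae_lebesgue_imply (P Q : Rn -> Prop) : (forall x, P x -> Q x) ->
  {ae lam, forall x, P x} -> {ae lam, forall x, Q x}.
Proof.
move=> PQ [N [mN N0 PN]]; exists N; split => // x nQx; apply: PN => /=.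
by move=> Px; apply/nQx/PQ.
Qed.

Definition wcube (w : Rn -> R) c (r : R) := \int[lam]_x (\1_(cube c r) x * w x).

(* The A_1 condition over cubes, in pointwise almost-everywhere form. *)
Definition A1_cube (A : R) (w : Rn -> R) := [/\
  forall x, 0 < w x,
  measurable_fun [set: lebesgue_type n] w,
  (forall c (r : R), 0 < r -> L1 (fun x => \1_(cube c r) x * w x)) &
  forall c (r : R), 0 < r ->
    {ae lam, forall z, cube c r z -> wcube w c r <= A * r ^+ n * w z}].

Variables (A : R) (w : Rn -> R).
Hypothesis A0 : 0 < A.
Hypothesis wP : A1_cube A w.

Let w0 x : 0 < w x. Proof. by case: wP. Qed.
Let mw : measurable_fun [set: lebesgue_type n] w. Proof. by case: wP. Qed.
Let wL1 c (r : R) : 0 < r -> L1 (fun x => \1_(cube c r) x * w x).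
Proof. by case: wP => _ _ + _; apply. Qed.

(** If the integral vanished, the positive function w would be zero almost everywhere on the cube,
    and the cube would be null. *)
Lemma wcube_gt0 c (r : R) : 0 < r -> 0 < wcube w c r.
Proof.
move=> r0.
have p0 x : 0 <= \1_(cube c r) x * w x by rewrite mulr_ge0 ?indic_ge0// ltW.
rewrite lt_neqAle I_ge0// andbT; apply/negP => /eqP W0.
have : (\int[lam]_x `|(\1_(cube c r) x * w x)%:E| = 0)%E.
  rewrite [LHS](_ : _ = \int[lam]_x (\1_(cube c r) x * w x)%:E)%E; last first.
    by apply: eq_integral => x _ /=; rewrite ger0_norm.
  by rewrite -EFin_I; [rewrite -/(wcube w c r) -W0|exact: wL1].
move=> /(ae_eq_integral_abs _ measurableT _).1 H.
have : {ae lam, forall x, ~ cube c r x}.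
  have mm : measurable_fun [set: lebesgue_type n]
      (fun x => (\1_(cube c r) x * w x)%:E).
    by apply/measurable_EFinP/L1_measurable; exact: wL1.
  move: (H mm); apply: ae_lebesgue_imply => x /(_ I) /= [] e cx.
  by move: e; rewrite indic_in// mul1r => e; have := w0 x; rewrite e ltxx.
move=> [N [mN N0 cN]].
have : (lam (cube c r) <= lam N)%E.
  apply: le_measure; rewrite ?inE//; first exact: measurable_cube.
  by move=> x cx; apply: cN => /=; apply.
rewrite lam_cube// => le0.
have : (((2 * r) ^+ n)%:E <= 0 :> \bar R)%E by apply: (le_trans le0); rewrite -N0.
by rewrite lee_fin leNgt exprn_gt0// mulr_gt0.
Qed.

(** The almost everywhere A_1 inequality on the larger cube, multiplied by [F] and integrated over
    the smaller one: an unweighted integral is traded for a weighted one. *)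
Lemma wcube_le_int c c' (r r' : R) (F : Rn -> R) : 0 < r -> 0 < r' ->
  cube c' r' `<=` cube c r -> (forall x, 0 <= F x) ->
  L1 (fun x => \1_(cube c' r') x * F x) ->
  L1 (fun x => \1_(cube c' r') x * (F x * w x)) ->
  wcube w c r * \int[lam]_x (\1_(cube c' r') x * F x) <=
  A * r ^+ n * \int[lam]_x (\1_(cube c' r') x * (F x * w x)).
Proof.
move=> r0 r'0 sub F0 iF iFw.
rewrite -!IZ//; apply: I_le_ae.
- exact: L1Z.
- exact: L1Z.
- by move=> x; rewrite mulr_ge0 ?mulr_ge0 ?indic_ge0// ltW// wcube_gt0.
- by move=> x; rewrite !mulr_ge0 ?indic_ge0 ?exprn_ge0// ltW.
case: wP => _ _ _ /(_ c r r0); apply: ae_lebesgue_imply => x h.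
have [cx|cx] := pselect (cube c' r' x); last by rewrite indic_notin// !mul0r !mulr0.
rewrite indic_in// !mul1r [F x * w x]mulrC mulrA ler_wpM2r//.
exact/h/sub.
Qed.

Variables (a K : R).
Hypotheses (a0 : 0 < a) (K0 : 0 < K).
Variables (s : seq (@idx n)) (psi : @idx n -> Rn -> R).
Hypothesis us : uniq s.
Hypothesis psiP : forall r, adapted a K (ctr r) (len r.1) (psi r).

Variables (g : Rn -> R) (G : R) (c0 : Rn) (r0 : R).
Hypothesis mg : measurable_fun [set: lebesgue_type n] g.
Hypothesis gG : forall x, `|g x| <= G.
Hypothesis rp : 0 < r0.
Hypothesis gsupp : forall x, ~ cube c0 r0 x -> g x = 0.

(** The factor 4 is one 2 from [layer_le] and one from [layer_ge]; 4^n comes from applying A_1 on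
    cubes of radius 4 [len r.1]. *)
Definition L2w_const := 4 * L2_const (n := n) a K * (A * 4 ^+ n).

Lemma bounded_supp_L1 (h : Rn -> R) (H : R) :
  measurable_fun [set: lebesgue_type n] h -> (forall x, `|h x| <= H) ->
  (forall x, ~ cube c0 r0 x -> h x = 0) -> L1 h.
Proof.
move=> mh hH hs; apply: (@L1_le _ (lebesgue_type n) R lam _
  (fun x => H * \1_(cube c0 r0) x)) => //.
  exact/L1Z/L1_cube.
move=> x; have [cx|cx] := pselect (cube c0 r0 x); first by rewrite indic_in// mulr1.
by rewrite hs// normr0 indic_notin// mulr0.
Qed.

Let G2 x : `|g x ^+ 2| <= G ^+ 2.
Proof. by rewrite normrX; apply: lerXn2r; rewrite ?nnegrE// (le_trans (normr_ge0 _) (gG x)). Qed.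

Let mg2 : measurable_fun [set: lebesgue_type n] (fun x => g x ^+ 2).
Proof. exact: measurable_funX. Qed.

Let ig2 : L1 (fun x => g x ^+ 2).
Proof.
apply: bounded_supp_L1 mg2 G2 _ => x /gsupp ->.
by rewrite expr0n.
Qed.

Let ig2w : L1 (fun x => g x ^+ 2 * w x).
Proof.
apply: (@L1_le _ (lebesgue_type n) R lam _
  (fun x => G ^+ 2 * (\1_(cube c0 r0) x * w x))).
- exact: measurable_funM.
- exact/L1Z/wL1.
move=> x; have [cx|cx] := pselect (cube c0 r0 x); last first.
  by rewrite gsupp// expr0n mul0r normr0 indic_notin// mul0r mulr0.
by rewrite indic_in// mul1r normrM [`|w x|]gtr0_norm// ler_wpM2r// ltW.
Qed.

Lemma L2w_bound :
  \sum_(r <- s) wcube w (ctr r) (4 * len r.1) *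
     (\int[lam]_x (g x * psi r x)) ^+ 2 <=
  L2w_const * \int[lam]_x (g x ^+ 2 * w x).
Proof.
pose q (r : @idx n) := \int[lam]_x (g x * psi r x).
pose W (r : @idx n) := wcube w (ctr r) (4 * len r.1).
have l40 (r : @idx n) : 0 < 4 * len r.1 :> R by rewrite mulr_gt0// len_gt0.
have ln0 (r : @idx n) : 0 < len r.1 ^+ n :> R by rewrite exprn_gt0// len_gt0.
pose v r := W r / len r.1 ^+ n.
have v0 r : 0 < v r by rewrite divr_gt0// wcube_gt0.
have [e e0 ev] := seq_lower_bound (fun r (_ : r \in s) => v0 r).
have [N vN] := seq_upper_bound s v e0.
pose E (k : nat) := [set x : lebesgue_type n | e * 2 ^+ k <= A * 4 ^+ n * w x].
have mE k : measurable (E k).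
  rewrite (_ : E k = (fun x => A * 4 ^+ n * w x) @^-1` `[e * 2 ^+ k, +oo[%classic).
    rewrite -[X in measurable X]setTI.
    by apply: (measurable_funM (measurable_cst _) mw).
  by apply/seteqP; split => x /=; rewrite in_itv/= andbT.
pose gk k x := \1_(E k) x * g x.
have mgk k : measurable_fun [set: lebesgue_type n] (gk k).
  by apply: measurable_funM => //; exact: measurable_indicT.
have igk k : L1 (fun x => gk k x ^+ 2).
  apply: (@L1_le _ (lebesgue_type n) R lam (fun x => gk k x ^+ 2) (fun x => g x ^+ 2) _ ig2).
    exact: measurable_funX.
  move=> x; rewrite /gk exprMn normrM [X in _ * X]ger0_norm ?sqr_ge0//.
  rewrite ler_piMl ?sqr_ge0// normrX exprn_ile1//.
  exact: indic_le1.
(* Where the average v r of w is at least e 2^k, A_1 puts the cube of r inside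
   E k almost everywhere, so g may be truncated to E k. *)
have qk k r : e * 2 ^+ k <= v r -> q r = \int[lam]_x (gk k x * psi r x).
  move=> evr; apply: I_eq_ae.
  - exact: (L1_pairing a0 K0 psiP mg ig2 r).
  - exact: (L1_pairing a0 K0 psiP (mgk k) (igk k) r).
  case: wP => _ _ _ /(_ (ctr r) _ (l40 r)); apply: ae_lebesgue_imply => x h.
  have [cx|cx] := pselect (cube (ctr r) (4 * len r.1) x); last first.
    by case: (psiP r) => -> // _ _ _; rewrite !mulr0.
  rewrite /gk indic_in ?mul1r// /E/=; apply: (le_trans evr).
  rewrite ler_pdivrMr//; apply: (le_trans (h cx)).
  by rewrite exprMn le_eqVlt; apply/orP; left; apply/eqP; ring.
have step k : \sum_(r <- s | e * 2 ^+ k <= v r) len r.1 ^+ n * q r ^+ 2 <=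
    L2_const (n := n) a K * \int[lam]_x (gk k x ^+ 2).
  have usk : uniq [seq r <- s | e * 2 ^+ k <= v r] by exact: filter_uniq.
  apply: le_trans (L2_bound a0 K0 usk psiP (mgk k) (igk k)).
  rewrite big_filter le_eqVlt; apply/orP; left; apply/eqP.
  by apply: eq_bigr => r /qk ->.
(* Each average is replaced by the sum of the levels below it. The unweighted bound then applies
   level by level to the truncations [gk k], and [layer_ge] reassembles these into the weight w. *)
apply: (@le_trans _ _ (\sum_(r <- s) \sum_(k < N)
    2 * (e * 2 ^+ k) * ((e * 2 ^+ k <= v r)%R%:R * (len r.1 ^+ n * q r ^+ 2)))).
  rewrite big_seq [leRHS]big_seq; apply: ler_sum => r rs.
  have -> : wcube w (ctr r) (4 * len r.1) = v r * len r.1 ^+ n.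
    by rewrite /v divfK// gt_eqF.
  have := layer_le e0 (ev _ rs) (vN _ rs).
  have p0 : 0 <= len r.1 ^+ n * q r ^+ 2 by rewrite mulr_ge0 ?sqr_ge0// ltW.
  move=> /(ler_wpM2r p0); rewrite mulrA => /le_trans; apply.
  rewrite big_distrr /= big_distrl /= le_eqVlt; apply/orP; left; apply/eqP.
  by apply: eq_bigr => k _; ring.
rewrite exchange_big /=.
apply: (@le_trans _ _ (\sum_(k < N) 2 * (e * 2 ^+ k) *
    (L2_const (n := n) a K * \int[lam]_x (gk k x ^+ 2)))).
  apply: ler_sum => k _; rewrite -big_distrr /= ler_wpM2l//.
    by rewrite !mulr_ge0 ?exprn_ge0// ltW.
  apply: le_trans (step k); rewrite [leRHS]big_mkcond /=.
  apply: ler_sum => r _; case: (_ <= v r) => /=; first by rewrite mul1r.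
  by rewrite mul0r.
have -> : \sum_(k < N) 2 * (e * 2 ^+ k) *
    (L2_const (n := n) a K * \int[lam]_x (gk k x ^+ 2)) =
  2 * L2_const (n := n) a K *
    \int[lam]_x (\sum_(k < N) e * 2 ^+ k * gk k x ^+ 2).
  rewrite Isum; last by move=> k; exact: L1Z.
  rewrite big_distrr /=; apply: eq_bigr => k _; rewrite IZ//; ring.
rewrite /L2w_const.
rewrite (_ : 4 * _ * _ * _ = 2 * L2_const (n := n) a K *
  (2 * (A * 4 ^+ n) * \int[lam]_x (g x ^+ 2 * w x))); last by ring.
rewrite ler_wpM2l//.
  by rewrite mulr_ge0// ltW// L2_const_gt0.
rewrite -IZ//; apply: I_le.
- by apply: L1_sum => k; exact: L1Z.
- exact: L1Z.
move=> x.
have Aw0 : 0 <= A * 4 ^+ n * w x by rewrite !mulr_ge0 ?exprn_ge0// ltW.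
have := ler_wpM2r (sqr_ge0 (g x)) (layer_ge N e0 Aw0).
rewrite (_ : 2 * (A * 4 ^+ n) * (g x ^+ 2 * w x) =
  2 * (A * 4 ^+ n * w x) * g x ^+ 2); last by ring.
apply: le_trans; rewrite big_distrl /=; apply: ler_sum => k _.
rewrite /gk indicE (_ : (x \in E k) = (e * 2 ^+ k <= A * 4 ^+ n * w x)); last first.
  by apply/idP/idP => [/set_mem//|h]; exact/mem_set.
case: (e * 2 ^+ k <= _) => /=; first by rewrite mul1r mulr1.
by rewrite mul0r expr0n !mulr0 mul0r.
Qed.

End weighted.

(** * Calderon-Zygmund decomposition *)

Section finite_l2.
Context {R : realType}.

(** Lagrange's identity: the difference of the two sides is half a double sum of squares. *)
Lemma cauchy_schwarz (I : Type) (s : seq I) (a b : I -> R) :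
  (\sum_(i <- s) a i * b i) ^+ 2 <=
  (\sum_(i <- s) a i ^+ 2) * (\sum_(i <- s) b i ^+ 2).
Proof.
have : 0 <= \sum_(i <- s) \sum_(k <- s) (a i * b k - a k * b i) ^+ 2.
  by apply: sumr_ge0 => i _; apply: sumr_ge0 => k _; exact: sqr_ge0.
have -> : \sum_(i <- s) \sum_(k <- s) (a i * b k - a k * b i) ^+ 2 =
   2 * ((\sum_(i <- s) a i ^+ 2) * (\sum_(i <- s) b i ^+ 2)) -
   2 * (\sum_(i <- s) a i * b i) ^+ 2.
  transitivity (\sum_(i <- s) (a i ^+ 2 * (\sum_(k <- s) b k ^+ 2) +
     (b i ^+ 2 * (\sum_(k <- s) a k ^+ 2)) - 2 * (a i * b i) * \sum_(k <- s) a k * b k)).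
    apply: eq_bigr => i _; rewrite !big_distrr /= -big_split -sumrB /=.
    by apply: eq_bigr => k _; ring.
  rewrite sumrB big_split /= -!big_distrl /= -big_distrr /=; ring.
lra.
Qed.

Definition l2 (J : nat) (T : Type) (f : nat -> T -> R) (x : T) : R :=
  Num.sqrt (\sum_(j < J) f j x ^+ 2).

Lemma l2_ge0 J T (f : nat -> T -> R) x : 0 <= l2 J f x.
Proof. exact: sqrtr_ge0. Qed.

Lemma l2_le_sum J T (f : nat -> T -> R) x : l2 J f x <= \sum_(j < J) `|f j x|.
Proof.
have S0 : 0 <= \sum_(j < J) `|f j x| by apply: sumr_ge0.
rewrite -[leRHS]ger0_norm// -sqrtr_sqr ler_sqrt ?sqr_ge0//.
elim: J {S0} => [|J IH]; first by rewrite !big_ord0 expr0n.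
rewrite !big_ord_recr /= sqrrD real_normK ?num_real// lerD2r.
apply: (le_trans IH); rewrite lerDl mulrn_wge0// mulr_ge0//.
by apply: sumr_ge0.
Qed.

Lemma l2_ge J T (f : nat -> T -> R) x (j : 'I_J) : `|f j x| <= l2 J f x.
Proof.
rewrite -sqrtr_sqr ler_sqrt; last by apply: sumr_ge0 => i _; exact: sqr_ge0.
by rewrite (bigD1 j)//= lerDl sumr_ge0// => i _; exact: sqr_ge0.
Qed.

Context d (T : measurableType d) (mu : {measure set T -> \bar R}).
Local Notation L1 f := (mu.-integrable setT (EFin \o f)).

Lemma l2_measurable J (f : nat -> T -> R) :
  (forall j, measurable_fun setT (f j)) -> measurable_fun setT (l2 J f).
Proof.
move=> mf; rewrite /l2.
apply: (measurableT_comp (continuous_measurable_fun (@sqrt_continuous R))).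
by apply: measurable_sum => j; exact: measurable_funX.
Qed.

Lemma l2_L1 J (f : nat -> T -> R) : (forall j, L1 (f j)) -> L1 (l2 J f).
Proof.
move=> fi; apply: (@L1_le _ _ _ mu _ (fun x => \sum_(j < J) `|f j x|)).
- by apply: l2_measurable => j; exact: L1_measurable (fi j).
- by apply: L1_sum => j; exact: L1_norm.
- by move=> x; rewrite ger0_norm ?l2_ge0//; exact: l2_le_sum.
Qed.

(* Minkowski's integral inequality, by duality with v itself. *)
Lemma l2_Rintegral_le J (f : nat -> T -> R) (k : T -> R) (B : R) (v : nat -> R) :
  (forall j, L1 (f j)) -> measurable_fun setT k -> (forall x, 0 <= k x <= B) ->
  (forall j, (j < J)%N -> `|v j| <= \int[mu]_x (k x * `|f j x|)) ->
  \sum_(j < J) v j ^+ 2 <= (\int[mu]_x (k x * l2 J f x)) ^+ 2.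
Proof.
move=> fi mk kB vJ.
set V := \sum_(j < J) _.
have kB' x : `|k x| <= B by have /andP[? ?] := kB x; rewrite ger0_norm.
have k0 x : 0 <= k x by have /andP[] := kB x.
have iF : L1 (fun x => k x * l2 J f x) by apply: L1M mk kB' _; exact: l2_L1.
have ikf j : L1 (fun x => k x * `|f j x|) by apply: L1M mk kB' _; exact: L1_norm.
have V0 : 0 <= V by apply: sumr_ge0 => j _; exact: sqr_ge0.
have I0 : 0 <= \int[mu]_x (k x * l2 J f x).
  by apply: I_ge0 => x; rewrite mulr_ge0 ?l2_ge0.
have : V <= Num.sqrt V * \int[mu]_x (k x * l2 J f x).
  apply: (@le_trans _ _ (\sum_(j < J) `|v j| * \int[mu]_x (k x * `|f j x|))).
    apply: ler_sum => j _; rewrite -real_normK ?num_real// expr2.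
    by rewrite ler_wpM2l// vJ.
  rewrite -IZ//.
  apply: (@le_trans _ _ (\int[mu]_x (\sum_(j < J) `|v j| * (k x * `|f j x|)))).
    rewrite Isum; last by move=> j; exact: L1Z.
    by apply: ler_sum => j _; rewrite IZ.
  apply: I_le.
  - by apply: L1_sum => j; exact: L1Z.
  - exact: L1Z.
  move=> x.
  have -> : \sum_(j < J) `|v j| * (k x * `|f j x|) =
      k x * \sum_(j < J) `|v j| * `|f j x|.
    by rewrite big_distrr /=; apply: eq_bigr => j _; ring.
  rewrite mulrCA ler_wpM2l//.
  have h0 : 0 <= \sum_(j < J) `|v j| * `|f j x|.
    by apply: sumr_ge0 => j _; rewrite mulr_ge0.
  rewrite -(ler_pXn2r (n := 2))// ?nnegrE ?mulr_ge0 ?sqrtr_ge0//.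
  apply: (le_trans (cauchy_schwarz _ _ _)).
  rewrite exprMn !sqr_sqrtr//; last by apply: sumr_ge0 => i _; exact: sqr_ge0.
  rewrite le_eqVlt; apply/orP; left; apply/eqP.
  by congr (_ * _); apply: eq_bigr => j _; rewrite real_normK ?num_real.
have [->|Vn0] := eqVneq V 0; first by rewrite sqr_ge0.
have sV : 0 < Num.sqrt V by rewrite sqrtr_gt0 lt_neqAle eq_sym Vn0.
rewrite -{1}(sqr_sqrtr V0) expr2 ler_pM2l// => h.
by rewrite -(sqr_sqrtr V0) ler_pXn2r// nnegrE ltW.
Qed.

End finite_l2.

(** * Dyadic subdivision with a stopping rule *)

Section calderon_zygmund.
Context {R : realType} {n : nat}.
Local Notation Rn := 'rV[R]_n.
Local Notation lam := (@lebesgue_rV R n).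
Local Notation L1 f := (lam.-integrable setT (EFin \o f)).

Definition child (c : Rn) (r : R) (e : {ffun 'I_n -> bool}) : Rn :=
  \row_i (c ord0 i + (if e i then r / 2 else - (r / 2))).

Lemma indic_cubeE (c : Rn) (r : R) z :
  \1_(cube c r) z = \prod_(i < n) (c ord0 i - r <= z ord0 i < c ord0 i + r)%R%:R :> R.
Proof.
have [cz|cz] := pselect (cube c r z).
  by rewrite indic_in// big1// => i _; rewrite cz.
rewrite indic_notin//; apply/esym/eqP; rewrite prodf_seq_eq0.
have : exists i, ~~ (c ord0 i - r <= z ord0 i < c ord0 i + r).
  by apply/existsP; rewrite -negb_forall; apply/forallP.
move=> [i hi]; apply/hasP; exists i; first exact: mem_index_enum.
by rewrite /= (negbTE hi).
Qed.

(** On each axis the two half-open halves partition the interval exactly; distributing the product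
    over these sums runs through all sign choices. *)
Lemma indic_cube_split (c : Rn) (r : R) z : 0 < r ->
  \1_(cube c r) z = \sum_(e : {ffun 'I_n -> bool}) \1_(cube (child c r e) (r / 2)) z :> R.
Proof.
move=> r0; rewrite indic_cubeE.
under [RHS]eq_bigr do rewrite indic_cubeE.
transitivity (\prod_(i < n) \sum_(b : bool)
    (c ord0 i + (if b then r / 2 else - (r / 2)) - r / 2 <= z ord0 i <
     c ord0 i + (if b then r / 2 else - (r / 2)) + r / 2)%R%:R : R); last first.
  rewrite bigA_distr_bigA /=; apply: eq_bigr => e _; apply: eq_bigr => i _.
  by rewrite !mxE.
apply: eq_bigr => i _; rewrite big_bool /=.
set u := c ord0 i; set t := z ord0 i.
have -> : u + r / 2 - r / 2 = u by ring.
have -> : u + r / 2 + r / 2 = u + r by field.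
have -> : u - r / 2 - r / 2 = u - r by field.
have -> : u - r / 2 + r / 2 = u by ring.
have [h1|h1] := leP (u - r) t; have [h2|h2] := ltP t (u + r);
  have [h3|h3] := leP u t => //=; rewrite ?addr0 ?add0r//; exfalso; lra.
Qed.

Definition mass (F : Rn -> R) (q : Rn * R) := \int[lam]_x (\1_(cube q.1 q.2) x * F x).

Lemma mass_le F c r c' r' : L1 F -> (forall x, 0 <= F x) ->
  cube c r `<=` cube c' r' -> mass F (c, r) <= mass F (c', r').
Proof.
move=> iF F0 sub; apply: I_le.
- by apply: L1_indic => //; exact: measurable_cube.
- by apply: L1_indic => //; exact: measurable_cube.
- by move=> x; rewrite ler_wpM2r//; exact: indic_sub.
Qed.

Variables (F : Rn -> R) (sigma : R).
Hypotheses (iF : L1 F) (F0 : forall x, 0 <= F x) (sigma0 : 0 < sigma).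

(* Stopping after N subdivisions leaves cells on which F is not large; they are
   only controlled by their size, r / 2^N. *)
Lemma CZ N (c : Rn) (r : R) : 0 < r ->
  mass F (c, r) <= sigma * (2 * r) ^+ n ->
  exists P : seq (Rn * R),
    (forall x, \1_(cube c r) x = \sum_(q <- P) \1_(cube q.1 q.2) x :> R) /\
    forall q, q \in P -> [/\ 0 < q.2,
      mass F q <= 2 ^+ n * sigma * (2 * q.2) ^+ n &
      (sigma * (2 * q.2) ^+ n < mass F q) \/ q.2 = r / 2 ^+ N].
Proof.
elim: N c r => [|N IH] c r r0 mr.
  exists [:: (c, r)]; split=> [x|q]; first by rewrite big_seq1.
  rewrite inE => /eqP ->; split => //=; last by right; rewrite expr0 divr1.
  apply: (le_trans mr); apply: ler_wpM2r.
    by rewrite exprn_ge0// mulr_ge0// ltW.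
  by rewrite ler_peMl ?(ltW sigma0)// exprn_ege1// ler1n.
have r20 : 0 < r / 2 by rewrite divr_gt0.
have sub e : cube (child c r e) (r / 2) `<=` cube c r.
  apply: sub_cube => i; rewrite mxE; case: (e i).
    by rewrite addrAC subrr add0r ger0_norm; lra.
  by rewrite addrAC subrr add0r normrN ger0_norm; lra.
have H e : exists P : seq (Rn * R),
    (forall x, \1_(cube (child c r e) (r / 2)) x = \sum_(q <- P) \1_(cube q.1 q.2) x :> R) /\
    forall q, q \in P -> [/\ 0 < q.2,
      mass F q <= 2 ^+ n * sigma * (2 * q.2) ^+ n &
      (sigma * (2 * q.2) ^+ n < mass F q) \/ q.2 = r / 2 ^+ N.+1].
  have [h|h] := leP (mass F (child c r e, r / 2)) (sigma * (2 * (r / 2)) ^+ n).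
    have [P [P1 P2]] := IH _ _ r20 h; exists P; split => // q /P2[q1 q2 q3].
    split => //; case: q3 => [|->]; first by left.
    by right; rewrite exprS invfM mulrA.
  exists [:: (child c r e, r / 2)]; split=> [x|q]; first by rewrite big_seq1.
  rewrite inE => /eqP ->; split => //=; last by left.
  (* A selected child inherits the mass bound of its parent, whose volume is 2^n times larger. *)
  apply: (le_trans (mass_le iF F0 (@sub e))); apply: (le_trans mr).
  by rewrite -mulrA mulrCA -exprMn (_ : 2 * (2 * (r / 2)) = 2 * r)//; field.
have [f fP] := choice H.
exists (flatten [seq f e | e <- index_enum {ffun 'I_n -> bool}]); split.
  move=> x; rewrite indic_cube_split// big_flatten big_map.
  by apply: eq_bigr => e _; rewrite (fP e).1.
by move=> q /flatten_mapP[e _ qe]; exact: (fP e).2.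
Qed.

End calderon_zygmund.

(** * Weak type (1,1) *)

Section cells.
Context {R : realType} {n : nat}.
Local Notation Rn := 'rV[R]_n.
Local Notation lam := (@lebesgue_rV R n).
Local Notation L1 f := (lam.-integrable setT (EFin \o f)).

Definition avg (h : Rn -> R) (q : Rn * R) := mass h q / (2 * q.2) ^+ n.

(** For integrable h this is also the integral over the cell of (h - avg h) p: the pairing of the
    bad part of h with p, with the cancellation moved onto p. *)
Definition osc (h p : Rn -> R) (q : Rn * R) :=
  \int[lam]_x (\1_(cube q.1 q.2) x * h x * (p x - avg p q)).

Lemma mass_L1 (h : Rn -> R) (q : Rn * R) : L1 h -> L1 (fun x => \1_(cube q.1 q.2) x * h x).
Proof. by move=> ih; apply: L1_indic => //; exact: measurable_cube. Qed.

Lemma mass_ge0 (h : Rn -> R) (q : Rn * R) : (forall x, 0 <= h x) -> 0 <= mass h q.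
Proof. by move=> h0; apply: I_ge0 => x; rewrite mulr_ge0// indic_ge0. Qed.

Lemma abs_mass_le (h : Rn -> R) (q : Rn * R) : L1 h -> `|mass h q| <= mass (fun x => `|h x|) q.
Proof.
move=> ih; apply: I_abs_le.
- exact: mass_L1.
- by apply: mass_L1; exact: L1_norm.
- by move=> x; rewrite normrM ger0_norm// indic_ge0.
Qed.

Variables (a K : R) (a0 : 0 < a) (K0 : 0 < K).
Variables (c : Rn) (l : R) (p : Rn -> R) (l0 : 0 < l).
Hypothesis pP : adapted a K c l p.
Variables (h : Rn -> R) (ih : L1 h) (q : Rn * R) (q0 : 0 < q.2).

Let iq : L1 (fun x => \1_(cube q.1 q.2) x * h x). Proof. exact: mass_L1. Qed.

Let ip : L1 p. Proof. exact: adapted_L1 a0 K0 l0 pP. Qed.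

Let iphq : L1 (fun x => \1_(cube q.1 q.2) x * (h x * p x)).
Proof.
rewrite (_ : (fun _ => _) = fun x => p x * (\1_(cube q.1 q.2) x * h x)).
  exact: (adapted_mul_L1 a0 K0 l0 pP (f := fun x => \1_(cube q.1 q.2) x * h x) iq).
by apply/funext => x; ring.
Qed.

Lemma mass_split : mass (fun x => h x * p x) q = avg h q * mass p q + osc h p q.
Proof.
have -> : osc h p q = \int[lam]_x (\1_(cube q.1 q.2) x * (h x * p x) -
    avg p q * (\1_(cube q.1 q.2) x * h x)).
  by apply: eq_I => x; ring.
rewrite IB//; last exact: L1Z.
rewrite IZ// /avg -/(mass h q) -/(mass (fun x => h x * p x) q); ring.
Qed.

Lemma avg_close x : cube q.1 q.2 x ->
  `|p x - avg p q| <= K / l ^+ n * (2 * q.2 / l) `^ a.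
Proof.
move=> qx; set B := K / l ^+ n * _.
have q2 : 0 < (2 * q.2) ^+ n by rewrite exprn_gt0// mulr_gt0.
have ic : L1 (\1_(cube q.1 q.2) : Rn -> R) by exact: L1_cube.
have icp : L1 (fun y => \1_(cube q.1 q.2) y * p y) by exact: mass_L1.
have -> : p x - avg p q = ((2 * q.2) ^+ n)^-1 *
    \int[lam]_y (\1_(cube q.1 q.2) y * (p x - p y)).
  have -> : \int[lam]_y (\1_(cube q.1 q.2) y * (p x - p y)) =
    \int[lam]_y (p x * \1_(cube q.1 q.2) y - \1_(cube q.1 q.2) y * p y).
    by apply: eq_I => y; ring.
  rewrite IB//; last exact: L1Z.
  rewrite IZ// I_cube// /avg /mass; field.
  by rewrite gt_eqF//.
have qi0 : 0 <= ((2 * q.2) ^+ n)^-1 by rewrite invr_ge0 ltW.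
rewrite normrM (ger0_norm qi0) ler_pdivrMl//.
apply: (@le_trans _ _ (\int[lam]_y (B * \1_(cube q.1 q.2) y))); last first.
  by rewrite IZ// I_cube// mulrC.
apply: I_abs_le.
- rewrite (_ : (fun _ => _) = fun y => p x * \1_(cube q.1 q.2) y - \1_(cube q.1 q.2) y * p y).
    by apply: L1B => //; exact: L1Z.
  by apply/funext => y; ring.
- exact: L1Z.
move=> y; have [qy|qy] := pselect (cube q.1 q.2 y); last first.
  by rewrite indic_notin// mul0r normr0 mulr0.
rewrite indic_in// mul1r mulr1; case: pP => _ _ _; apply; first by rewrite mulr_gt0.
have := supdist_le_trans (supdist_le_sym (cube_supdist_le qx)) (cube_supdist_le qy).
by apply: supdist_le_le; lra.
Qed.

Lemma osc_le : `|osc h p q| <=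
  K / l ^+ n * (2 * q.2 / l) `^ a * mass (fun x => `|h x|) q.
Proof.
rewrite -IZ; last by apply: mass_L1; exact: L1_norm.
apply: I_abs_le.
- rewrite (_ : (fun _ => _) = fun x => \1_(cube q.1 q.2) x * (h x * p x) -
    avg p q * (\1_(cube q.1 q.2) x * h x)).
    by apply: L1B => //; exact: L1Z.
  by apply/funext => x; ring.
- by apply/L1Z/mass_L1; exact: L1_norm.
move=> x; have [qx|qx] := pselect (cube q.1 q.2 x); last first.
  by rewrite indic_notin// !mul0r normr0 mulr0.
rewrite indic_in// !mul1r normrM mulrC ler_wpM2r//.
exact: avg_close.
Qed.

Lemma osc_far : ~ (exists x, cube q.1 q.2 x /\ cube c (4 * l) x) -> osc h p q = 0.
Proof.
move=> far; have p0 x : cube q.1 q.2 x -> p x = 0.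
  move=> qx; case: pP => + _ _ _; apply => cx; apply: far.
  by exists x.
have av0 : avg p q = 0.
  rewrite /avg (_ : mass p q = 0) ?mul0r// -[RHS](@I0 _ _ _ lam).
  apply: eq_I => x; have [qx|qx] := pselect (cube q.1 q.2 x).
    by rewrite p0// mulr0.
  by rewrite indic_notin// mul0r.
rewrite -[RHS](@I0 _ _ _ lam); apply: eq_I => x; rewrite av0.
have [qx|qx] := pselect (cube q.1 q.2 x); first by rewrite p0// subr0 mulr0.
by rewrite indic_notin// !mul0r.
Qed.

End cells.

(** * The weak type bound for a given partition into stopping cells *)

Section weak_type_cells.
Context {R : realType} {n : nat}.
Local Notation Rn := 'rV[R]_n.
Local Notation lam := (@lebesgue_rV R n).
Local Notation L1 f := (lam.-integrable setT (EFin \o f)).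
Variables (A : R) (w : Rn -> R).
Hypothesis A0 : 0 < A.
Hypothesis wP : A1_cube A w.
Variables (a K : R) (a0 : 0 < a) (K0 : 0 < K).
Variables (s : seq (@idx n)) (psi : @idx n -> nat -> Rn -> R).
Hypothesis us : uniq s.
Hypothesis psiP : forall r j, adapted a K (ctr r) (len r.1) (psi r j).
Variables (J : nat) (f : nat -> Rn -> R).
Hypothesis fi : forall j, L1 (f j).
Local Notation F := (l2 J f).
Hypothesis iFw : L1 (fun x => F x * w x).
Variables (sigma : R) (sigma0 : 0 < sigma).
Variables (c0 : Rn) (rho : R) (rho0 : 0 < rho).
Hypothesis fsupp : forall j x, ~ cube c0 rho x -> f j x = 0.

Variables (m : nat) (q : 'I_m -> Rn * R).
Hypothesis q0 : forall i, 0 < (q i).2.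
Hypothesis qsum : forall x,
  \1_(cube c0 rho) x = \sum_i \1_(cube (q i).1 (q i).2) x :> R.
Hypothesis qmass : forall i, mass F (q i) <= 2 ^+ n * sigma * (2 * (q i).2) ^+ n.

Local Notation qi i := (cube (q i).1 (q i).2).
Local Notation star r := (cube (ctr r : Rn) (4 * len r.1)).
Local Notation pair h p := (\int[lam]_x (h x * p x)).

Let iF : L1 F. Proof. exact: l2_L1. Qed.
Let w0 x : 0 < w x. Proof. by case: wP. Qed.
Let Fw0 x : 0 <= F x * w x. Proof. by rewrite mulr_ge0 ?l2_ge0// ltW. Qed.
Let l0 (r : @idx n) : 0 < len r.1 :> R. Proof. exact: len_gt0. Qed.
Let l40 (r : @idx n) : 0 < 4 * len r.1 :> R. Proof. by rewrite mulr_gt0. Qed.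
Let iw c (r : R) : 0 < r -> L1 (fun x => \1_(cube c r) x * w x).
Proof. by case: wP => _ _ + _; apply. Qed.

Lemma cells_mass_le (h : Rn -> R) (B : pred 'I_m) : L1 h ->
  (forall x, 0 <= h x) -> \sum_(i | B i) mass h (q i) <= \int[lam]_x h x.
Proof.
move=> ih h0; rewrite -Isum; last by move=> i; exact: mass_L1.
apply: I_le => //; first by apply: L1_sum => i; exact: mass_L1.
move=> x; rewrite -big_distrl /= -[leRHS]mul1r ler_wpM2r//.
apply: (@le_trans _ _ (\sum_i \1_(qi i) x)).
  rewrite [leRHS](bigID B) /= lerDl; apply: sumr_ge0 => i _.
  exact: indic_ge0.
by rewrite -qsum indic_le.
Qed.

Lemma wcube_mass_le i c (r : R) : 0 < r -> qi i `<=` cube c r ->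
  wcube w c r * mass F (q i) <= A * r ^+ n * mass (fun x => F x * w x) (q i).
Proof.
move=> r0 sub; apply: (wcube_le_int A0 wP) => //.
- by move=> x; exact: l2_ge0.
- exact: mass_L1.
- exact: mass_L1.
Qed.

Definition big i := sigma * (2 * (q i).2) ^+ n < mass F (q i).

(** On a selected cell sigma |q| is below the mass of [F], and A_1 on the cube nine times larger
    turns that mass into a weighted one. The factor 9 is what [far_near_geometry] needs; (9/2)^n is
    a ratio of a ninth-fold radius to a side length, to the power n. *)
Lemma big_cells_le :
  \sum_(i | big i) wcube w (q i).1 (9 * (q i).2) <=
  A * (9 / 2) ^+ n / sigma * \int[lam]_x (F x * w x).
Proof.
have C0 : 0 <= A * (9 / 2) ^+ n / sigma.
  by rewrite divr_ge0 ?mulr_ge0 ?exprn_ge0 ?divr_ge0// ltW.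
apply: le_trans (ler_wpM2l C0 (cells_mass_le big iFw Fw0)); rewrite big_distrr /=.
apply: ler_sum => i bi.
have q2 : 0 < (2 * (q i).2) ^+ n by rewrite exprn_gt0// mulr_gt0.
have q9 : 0 < 9 * (q i).2 by rewrite mulr_gt0.
have sub : qi i `<=` cube (q i).1 (9 * (q i).2).
  by apply: sub_cube_radius; have := q0 i; lra.
have h := wcube_mass_le q9 sub.
have h2 : wcube w (q i).1 (9 * (q i).2) * (sigma * (2 * (q i).2) ^+ n) <=
    wcube w (q i).1 (9 * (q i).2) * mass F (q i).
  by rewrite ler_wpM2l// ltW// (wcube_gt0 wP).
have sq0 : 0 < sigma * (2 * (q i).2) ^+ n by rewrite mulr_gt0.
rewrite -(ler_pM2r sq0); apply: (le_trans h2); apply: (le_trans h).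
rewrite le_eqVlt; apply/orP; left; apply/eqP.
rewrite expr_div_n !exprMn; field.
by rewrite gt_eqF//= expf_neq0.
Qed.

(** The average is taken on unselected cells as well; the resulting discrepancy there is [err]. *)
Definition good_part j x := \sum_i avg (f j) (q i) * \1_(qi i) x.

Lemma good_measurable j : measurable_fun [set: lebesgue_type n] (good_part j).
Proof.
apply: measurable_sum => i; apply: (measurable_funM (measurable_cst _)).
exact/measurable_indicT/measurable_cube.
Qed.

Lemma good_supp j x : ~ cube c0 rho x -> good_part j x = 0.
Proof.
move=> cx; have := qsum x; rewrite indic_notin// => /esym/eqP.
rewrite psumr_eq0 => [/allP h|i _]; last exact: indic_ge0.
by rewrite /good_part big1// => i _; move: (h i (mem_index_enum i)) => /eqP ->; rewrite mulr0.
Qed.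

(** Minkowski's inequality with the normalised indicator of the cell as kernel. *)
Lemma avg_sqr_sum i : \sum_(j < J) avg (f j) (q i) ^+ 2 <= avg F (q i) ^+ 2.
Proof.
have q2 : 0 < (2 * (q i).2) ^+ n by rewrite exprn_gt0// mulr_gt0.
have qi0 : 0 < ((2 * (q i).2) ^+ n)^-1 by rewrite invr_gt0.
have -> : avg F (q i) = \int[lam]_x (((2 * (q i).2) ^+ n)^-1 * \1_(qi i) x * F x).
  rewrite /avg mulrC -IZ; last exact: mass_L1.
  by apply: eq_I => x; rewrite mulrA.
apply: (@l2_Rintegral_le _ _ _ lam J f
  (fun x => ((2 * (q i).2) ^+ n)^-1 * \1_(qi i) x) ((2 * (q i).2) ^+ n)^-1
  (fun j => avg (f j) (q i)) fi).
- apply: (measurable_funM (measurable_cst _)).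
  exact/measurable_indicT/measurable_cube.
- move=> x; rewrite mulr_ge0 ?indic_ge0 ?(ltW qi0)//= ler_piMr ?(ltW qi0)//.
- move=> j _; rewrite /avg normrM [X in _ * X]ger0_norm ?(ltW qi0)//.
  rewrite mulrC; under eq_I do rewrite -mulrA.
  rewrite IZ; last by apply: mass_L1; exact: L1_norm.
  by rewrite ler_wpM2l ?(ltW qi0)//; exact: abs_mass_le.
Qed.

Lemma avgF i : 0 <= avg F (q i) <= 2 ^+ n * sigma.
Proof.
have q2 : 0 < (2 * (q i).2) ^+ n by rewrite exprn_gt0// mulr_gt0.
rewrite /avg divr_ge0 ?(ltW q2) ?mass_ge0//=; last by move=> x; exact: l2_ge0.
by rewrite ler_pdivrMr.
Qed.

Lemma good_sqr_sum x : \sum_(j < J) good_part j x ^+ 2 <=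
  2 ^+ n * sigma * \sum_i avg F (q i) * \1_(qi i) x.
Proof.
have ii i : \1_(qi i) x * \1_(qi i) x = \1_(qi i) x :> R.
  by rewrite indicE; case: (_ \in _); rewrite ?mulr1 ?mulr0.
apply: (@le_trans _ _ (\sum_(j < J) \sum_i avg (f j) (q i) ^+ 2 * \1_(qi i) x)).
  apply: ler_sum => j _.
  rewrite /good_part (eq_bigr (fun i => \1_(qi i) x * (avg (f j) (q i) * \1_(qi i) x))); last first.
    by move=> i _; rewrite mulrCA ii.
  (* The cells partition the starting cube, so the factor made of squared indicators is an
     indicator, at most 1. *)
  apply: (le_trans (cauchy_schwarz _ _ _)).
  rewrite (eq_bigr (fun i => \1_(qi i) x)); last by move=> i _; rewrite expr2 ii.
  rewrite -qsum.
  rewrite [X in _ * X](eq_bigr (fun i => avg (f j) (q i) ^+ 2 * \1_(qi i) x)); last first.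
    by move=> i _; rewrite exprMn [\1_(qi i) x ^+ 2]expr2 ii.
  rewrite ler_piMl//.
    by apply: sumr_ge0 => i _; rewrite mulr_ge0 ?sqr_ge0 ?indic_ge0.
rewrite exchange_big /= big_distrr /=; apply: ler_sum => i _.
rewrite -big_distrl /= mulrA ler_wpM2r ?indic_ge0//.
apply: (le_trans (avg_sqr_sum i)).
have /andP[h1 h2] := avgF i.
by rewrite expr2 ler_wpM2r.
Qed.

(** One factor [avg F] is bounded by 2^n sigma. By A_1 on the cell itself, the other times w(q) is
    at most A 2^-n times the integral of F w over q, so the powers of 2 cancel. *)
Lemma good_part_le : \sum_(j < J) \sum_(r <- s) wcube w (ctr r) (4 * len r.1) *
    pair (good_part j) (psi r j) ^+ 2 <=
  @L2w_const R n A a K * (A * sigma) * \int[lam]_x (F x * w x).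
Proof.
have gb j : exists G, forall x, `|good_part j x| <= G.
  exists (\sum_i `|avg (f j) (q i)|) => x; rewrite (le_trans (ler_norm_sum _ _ _))//.
  by apply: ler_sum => i _; rewrite normrM ler_piMr// indic_le1.
have C0 : 0 <= @L2w_const R n A a K.
  rewrite /L2w_const; apply: mulr_ge0.
    by apply: mulr_ge0 => //; exact: ltW (L2_const_gt0 a0 K0).
  by apply: mulr_ge0; rewrite ?exprn_ge0 ?(ltW A0).
have mw : measurable_fun [set: lebesgue_type n] w by case: wP.
have ig2w j : L1 (fun x => good_part j x ^+ 2 * w x).
  have [G gG] := gb j.
  apply: (@L1_le _ (lebesgue_type n) R lam _
    (fun x => G ^+ 2 * (\1_(cube c0 rho) x * w x))).
  - apply: (measurable_funM _ mw); apply: measurable_funX.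
    exact: good_measurable.
  - exact/L1Z/iw.
  move=> x; have [cx|cx] := pselect (cube c0 rho x); last first.
    by rewrite good_supp// expr0n mul0r normr0 indic_notin// mul0r mulr0.
  rewrite indic_in// mul1r normrM [`|w x|]gtr0_norm// ler_wpM2r ?(ltW (w0 x))//.
  by rewrite normrX; apply: lerXn2r; rewrite ?nnegrE// (le_trans (normr_ge0 _) (gG x)).
apply: (@le_trans _ _ (\sum_(j < J) @L2w_const R n A a K *
    \int[lam]_x (good_part j x ^+ 2 * w x))).
  apply: ler_sum => j _; have [G gG] := gb j.
  apply: (@L2w_bound R n A w A0 wP a K a0 K0 s (fun r => psi r j) us _
    (good_part j) G c0 rho (good_measurable j) gG rho0 (@good_supp j)) => r.
  exact: psiP.
rewrite -big_distrr /= -[leRHS]mulrA ler_wpM2l//.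
rewrite -Isum//.
have iqw i : L1 (fun x => \1_(qi i) x * w x) by exact: iw.
apply: (@le_trans _ _ (\int[lam]_x (2 ^+ n * sigma *
    \sum_i avg F (q i) * (\1_(qi i) x * w x)))).
  apply: I_le; first exact: L1_sum.
    by apply: L1Z; apply: L1_sum => i; exact: L1Z.
  move=> x; rewrite -big_distrl /=.
  have := ler_wpM2r (ltW (w0 x)) (good_sqr_sum x).
  rewrite -[X in _ <= X -> _]mulrA [X in _ <= _ * X -> _]big_distrl /=.
  by under [X in _ <= _ * X -> _]eq_bigr do rewrite -mulrA.
rewrite IZ; last by apply: L1_sum => i; exact: L1Z.
rewrite Isum; last by move=> i; exact: L1Z.
apply: (@le_trans _ _ (A * sigma * \sum_i mass (fun x => F x * w x) (q i))); last first.
  rewrite ler_wpM2l ?mulr_ge0 ?(ltW A0) ?(ltW sigma0)//.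
  exact: (cells_mass_le xpredT iFw Fw0).
rewrite !big_distrr /=; apply: ler_sum => i _.
rewrite IZ// -/(wcube w (q i).1 (q i).2).
have q2 : 0 < (2 * (q i).2) ^+ n by rewrite exprn_gt0// mulr_gt0.
have := wcube_mass_le (q0 i) (@subset_refl _ (qi i)).
rewrite /avg => h.
rewrite [leLHS](_ : _ = (2 ^+ n * sigma / (2 * (q i).2) ^+ n) *
  (wcube w (q i).1 (q i).2 * mass F (q i))); last by ring.
have C1 : 0 <= 2 ^+ n * sigma / (2 * (q i).2) ^+ n.
  by rewrite divr_ge0 ?mulr_ge0 ?exprn_ge0 ?mulr_ge0// ltW.
apply: (le_trans (ler_wpM2l C1 h)).
rewrite le_eqVlt; apply/orP; left; apply/eqP.
rewrite exprMn; field.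
by rewrite !expf_neq0 ?gt_eqF.
Qed.

Definition near r i : bool := `[< exists x, qi i x /\ star r x >].

(** Holds for every box whose star contains a point outside all enlarged selected cells, which are
    the only boxes seen from such a point. *)
Definition far_from_big r : bool :=
  `[< forall i, big i -> ~ (star r `<=` cube (q i).1 (9 * (q i).2)) >].

Definition ker (r : @idx n) i := K / len r.1 ^+ n * (2 * (q i).2 / len r.1) `^ a.

Definition bad r j := \sum_(i | big i) osc (f j) (psi r j) (q i).

(* The cells that were never selected: negligible once they are small enough. *)
Definition err r j := \sum_(i | ~~ big i) osc (f j) (psi r j) (q i).

Definition bad_bound r := \sum_(i | big i && near r i) ker r i * mass F (q i).

Lemma ker_ge0 r i : 0 <= ker r i.
Proof.
by rewrite /ker mulr_ge0 ?powR_ge0// divr_ge0 ?exprn_ge0// ltW.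
Qed.

Lemma bad_bound_ge0 r : 0 <= bad_bound r.
Proof.
apply: sumr_ge0 => i _; rewrite mulr_ge0 ?ker_ge0// mass_ge0// => x.
exact: l2_ge0.
Qed.

(** Minkowski's inequality with a kernel constant on cells: the sum over j is absorbed into [F]
    before any weight appears. Cells not meeting the star contribute zero by [osc_far]. *)
Lemma bad_sqr_sum r : \sum_(j < J) bad r j ^+ 2 <= bad_bound r ^+ 2.
Proof.
pose k x := \sum_(i | big i && near r i) ker r i * \1_(qi i) x.
have massE (h : Rn -> R) : L1 h -> \int[lam]_x (k x * h x) =
    \sum_(i | big i && near r i) ker r i * mass h (q i).
  move=> ih.
  have -> : \int[lam]_x (k x * h x) = \int[lam]_x
      (\sum_(i | big i && near r i) ker r i * (\1_(qi i) x * h x)).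
    apply: eq_I => x; rewrite /k big_distrl /=; apply: eq_bigr => i _.
    by rewrite mulrA.
  rewrite Isum; last by move=> i; apply/L1Z/mass_L1.
  by apply: eq_bigr => i _; rewrite IZ//; exact: mass_L1.
rewrite /bad_bound -massE//.
apply: (@l2_Rintegral_le _ _ _ lam J f k (\sum_(i | big i && near r i) ker r i)
  (bad r) fi).
- apply: (@L1_measurable _ _ _ lam k); apply: L1_sum => i; apply: L1Z.
  exact: L1_cube.
- move=> x; apply/andP; split.
    by apply: sumr_ge0 => i _; rewrite mulr_ge0 ?ker_ge0 ?indic_ge0.
  by apply: ler_sum => i _; rewrite ler_piMr ?ker_ge0 ?indic_le.
move=> j _; rewrite massE; last exact: L1_norm.
rewrite /bad (le_trans (ler_norm_sum _ _ _))//.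
rewrite (bigID (near r)) /= [X in _ + X]big1 ?addr0; last first.
  move=> i /andP[_ /asboolPn nri].
  by rewrite (osc_far (psiP r j)) ?normr0.
by apply: ler_sum => i _; exact: (osc_le a0 K0 (l0 r) (psiP r j) (fi j) (q0 i)).
Qed.

(** For a fixed box the bound tends to zero with [delta], the common radius of the unselected
    cells. *)
Lemma err_le delta r j : (forall i, ~~ big i -> (q i).2 = delta) ->
  `|err r j| <= K / len r.1 ^+ n * (2 * delta / len r.1) `^ a *
     \int[lam]_x `|f j x|.
Proof.
move=> qd; rewrite /err (le_trans (ler_norm_sum _ _ _))//.
apply: (@le_trans _ _ (\sum_(i | ~~ big i) K / len r.1 ^+ n *
    (2 * delta / len r.1) `^ a * mass (fun x => `|f j x|) (q i))).
  apply: ler_sum => i bi; rewrite -(qd i bi).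
  exact: (osc_le a0 K0 (l0 r) (psiP r j) (fi j) (q0 i)).
rewrite -big_distrr /= ler_wpM2l//.
  by rewrite mulr_ge0 ?powR_ge0// divr_ge0 ?exprn_ge0// ltW.
by apply: cells_mass_le => //; exact: L1_norm.
Qed.

(** If the cell were at least as coarse as the box, a star meeting it would lie within q.2 + 8 len
    <= 9 q.2 of its centre. Hence the cell is finer, the centres are within 5 len, and the star
    within 5 + 4 = 9 len. *)
Lemma far_near_geometry r i : big i -> far_from_big r -> near r i ->
  [/\ (q i).2 < len r.1, supdist_le (5 * len r.1) (q i).1 (ctr r) &
      star r `<=` cube (q i).1 (9 * len r.1)].
Proof.
move=> bi /asboolP /(_ _ bi) nsub /asboolP[x [qx rx]].
have d := supdist_le_trans (cube_supdist_le qx) (supdist_le_sym (cube_supdist_le rx)).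
have qr : (q i).2 < len r.1.
  rewrite ltNge; apply/negP => h; apply: nsub; apply: sub_cube.
  by apply/supdist_le_sym/(supdist_le_le _ d); lra.
split => //.
  by apply: supdist_le_le d; lra.
by apply: sub_cube; apply/supdist_le_sym/(supdist_le_le _ d); lra.
Qed.

Lemma wcube_mono c c' (r r' : R) : 0 < r -> 0 < r' -> cube c r `<=` cube c' r' ->
  wcube w c r <= wcube w c' r'.
Proof.
move=> r0 r'0 sub; apply: I_le; [exact: iw|exact: iw|move=> x].
by rewrite ler_wpM2r ?(ltW (w0 x))//; exact: indic_sub.
Qed.

Definition bad_const := A * 9 ^+ n * K * 2 `^ a * @count_const R n 5 a.

(** Fix a selected cell. A_1 on the cube of radius 9 [len r.1] about it turns w(star) times the mass
    of [F] into a weighted mass, cancelling the denominator of [ker]. What remains, (q.2 / len)^a,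
    is summed over the coarser boxes by [lattice_sum_le]. *)
Lemma bad_part_le :
  \sum_(r <- s | far_from_big r) wcube w (ctr r) (4 * len r.1) * bad_bound r <=
  bad_const * \int[lam]_x (F x * w x).
Proof.
have C0 : 0 <= bad_const.
  rewrite /bad_const; apply: mulr_ge0; last by rewrite ltW// count_const_gt0.
  by rewrite !mulr_ge0 ?exprn_ge0 ?powR_ge0 ?(ltW A0) ?(ltW K0).
apply: le_trans (ler_wpM2l C0 (cells_mass_le big iFw Fw0)).
rewrite [leRHS]big_distrr /=.
under eq_bigr => r _ do rewrite /bad_bound big_distrr big_mkcondr /=.
rewrite exchange_big /=; apply: ler_sum => i bi.
pose P r := far_from_big r && near r i.
set Fw := mass (fun x => F x * w x) (q i).
have Fw_ge0 : 0 <= Fw by exact: mass_ge0.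
have := @lattice_sum_le R n s P 5 a (q i).2 (q i).1 us _ a0 (q0 i).
move=> /(_ ltac:(lra)) h.
pose C := A * 9 ^+ n * K * 2 `^ a.
have C'0 : 0 <= C * Fw.
  by rewrite /C !mulr_ge0 ?exprn_ge0 ?powR_ge0 ?(ltW A0) ?(ltW K0).
rewrite /bad_const -/C -mulrA [_ * Fw]mulrC mulrA.
apply: le_trans (ler_wpM2l C'0 (h _)); last first.
  move=> r _ /andP[fr nr]; have [h1 h2 _] := far_near_geometry bi fr nr.
  by rewrite max_l// ltW.
rewrite big_distrr /= -big_mkcondr /=; apply: ler_sum => r /andP[fr nr].
have [h1 h2 h3] := far_near_geometry bi fr nr.
have l90 : 0 < 9 * len r.1 :> R by rewrite mulr_gt0.
have sub : qi i `<=` cube (q i).1 (9 * len r.1).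
  by apply: sub_cube_radius; have := q0 i; lra.
have k1 : wcube w (ctr r) (4 * len r.1) * mass F (q i) <= A * (9 * len r.1) ^+ n * Fw.
  apply: le_trans (wcube_mass_le l90 sub); rewrite ler_wpM2r//.
    by apply: mass_ge0 => x; exact: l2_ge0.
  exact: wcube_mono.
rewrite mulrCA; apply: (le_trans (ler_wpM2l (ker_ge0 r i) k1)).
rewrite /ker /scale_ratio max_l ?min_r ?(ltW h1)// divff ?gt_eqF// expr1n mul1r.
have -> : (2 * (q i).2 / len r.1) `^ a = 2 `^ a * ((q i).2 / len r.1) `^ a.
  by rewrite -mulrA powRM// divr_ge0// ltW.
rewrite exprMn /C le_eqVlt; apply/orP; left; apply/eqP; field.
by rewrite expf_neq0 ?gt_eqF.
Qed.

Lemma pairing_split r j : pair (f j) (psi r j) =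
  pair (good_part j) (psi r j) + bad r j + err r j.
Proof.
have ip : L1 (psi r j) by exact: adapted_L1 a0 K0 (l0 r) (psiP r j).
have ifp : L1 (fun x => f j x * psi r j x).
  rewrite (_ : (fun _ => _) = fun x => psi r j x * f j x).
    exact: (adapted_mul_L1 a0 K0 (l0 r) (psiP r j) (fi j)).
  by apply/funext => x; rewrite mulrC.
have -> : pair (f j) (psi r j) = \sum_i mass (fun x => f j x * psi r j x) (q i).
  rewrite -Isum; last by move=> i; exact: mass_L1.
  apply: eq_I => x; rewrite -big_distrl /= -qsum.
  have [cx|cx] := pselect (cube c0 rho x); first by rewrite indic_in// mul1r.
  by rewrite fsupp// mul0r mulr0.
have -> : pair (good_part j) (psi r j) = \sum_i avg (f j) (q i) * mass (psi r j) (q i).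
  have -> : pair (good_part j) (psi r j) = \int[lam]_x
     (\sum_i avg (f j) (q i) * (\1_(qi i) x * psi r j x)).
    apply: eq_I => x; rewrite /good_part big_distrl /=; apply: eq_bigr => i _.
    by rewrite mulrA.
  rewrite Isum; last by move=> i; apply/L1Z/mass_L1.
  by apply: eq_bigr => i _; rewrite IZ//; exact: mass_L1.
rewrite -addrA.
have -> : bad r j + err r j = \sum_i osc (f j) (psi r j) (q i).
  by rewrite [RHS](bigID big).
rewrite -big_split /=; apply: eq_bigr => i _.
exact: (mass_split a0 K0 (l0 r) (psiP r j) (fi j)).
Qed.

Definition square_sum x :=
  \sum_(r <- s) \1_(star r) x * \sum_(j < J) pair (f j) (psi r j) ^+ 2.

Lemma sum_sqr_le (I : Type) (t : seq I) (b : I -> R) : (forall i, 0 <= b i) ->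
  \sum_(i <- t) b i ^+ 2 <= (\sum_(i <- t) b i) ^+ 2.
Proof.
move=> b0; elim: t => [|i t IH]; first by rewrite !big_nil expr0n.
rewrite !big_cons sqrrD -addrA lerD2l (le_trans IH)// lerDr mulrn_wge0//.
by rewrite mulr_ge0//; apply: sumr_ge0.
Qed.

Hypothesis err_small : \sum_(r <- s) \sum_(j < J) err r j ^+ 2 <= sigma ^+ 2 / 9.

(** The square sum is at most three times the sum of a good, a bad and an error part, the last at
    most sigma^2 / 9. Above level sigma^2 and off the enlarged cells, the good or the bad part is
    thus at least sigma^2 / 9. Chebyshev is applied to the square for the good part and to the first
    power for the bad one. *)
Lemma level_le x : \1_[set y | sigma ^+ 2 < square_sum y] x <=
  \sum_(i | big i) \1_(cube (q i).1 (9 * (q i).2)) x +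
  (9 / sigma ^+ 2 * \sum_(r <- s) \1_(star r) x *
     (\sum_(j < J) pair (good_part j) (psi r j) ^+ 2) +
   3 / sigma * \sum_(r <- s | far_from_big r) \1_(star r) x * bad_bound r) :> R.
Proof.
set X1 := \sum_(i | big i) _; set TG := \sum_(r <- s) _; set VV := \sum_(r <- s | _) _.
have X10 : 0 <= X1 by apply: sumr_ge0 => i _; exact: indic_ge0.
have TG0 : 0 <= TG.
  apply: sumr_ge0 => r _; rewrite mulr_ge0 ?indic_ge0//.
  by apply: sumr_ge0 => j _; exact: sqr_ge0.
have VV0 : 0 <= VV.
  by apply: sumr_ge0 => r _; rewrite mulr_ge0 ?indic_ge0 ?bad_bound_ge0.
have s20 : 0 < sigma ^+ 2 by rewrite exprn_gt0.
have G0 : 0 <= 9 / sigma ^+ 2 * TG by rewrite mulr_ge0// divr_ge0// ltW.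
have V0 : 0 <= 3 / sigma * VV by rewrite mulr_ge0// divr_ge0// ltW.
have [|hS] := pselect ([set y | sigma ^+ 2 < square_sum y] x); last first.
  by rewrite indic_notin// !addr_ge0.
move=> /= hS; rewrite indic_in//.
have [[i [bi xi]]|out] := pselect (exists i, big i /\ cube (q i).1 (9 * (q i).2) x).
  rewrite ler_wpDr ?addr_ge0// /X1 (bigD1 i)//= indic_in// lerDl.
  by apply: sumr_ge0 => k _; exact: indic_ge0.
(* The l^2 sum over boxes is enlarged to an l^1 sum, affordable because [ker] decays; it yields the
   first power that an L^1(w) bound can control. *)
have TV : \sum_(r <- s) \1_(star r) x * (\sum_(j < J) bad r j ^+ 2) <= VV ^+ 2.
  rewrite /VV [X in _ <= X ^+ 2]big_mkcond /=.
  apply: le_trans (sum_sqr_le _ _); last first.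
    move=> r; case: ifP => // _.
    by rewrite mulr_ge0 ?indic_ge0 ?bad_bound_ge0.
  apply: ler_sum => r _.
  have [rx|rx] := pselect (star r x); last first.
    rewrite indic_notin// mul0r; exact: sqr_ge0.
  have -> : far_from_big r.
    apply/asboolP => i bi sub; apply: out; exists i; split => //.
    exact: sub.
  by rewrite indic_in// !mul1r; exact: bad_sqr_sum.
have TE : \sum_(r <- s) \1_(star r) x * (\sum_(j < J) err r j ^+ 2) <= sigma ^+ 2 / 9.
  apply: le_trans err_small; apply: ler_sum => r _; rewrite ler_piMl ?indic_le//.
  by apply: sumr_ge0 => j _; exact: sqr_ge0.
have : square_sum x <= 3 * (TG + \sum_(r <- s) \1_(star r) x * (\sum_(j < J) bad r j ^+ 2)
    + \sum_(r <- s) \1_(star r) x * (\sum_(j < J) err r j ^+ 2)).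
  rewrite /TG -!big_split /= big_distrr /=; apply: ler_sum => r _.
  rewrite -!mulrDr mulrCA ler_wpM2l ?indic_ge0//.
  rewrite -!big_split /= big_distrr /=; apply: ler_sum => j _.
  rewrite pairing_split; set u := pair _ _; set v := bad r j; set t := err r j.
  have := sqr_ge0 (u - v); have := sqr_ge0 (u - t); have := sqr_ge0 (v - t); nra.
move=> hT.
have hh : sigma ^+ 2 * (2 / 9) < TG + VV ^+ 2 by lra.
have [hG|hG] := leP (sigma ^+ 2 / 9) TG.
  have : 1 <= 9 / sigma ^+ 2 * TG.
    by rewrite mulrAC ler_pdivlMr// mul1r; lra.
  lra.
have hV : sigma ^+ 2 / 9 <= VV ^+ 2 by lra.
have : sigma / 3 <= VV.
  rewrite -(ler_pXn2r (n := 2))// ?nnegrE ?divr_ge0 ?(ltW sigma0)//.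
  rewrite expr_div_n (_ : 3 ^+ 2 = 9 :> R)//; ring.
have : 3 / sigma * (sigma / 3) = 1 by field; rewrite gt_eqF.
have s30 : 0 <= 3 / sigma by rewrite divr_ge0// ltW.
move=> e1 /(ler_wpM2l s30); rewrite e1; lra.
Qed.

Lemma square_sum_measurable : measurable_fun [set: lebesgue_type n] square_sum.
Proof.
apply: measurable_sum => r; apply: (measurable_funM _ (measurable_cst _)).
exact/measurable_indicT/measurable_cube.
Qed.

Definition weak_const := A * (9 / 2) ^+ n + 9 * (@L2w_const R n A a K * A) +
  3 * bad_const.

Lemma weak_type_cells_le :
  L1 (fun x => \1_[set y | sigma ^+ 2 < square_sum y] x * w x) /\
  \int[lam]_x (\1_[set y | sigma ^+ 2 < square_sum y] x * w x) <=
  weak_const / sigma * \int[lam]_x (F x * w x).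
Proof.
set S := [set y | _].
have mS : measurable (S : set (lebesgue_type n)).
  rewrite (_ : S = square_sum @^-1` `]sigma ^+ 2, +oo[%classic); last first.
    by apply/seteqP; split => x /=; rewrite in_itv/= andbT.
  by rewrite -[X in measurable X]setTI; exact: square_sum_measurable.
have mw : measurable_fun [set: lebesgue_type n] w by case: wP.
pose gg r := \sum_(j < J) pair (good_part j) (psi r j) ^+ 2.
pose H x := \sum_(i | big i) \1_(cube (q i).1 (9 * (q i).2)) x * w x +
  (9 / sigma ^+ 2 * \sum_(r <- s) gg r * (\1_(star r) x * w x) +
   3 / sigma * \sum_(r <- s | far_from_big r) bad_bound r * (\1_(star r) x * w x)).
have iwq i : L1 (fun x => \1_(cube (q i).1 (9 * (q i).2)) x * w x).
  by apply: iw; rewrite mulr_gt0.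
have iH1 : L1 (fun x => \sum_(i | big i) \1_(cube (q i).1 (9 * (q i).2)) x * w x).
  exact: L1_sum.
have iH2 : L1 (fun x => \sum_(r <- s) gg r * (\1_(star r) x * w x)).
  by apply: L1_sum => r; apply/L1Z/iw.
have iH3 : L1 (fun x => \sum_(r <- s | far_from_big r) bad_bound r * (\1_(star r) x * w x)).
  by apply: L1_sum => r; apply/L1Z/iw.
have iH : L1 H by apply: L1D => //; apply: L1D; exact: L1Z.
have SH x : \1_S x * w x <= H x.
  have := ler_wpM2r (ltW (w0 x)) (level_le x); rewrite -/S.
  move=> /le_trans; apply; rewrite le_eqVlt; apply/orP; left; apply/eqP.
  have E2 : \sum_(r <- s) gg r * (\1_(star r) x * w x) =
      (\sum_(r <- s) \1_(star r) x * gg r) * w x.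
    by rewrite big_distrl /=; apply: eq_bigr => r _; ring.
  have E3 : \sum_(r <- s | far_from_big r) bad_bound r * (\1_(star r) x * w x) =
      (\sum_(r <- s | far_from_big r) \1_(star r) x * bad_bound r) * w x.
    by rewrite big_distrl /=; apply: eq_bigr => r _; ring.
  by rewrite /H E2 E3 -big_distrl /= -/(gg _); ring.
have iS : L1 (fun x => \1_S x * w x).
  apply: (L1_le _ iH).
    by apply: (measurable_funM _ mw); exact: measurable_indicT.
  by move=> x; rewrite ger0_norm ?SH// mulr_ge0 ?indic_ge0 ?(ltW (w0 x)).
split => //.
apply: (le_trans (I_le iS iH SH)).
rewrite /H ID//; last by apply: L1D; exact: L1Z.
rewrite ID; [|exact: L1Z|exact: L1Z].
rewrite !IZ// !Isum//; try by move=> r; exact/L1Z/iw.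
rewrite /weak_const.
rewrite (_ : (A * (9 / 2) ^+ n + 9 * (@L2w_const R n A a K * A) + 3 * bad_const) / sigma *
    \int[lam]_x (F x * w x) =
  A * (9 / 2) ^+ n / sigma * \int[lam]_x (F x * w x) +
  (9 / sigma ^+ 2 * (@L2w_const R n A a K * (A * sigma) * \int[lam]_x (F x * w x)) +
  3 / sigma * (bad_const * \int[lam]_x (F x * w x)))); last first.
  by field; rewrite gt_eqF.
apply: lerD; first exact: big_cells_le.
apply: lerD.
  rewrite ler_wpM2l ?divr_ge0 ?exprn_ge0 ?(ltW sigma0)//.
  apply: le_trans good_part_le; rewrite exchange_big /=.
  apply: ler_sum => r _; rewrite IZ; last exact: iw.
  by rewrite mulrC -big_distrr.
rewrite ler_wpM2l ?divr_ge0 ?(ltW sigma0)//.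
apply: le_trans bad_part_le; apply: ler_sum => r _.
by rewrite IZ; [rewrite mulrC|exact: iw].
Qed.

End weak_type_cells.

(** * Choice of the starting cube and of the depth *)

Section weak_type.
Context {R : realType} {n : nat}.
Local Notation Rn := 'rV[R]_n.
Local Notation lam := (@lebesgue_rV R n).
Local Notation L1 f := (lam.-integrable setT (EFin \o f)).
Variables (A : R) (w : Rn -> R).
Hypothesis n0 : (0 < n)%N.
Hypothesis A0 : 0 < A.
Hypothesis wP : A1_cube A w.
Variables (a K : R) (a0 : 0 < a) (K0 : 0 < K).
Variables (s : seq (@idx n)) (psi : @idx n -> nat -> Rn -> R).
Hypothesis us : uniq s.
Hypothesis psiP : forall r j, adapted a K (ctr r) (len r.1) (psi r j).
Variables (J : nat) (f : nat -> Rn -> R).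
Hypothesis fi : forall j, L1 (f j).
Local Notation F := (l2 J f).
Hypothesis iFw : L1 (fun x => F x * w x).
Variables (sigma : R) (sigma0 : 0 < sigma).
Variables (c0 : Rn) (r0 : R) (r00 : 0 < r0).
Hypothesis fsupp : forall j x, ~ cube c0 r0 x -> f j x = 0.

Lemma geometric_small (y D e : R) : 0 <= y -> y < 1 -> 0 < e ->
  exists N, D * y ^+ N <= e.
Proof.
move=> y0 y1 e0.
have cv : D * y ^+ N @[N --> \oo] --> D * 0.
  by apply: cvgM; [exact: cvg_cst|apply: cvg_expr; rewrite ger0_norm].
rewrite mulr0 in cv; have /cvgrPdist_le /(_ e e0) [N _ /(_ N (leqnn N))] := cv.
rewrite sub0r normrN => /= h; exists N.
exact: le_trans (ler_norm _) h.
Qed.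

Lemma weak_type :
  L1 (fun x => \1_[set y | sigma ^+ 2 < square_sum s psi J f y] x * w x) /\
  \int[lam]_x (\1_[set y | sigma ^+ 2 < square_sum s psi J f y] x * w x) <=
  @weak_const R n A a K / sigma * \int[lam]_x (F x * w x).
Proof.
have iF : L1 F by exact: l2_L1.
have F0 x : 0 <= F x by exact: l2_ge0.
pose IF := \int[lam]_x F x.
have IF0 : 0 <= IF by exact: I_ge0.
have [t t0 tE] : exists2 t : R, 0 <= t & IF = sigma * t.
  exists (IF / sigma); first by rewrite divr_ge0// ltW.
  by rewrite mulrCA divff ?mulr1// gt_eqF.
(* Large enough for the starting average of [F] to be at most sigma: the integral is sigma t <=
   sigma (2 rho) <= sigma (2 rho)^n, as 2 rho >= 1 and n > 0. *)
pose rho := r0 + t + 1.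
have r00' := r00; have rho0 : 0 < rho by rewrite /rho; lra.
have massQ : mass F (c0, rho) <= sigma * (2 * rho) ^+ n.
  apply: (@le_trans _ _ IF).
    apply: I_le => //; first exact: mass_L1.
    by move=> x; rewrite ler_piMl// indic_le.
  apply: (@le_trans _ _ (sigma * (2 * rho))).
    rewrite tE ler_pM2l// /rho; lra.
  rewrite ler_pM2l// -[leLHS]expr1 ler_weXn2l// /rho; lra.
have fsupp' j x : ~ cube c0 rho x -> f j x = 0.
  move=> cx; apply: fsupp => c0x; apply: cx.
  by apply: sub_cube_radius c0x; rewrite /rho; lra.
pose D := \sum_(r <- s) \sum_(j < J) (K / len r.1 ^+ n * (2 * rho / len r.1) `^ a *
     \int[lam]_x `|f j x|) ^+ 2.
(* Each subdivision halves the unselected cells, so the bound on the squared error gains a factor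
   2^(-2a); [D] does not depend on the depth. *)
pose y : R := ((2^-1) `^ a) ^+ 2.
have y1 : y < 1.
  rewrite /y expr_lt1// ?powR_ge0//.
  have one : 1 = 1 `^ a :> R by rewrite powR1.
  rewrite [ltRHS]one.
  apply: gt0_ltr_powR => //; rewrite ?nnegrE//.
  lra.
have e0 : 0 < sigma ^+ 2 / 9 by rewrite divr_gt0// exprn_gt0.
have [N DN] := geometric_small D (sqr_ge0 _) y1 e0.
have [P [Psum PP]] := CZ iF F0 sigma0 N rho0 massQ.
pose q := tnth (in_tuple P).
have qP i : q i \in P by exact: mem_tnth.
have q0 i : 0 < (q i).2 by have [] := PP _ (qP i).
have qsum x : \1_(cube c0 rho) x = \sum_i \1_(cube (q i).1 (q i).2) x :> R.
  by rewrite Psum big_tnth.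
have qmass i : mass F (q i) <= 2 ^+ n * sigma * (2 * (q i).2) ^+ n.
  by have [] := PP _ (qP i).
have qd i : ~~ big J f sigma q i -> (q i).2 = rho / 2 ^+ N.
  by have [_ _ []] := PP _ (qP i) => // h; rewrite /big h.
apply: (@weak_type_cells_le R n A w A0 wP a K a0 K0 s psi us psiP J f fi iFw
  sigma sigma0 c0 rho rho0 fsupp' _ q q0 qsum qmass).
apply: le_trans DN; rewrite /D big_distrl /=; apply: ler_sum => r _.
rewrite big_distrl /=; apply: ler_sum => j _.
have lr : 0 < len r.1 :> R by exact: len_gt0.
have := err_le a0 K0 psiP fi q0 qsum r j qd.
set I1 := \int[lam]_x _ => h.
have I10 : 0 <= I1 by exact: I_ge0.
rewrite -real_normK ?num_real// /y -exprM mulnC exprM -exprMn.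
apply: lerXn2r; rewrite ?nnegrE//.
  by rewrite mulr_ge0 ?exprn_ge0 ?powR_ge0// !mulr_ge0 ?powR_ge0 ?invr_ge0 ?exprn_ge0// ltW.
apply: (le_trans h).
have -> : (2 * (rho / 2 ^+ N) / len r.1) `^ a =
    (2 * rho / len r.1) `^ a * ((2^-1) `^ a) ^+ N.
  have -> : 2 * (rho / 2 ^+ N) / len r.1 = 2 * rho / len r.1 * (2^-1) ^+ N.
    by rewrite exprVn; field; rewrite ?expf_neq0 ?gt_eqF ?exprn_gt0.
  rewrite powRM; last 2 first.
  - by rewrite divr_ge0 ?mulr_ge0// ltW.
  - by rewrite exprn_ge0.
  by congr (_ * _); apply: powR_expr; rewrite invr_ge0.
by rewrite le_eqVlt; apply/orP; left; apply/eqP; ring.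
Qed.

End weak_type.

(** * Morrey norms *)

Section doubling.
Context {R : realType} {n : nat}.
Local Notation Rn := 'rV[R]_n.
Local Notation lam := (@lebesgue_rV R n).
Local Notation L1 f := (lam.-integrable setT (EFin \o f)).
Variables (A : R) (w : Rn -> R).
Hypothesis n0 : (0 < n)%N.
Hypothesis A0 : 0 < A.
Hypothesis wP : A1_cube A w.

Lemma wcube_sub_le c c' (r r' : R) : 0 < r -> 0 < r' ->
  cube c' r' `<=` cube c r ->
  wcube w c r * (2 * r') ^+ n <= A * r ^+ n * wcube w c' r'.
Proof.
move=> r0 r'0 sub.
have iw : L1 (fun x => \1_(cube c' r') x * w x) by case: wP => _ _ + _; apply.
have ic : L1 (\1_(cube c' r') : Rn -> R) by exact: L1_cube.
have := @wcube_le_int R n A w A0 wP c c' r r' (fun=> 1) r0 r'0 sub.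
have -> : (fun x => \1_(cube c' r') x * 1) = (\1_(cube c' r') : Rn -> R).
  by apply/funext => x; rewrite mulr1.
have -> : (fun x => \1_(cube c' r') x * (1 * w x)) = (fun x => \1_(cube c' r') x * w x).
  by apply/funext => x; rewrite mul1r.
by move=> /(_ (fun=> ler01) ic iw); rewrite I_cube.
Qed.

(** The maximum with 1/2 keeps the constant positive, so that its logarithm defines an exponent. *)
Definition rev_const : R := Num.max (2^-1) (1 - (A * 2 ^+ n)^-1).

Lemma rev_const_bounds : 0 < rev_const < 1.
Proof.
rewrite /rev_const lt_max gt_max; apply/andP; split.
  by apply/orP; left; rewrite invr_gt0.
apply/andP; split; first by lra.
by rewrite ltrBlDr ltrDl invr_gt0 mulr_gt0 ?exprn_gt0.
Qed.

(* The translate of the cube by 2 r along an axis is disjoint from it and lies in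
   the cube of radius 4 r, of which it carries a fixed share by A_1. *)
Lemma reverse_doubling c (r : R) : 0 < r ->
  wcube w c r <= rev_const * wcube w c (4 * r).
Proof.
move=> r0; pose i0 := Ordinal n0.
pose c' : Rn := \row_i (c ord0 i + (i == i0)%:R * (2 * r)).
have iw c1 (r1 : R) : 0 < r1 -> L1 (fun x => \1_(cube c1 r1) x * w x).
  by case: wP => _ _ + _; apply.
have r40 : 0 < 4 * r by rewrite mulr_gt0.
have sub' : cube c' r `<=` cube c (4 * r).
  apply: sub_cube => i; rewrite mxE addrAC subrr add0r.
  by case: (i == i0); rewrite /= ?mul1r ?mul0r ?normr0 ?ger0_norm; lra.
have sub : cube c r `<=` cube c (4 * r) by apply: sub_cube_radius; lra.
have disj x : cube c r x -> ~ cube c' r x.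
  move=> /(_ i0) /andP[_ h1] /(_ i0) /andP[h2 _].
  by move: h2; rewrite mxE eqxx mul1r; lra.
have sumW : wcube w c r + wcube w c' r <= wcube w c (4 * r).
  rewrite -ID; [|exact: iw|exact: iw].
  apply: I_le; [by apply: L1D; exact: iw|exact: iw|move=> x].
  have w0 : 0 <= w x by case: wP => /(_ x)/ltW.
  rewrite -mulrDl ler_wpM2r//.
  have [cx|cx] := pselect (cube c r x).
    by rewrite indic_in// indic_notin ?addr0 ?indic_in//; [exact: sub|exact: disj].
  by rewrite [\1_(cube c r) x]indic_notin// add0r; exact: indic_sub.
have := wcube_sub_le r40 r0 sub'.
have rn : 0 < r ^+ n by rewrite exprn_gt0.
rewrite (_ : A * (4 * r) ^+ n * wcube w c' r =
  (A * 2 ^+ n * wcube w c' r) * (2 * r) ^+ n); last first.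
  by rewrite !exprMn (_ : 4 = 2 * 2) ?exprMn; ring.
rewrite ler_pM2r ?exprn_gt0 ?mulr_gt0// => h.
have A2 : 0 < A * 2 ^+ n by rewrite mulr_gt0 ?exprn_gt0.
have h' : (A * 2 ^+ n)^-1 * wcube w c (4 * r) <= wcube w c' r.
  by rewrite ler_pdivrMl.
apply: (@le_trans _ _ ((1 - (A * 2 ^+ n)^-1) * wcube w c (4 * r))).
  by rewrite mulrBl mul1r; lra.
rewrite ler_wpM2r ?(ltW (wcube_gt0 wP _ _))// /rev_const.
by rewrite le_max lexx orbT.
Qed.

(** Chosen so that [rev_const] is 4 to the power -[rev_exp]. *)
Definition rev_exp : R := - ln rev_const / ln 4.

Lemma ln4_gt0 : 0 < ln (4 : R).
Proof. by rewrite ln_gt0// ltr1n. Qed.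

Lemma rev_exp_gt0 : 0 < rev_exp.
Proof.
have /andP[g0 g1] := rev_const_bounds.
rewrite /rev_exp divr_gt0 ?ln4_gt0// oppr_gt0.
by rewrite ln_lt0// g0.
Qed.

Lemma wcube_mono_radius c (r r' : R) : 0 < r -> r <= r' -> wcube w c r <= wcube w c r'.
Proof.
move=> r0 rr'; have iw c1 (r1 : R) : 0 < r1 -> L1 (fun x => \1_(cube c1 r1) x * w x).
  by case: wP => _ _ + _; apply.
apply: I_le; [exact: iw|apply: iw; exact: lt_le_trans rr'|move=> x].
have w0 : 0 <= w x by case: wP => /(_ x)/ltW.
by rewrite ler_wpM2r//; apply: indic_sub; exact: sub_cube_radius.
Qed.

(** Reverse doubling is iterated up to the largest k with 4^k r <= l; the rounding of k costs one
    factor [rev_const^-1]. *)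
Lemma reverse_doubling_power c (r l : R) : 0 < r -> r <= l ->
  wcube w c r <= rev_const^-1 * (r / l) `^ rev_exp * wcube w c l.
Proof.
move=> r0 rl; have l0 : 0 < l by exact: lt_le_trans rl.
have /andP[g0 g1] := rev_const_bounds.
have iter k : wcube w c r <= rev_const ^+ k * wcube w c (4 ^+ k * r).
  elim: k => [|k IH]; first by rewrite !expr0 !mul1r.
  apply: (le_trans IH); rewrite exprSr -mulrA ler_wpM2l ?exprn_ge0 ?(ltW g0)//.
  by rewrite exprS -mulrA; apply: reverse_doubling; rewrite mulr_gt0 ?exprn_gt0.
have ex : exists k, l < 4 ^+ k.+1 * r.
  exists (Num.truncn (l / r)); rewrite -ltr_pdivrMr//.
  apply: lt_le_trans (truncnS_gt _) _.
  by rewrite -natrX ler_nat ltnW// ltn_expl.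
case: (ex_minnP ex) => k hk kmin.
have kl : 4 ^+ k * r <= l.
  case: k hk kmin => [_ _|k _ kmin]; first by rewrite expr0 mul1r.
  by rewrite leNgt; apply/negP => /kmin; rewrite ltnn.
apply: (le_trans (iter k)).
apply: ler_pM.
- by rewrite exprn_ge0// ltW.
- by rewrite ltW// (wcube_gt0 wP)// mulr_gt0 ?exprn_gt0.
- have gE : rev_const = 4^-1 `^ rev_exp.
    rewrite /rev_exp /powR ifF ?invr_eq0 ?pnatr_eq0// lnV ?posrE//.
    rewrite (_ : _ * - ln 4 = ln rev_const) ?lnK//.
    by field; rewrite gt_eqF// ln4_gt0.
  rewrite -ler_pdivrMl ?invr_gt0// invrK -exprS {1}gE.
  have -> : (4^-1 `^ rev_exp) ^+ k.+1 = ((4^-1) ^+ k.+1) `^ rev_exp.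
    by rewrite powR_expr// invr_ge0.
  apply: ge0_ler_powR; rewrite ?nnegrE ?(ltW rev_exp_gt0) ?exprn_ge0//.
    by rewrite divr_ge0 ?ltW.
  rewrite exprVn -[r / l]invf_div lef_pV2 ?posrE ?exprn_gt0 ?divr_gt0//.
  by rewrite ler_pdivrMr// ltW.
- by apply: wcube_mono_radius kl; rewrite mulr_gt0 ?exprn_gt0.
Qed.

(** Strictness matters because the growth condition compares [theta] at distinct arguments only. *)
Lemma wcube_lt c (r r' : R) : 0 < r -> 4 * r <= r' -> wcube w c r < wcube w c r'.
Proof.
move=> r0 rr'; have /andP[g0 g1] := rev_const_bounds.
have r40 : 0 < 4 * r by rewrite mulr_gt0.
apply: (le_lt_trans (reverse_doubling c r0)).
apply: lt_le_trans (wcube_mono_radius c r40 rr').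
by rewrite gtr_pMl// (wcube_gt0 wP).
Qed.

End doubling.

(** * The Morrey estimate on one cube for finite sums *)

Section morrey_cubes.
Context {R : realType} {n : nat}.
Local Notation Rn := 'rV[R]_n.
Local Notation lam := (@lebesgue_rV R n).
Local Notation L1 f := (lam.-integrable setT (EFin \o f)).
Variables (A : R) (w : Rn -> R).
Hypothesis n0 : (0 < n)%N.
Hypothesis A0 : 0 < A.
Hypothesis wP : A1_cube A w.
Variables (kappa Ct : R) (theta : R -> R).
Hypotheses (kappa1 : kappa < 1) (Ct0 : 0 < Ct).
Hypothesis theta0 : forall xi : R, 0 < xi -> 0 < theta xi.
Hypothesis thetaD : forall xi' xi : R, 0 < xi' -> xi' < xi ->
    theta xi / xi `^ kappa <= Ct * (theta xi' / xi' `^ kappa).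

Local Notation gam := (@rev_const R n A).

Lemma theta_le (xi' xi : R) : 0 < xi' -> xi' < xi ->
  theta xi <= Ct * (xi / xi') `^ kappa * theta xi'.
Proof.
move=> h0 h; have xi0 : 0 < xi by exact: lt_trans h.
have := thetaD h0 h; rewrite ler_pdivrMr ?powR_gt0// => /le_trans; apply.
have e : (xi'^-1) `^ kappa = (xi' `^ kappa)^-1.
  by rewrite -[xi'^-1]powR_inv1 ?ltW// -powRrM mulN1r powRN.
rewrite powRM ?invr_ge0 ?(ltW xi0) ?(ltW h0)// e.
by rewrite le_eqVlt; apply/orP; left; apply/eqP; ring.
Qed.

(** The ratio of the two weights is at least 1, so its power kappa < 1 is at most the ratio itself,
    which A_1 bounds. The condition 4 <= L gives the strict inequality of [wcube_lt]. *)
Lemma theta_doubling c (r L : R) : 0 < r -> 4 <= L ->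
  theta (wcube w c (L * r)) <= Ct * (A * (L / 2) ^+ n) * theta (wcube w c r).
Proof.
move=> r0 L4; have L0 : 0 < L by lra.
have Lr : 0 < L * r by rewrite mulr_gt0.
have W0 := wcube_gt0 wP c r0.
have lt1 : wcube w c r < wcube w c (L * r).
  by apply: (wcube_lt n0 A0 wP) => //; rewrite ler_pM2r.
apply: (le_trans (theta_le W0 lt1)).
rewrite ler_wpM2r ?(ltW (theta0 W0))// ler_wpM2l ?(ltW Ct0)//.
apply: (@le_trans _ _ (wcube w c (L * r) / wcube w c r)).
  by apply: ler1_powR; rewrite ?(ltW kappa1)// ler_pdivlMr// mul1r ltW.
rewrite ler_pdivrMr//.
have sub : cube c r `<=` cube c (L * r).
  by apply: sub_cube_radius; rewrite ler_peMl ?(ltW r0)//; lra.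
have := wcube_sub_le A0 wP Lr r0 sub.
rewrite (_ : A * (L * r) ^+ n * _ = A * (L / 2) ^+ n * wcube w c r * (2 * r) ^+ n).
  by rewrite ler_pM2r// exprn_gt0// mulr_gt0.
rewrite expr_div_n !exprMn; field.
by rewrite expf_neq0.
Qed.

Variables (a K : R) (a0 : 0 < a) (K0 : 0 < K).
Variables (s : seq (@idx n)) (psi : @idx n -> nat -> Rn -> R).
Hypothesis us : uniq s.
Hypothesis psiP : forall r j, adapted a K (ctr r) (len r.1) (psi r j).
Variables (J : nat) (f : nat -> Rn -> R).
Hypothesis fl : forall j c (r : R), 0 < r -> L1 (fun x => \1_(cube c r) x * f j x).
Local Notation F := (l2 J f).
Hypothesis iFw : forall c (r : R), 0 < r ->
  L1 (fun x => \1_(cube c r) x * (F x * w x)).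
Variables (M : R) (M0 : 0 <= M).
Hypothesis hM : forall c (r : R), 0 < r ->
  \int[lam]_x (\1_(cube c r) x * (F x * w x)) <= M * theta (wcube w c r).

Local Notation star r := (cube (ctr r : Rn) (4 * len r.1)).
Local Notation pair h p := (\int[lam]_x (h x * p x)).

Lemma l2_indic (E : set Rn) x :
  l2 J (fun j x => \1_E x * f j x) x = \1_E x * F x.
Proof.
rewrite /l2; have [Ex|Ex] := pselect (E x).
  by rewrite indic_in// mul1r; congr Num.sqrt; apply: eq_bigr => j _; rewrite mul1r.
rewrite indic_notin// mul0r big1 ?sqrtr0// => j _.
by rewrite mul0r expr0n.
Qed.

Lemma pairing_indic (E : set Rn) r j : measurable (E : set (lebesgue_type n)) ->
  L1 (fun x => \1_E x * f j x * psi r j x).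
Proof.
move=> mE.
have l40 : 0 < 4 * len r.1 :> R by rewrite mulr_gt0// len_gt0.
rewrite (_ : (fun _ => _) =
    fun x => \1_E x * (psi r j x * (\1_(star r) x * f j x))).
  apply: L1_indic => //.
  exact: (adapted_mul_L1 a0 K0 (len_gt0 _) (psiP r j) (fl j _ l40)).
apply/funext => x; have [sx|sx] := pselect (star r x).
  by rewrite [\1_(star r) x]indic_in//; ring.
by case: (psiP r j) => -> // _ _ _; rewrite mul0r !mulr0.
Qed.

Lemma pairing_L1 r j : L1 (fun x => f j x * psi r j x).
Proof.
have := @pairing_indic setT r j measurableT.
by under [X in _.-integrable _ X]funext do rewrite /= indicT mul1r.
Qed.

Section one_cube.
Variables (x0 : Rn) (r0 : R) (r00 : 0 < r0).

(** The radius 9 plays the role it has for selected cells: a star of scale at most r0 that meets the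
    cube stays inside. *)
Let B2 := cube x0 (9 * r0).
Let near_part j x := \1_B2 x * f j x.
Let far_pair r j := pair (f j) (psi r j) - pair (near_part j) (psi r j).

Let far_pairE r j :
  far_pair r j = \int[lam]_x ((1 - \1_B2 x) * (f j x * psi r j x)).
Proof.
rewrite /far_pair -IB; [|exact: pairing_L1|]; last first.
  by apply: pairing_indic; exact: measurable_cube.
by apply: eq_I => x; rewrite /near_part; ring.
Qed.

Lemma far_pair_eq0 r j : star r `<=` B2 -> far_pair r j = 0.
Proof.
move=> sub; rewrite far_pairE -[RHS](@I0 _ _ _ lam); apply: eq_I => x.
have [sx|sx] := pselect (star r x).
  by rewrite indic_in ?subrr ?mul0r//; exact: sub.
by case: (psiP r j) => -> // _ _ _; rewrite !mulr0.
Qed.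

Definition touch r : bool :=
  `[< (exists x, cube x0 r0 x /\ star r x) /\ ~ star r `<=` B2 >].

Lemma touch_geometry r : touch r ->
  [/\ r0 < len r.1, supdist_le (5 * len r.1) x0 (ctr r) &
      star r `<=` cube x0 (9 * len r.1)].
Proof.
move=> /asboolP[[x [qx rx]] nsub].
have d := supdist_le_trans (cube_supdist_le qx) (supdist_le_sym (cube_supdist_le rx)).
have rl : r0 < len r.1.
  rewrite ltNge; apply/negP => h; apply: nsub; apply: sub_cube.
  by apply/supdist_le_sym/(supdist_le_le _ d); lra.
split => //.
  by apply: supdist_le_le d; lra.
by apply: sub_cube; apply/supdist_le_sym/(supdist_le_le _ d); lra.
Qed.

(** Minkowski's inequality with a constant kernel; for the far part the size bound on [psi]
    suffices, without its cancellation. *)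
Lemma far_sqr_sum r : touch r -> \sum_(j < J) far_pair r j ^+ 2 <=
  (K / len r.1 ^+ n * \int[lam]_x (\1_(cube x0 (9 * len r.1)) x * F x)) ^+ 2.
Proof.
move=> /touch_geometry[rl _ sub].
have l0 : 0 < len r.1 :> R by exact: len_gt0.
have l90 : 0 < 9 * len r.1 :> R by rewrite mulr_gt0.
set E := cube x0 (9 * len r.1).
have B0 : 0 <= K / len r.1 ^+ n by rewrite divr_ge0 ?exprn_ge0 ?(ltW K0)// ltW.
have fE j : L1 (fun x => \1_E x * f j x) by exact: fl.
have -> : K / len r.1 ^+ n * \int[lam]_x (\1_E x * F x) =
    \int[lam]_x (K / len r.1 ^+ n * l2 J (fun j x => \1_E x * f j x) x).
  rewrite IZ; last exact: l2_L1.
  by congr (_ * _); apply: eq_I => x; rewrite l2_indic.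
apply: (@l2_Rintegral_le _ _ _ lam J (fun j x => \1_E x * f j x)
  (fun=> K / len r.1 ^+ n) (K / len r.1 ^+ n) (far_pair r) fE).
- exact: measurable_cst.
- by move=> x; rewrite B0 lexx.
move=> j _; rewrite far_pairE; apply: I_abs_le.
- rewrite (_ : (fun _ => _) = fun x => f j x * psi r j x -
    \1_B2 x * f j x * psi r j x).
    apply: L1B; first exact: pairing_L1.
    by apply: pairing_indic; exact: measurable_cube.
  by apply/funext => x; ring.
- by apply: L1Z; exact: L1_norm.
move=> x; have [sx|sx] := pselect (star r x); last first.
  by case: (psiP r j) => -> // _ _ _; rewrite !mulr0 normr0 mulr_ge0.
rewrite [\1_E x]indic_in ?mul1r; last exact: sub.
rewrite !normrM [`|f j x| * _]mulrC mulrA ler_wpM2r//.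
case: (psiP r j) => _ _ /(_ x) pb _.
apply: le_trans pb; rewrite ler_piMl//.
have := indic_ge0 R B2 x; have := indic_le R B2 x => h1 h2.
by rewrite ger0_norm; lra.
Qed.

Definition far_exp := @rev_exp R n A * (1 - kappa).

Lemma far_exp_gt0 : 0 < far_exp.
Proof. by rewrite /far_exp mulr_gt0 ?rev_exp_gt0// subr_gt0. Qed.

Definition far_factor := K * A * 9 ^+ n * Ct * gam^-1 `^ (1 - kappa).

Lemma far_factor_ge0 : 0 <= far_factor.
Proof.
by rewrite /far_factor !mulr_ge0 ?powR_ge0 ?exprn_ge0 ?(ltW K0) ?(ltW A0) ?(ltW Ct0).
Qed.

(** A_1 and the Morrey bound on the cube of radius 9 l give theta(W9) / W9. The growth condition
    compares it with theta(W) / W at the gain (W / W9)^(1 - kappa), and reverse doubling makes this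
    gain a positive power of r0 / l. *)
Lemma far_avg_le (l : R) : r0 < l ->
  K / l ^+ n * \int[lam]_x (\1_(cube x0 (9 * l)) x * F x) <=
  far_factor * M * (theta (wcube w x0 r0) / wcube w x0 r0) * (r0 / l) `^ far_exp.
Proof.
move=> rl; have r00' := r00; have l0 : 0 < l by exact: lt_trans rl.
have l90 : 0 < 9 * l by rewrite mulr_gt0.
set W9 := wcube w x0 (9 * l); set W := wcube w x0 r0.
have W90 : 0 < W9 by exact: (wcube_gt0 wP).
have W0 : 0 < W by exact: (wcube_gt0 wP).
have WW : W < W9 by apply: (wcube_lt n0 A0 wP) => //; lra.
have ln0 : 0 < l ^+ n by rewrite exprn_gt0.
have iF9 : L1 (fun x => \1_(cube x0 (9 * l)) x * F x).
  rewrite (_ : (fun _ => _) = l2 J (fun j x => \1_(cube x0 (9 * l)) x * f j x)).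
    by apply: l2_L1 => j; exact: fl.
  by apply/funext => x; rewrite l2_indic.
set I9 := \int[lam]_x _.
have h1 : W9 * I9 <= A * (9 * l) ^+ n * (M * theta W9).
  apply: (@le_trans _ _ (A * (9 * l) ^+ n *
      \int[lam]_x (\1_(cube x0 (9 * l)) x * (F x * w x)))).
    apply: (wcube_le_int A0 wP) => //; last exact: iFw.
    by move=> x; exact: l2_ge0.
  by rewrite ler_wpM2l ?mulr_ge0 ?exprn_ge0 ?(ltW A0) ?(ltW l90)//; exact: hM.
have h2 := theta_le W0 WW.
have h3 : (W / W9) `^ (1 - kappa) <=
    gam^-1 `^ (1 - kappa) * (r0 / l) `^ far_exp.
  have /andP[g0 g1] := @rev_const_bounds R n A A0.
  rewrite /far_exp powRrM -powRM ?invr_ge0 ?(ltW g0) ?powR_ge0//.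
  apply: ge0_ler_powR; rewrite ?nnegrE ?subr_ge0 ?(ltW kappa1)//.
  + by rewrite divr_ge0 ?ltW.
  + by rewrite mulr_ge0 ?invr_ge0 ?powR_ge0 ?(ltW g0).
  rewrite ler_pdivrMr//.
  apply: (le_trans (reverse_doubling_power n0 A0 wP x0 r00 (ltW rl))).
  rewrite ler_wpM2l ?mulr_ge0 ?invr_ge0 ?powR_ge0 ?(ltW g0)//.
  by apply: (wcube_mono_radius wP) => //; lra.
have h4 : theta W9 / W9 <= Ct * (theta W / W) * (W / W9) `^ (1 - kappa).
  rewrite ler_pdivrMr//; apply: (le_trans h2).
  have -> : (W9 / W) `^ kappa = (W / W9) `^ (1 - kappa) * (W9 / W).
    have z0 : 0 < W / W9 by rewrite divr_gt0.
    rewrite powRD; last by rewrite (gt_eqF z0) implybT.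
    rewrite powRr1 ?(ltW z0)// powRN mulrAC (_ : W / W9 * (W9 / W) = 1).
      rewrite mul1r -[W9 / W]invf_div -[X in X `^ _]powR_inv1 ?(ltW z0)//.
      by rewrite -powRrM mulN1r powRN.
    by field; rewrite !gt_eqF.
  by rewrite le_eqVlt; apply/orP; left; apply/eqP; field; rewrite !gt_eqF.
have h5 : I9 <= A * (9 * l) ^+ n * M * (theta W9 / W9).
  by rewrite mulrA ler_pdivlMr// mulrC (le_trans h1)// !mulrA.
apply: (@le_trans _ _ (K / l ^+ n * (A * (9 * l) ^+ n * M *
    (Ct * (theta W / W) * (gam^-1 `^ (1 - kappa) * (r0 / l) `^ far_exp))))).
  rewrite ler_wpM2l ?divr_ge0 ?(ltW K0) ?(ltW ln0)//; apply: (le_trans h5).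
  rewrite ler_wpM2l ?mulr_ge0 ?exprn_ge0 ?(ltW A0) ?(ltW l90)//.
  apply: (le_trans h4); rewrite ler_wpM2l//.
  by rewrite mulr_ge0 ?(ltW Ct0)// divr_ge0 ?(ltW W0) ?(ltW (theta0 W0)).
rewrite exprMn /far_factor le_eqVlt; apply/orP; left; apply/eqP; field.
by rewrite !gt_eqF.
Qed.

Definition far_const := far_factor * @count_const R n 5 far_exp.

Lemma far_sum_le :
  \sum_(r <- s | touch r) K / len r.1 ^+ n *
    \int[lam]_x (\1_(cube x0 (9 * len r.1)) x * F x) <=
  far_const * M * (theta (wcube w x0 r0) / wcube w x0 r0).
Proof.
have W0 := wcube_gt0 wP x0 r00.
have C0 : 0 <= far_factor * M * (theta (wcube w x0 r0) / wcube w x0 r0).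
  apply: mulr_ge0; last by rewrite divr_ge0 ?(ltW W0) ?(ltW (theta0 W0)).
  by rewrite mulr_ge0// far_factor_ge0.
have := @lattice_sum_le R n s touch 5 far_exp r0 x0 us _ far_exp_gt0 r00.
move=> /(_ ltac:(lra)) h.
rewrite (_ : far_const * M * _ = far_factor * M *
  (theta (wcube w x0 r0) / wcube w x0 r0) * @count_const R n 5 far_exp); last first.
  by rewrite /far_const; ring.
apply: le_trans (ler_wpM2l C0 (h _)); last first.
  by move=> r _ /touch_geometry[h1 h2 _]; rewrite max_l// ltW.
rewrite big_distrr /=; apply: ler_sum => r /touch_geometry[h1 _ _].
apply: (le_trans (far_avg_le h1)).
by rewrite /scale_ratio max_l ?min_r ?(ltW h1)// divff ?expr1n ?mul1r// gt_eqF// len_gt0.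
Qed.

(** The 2 comes from using the level sigma / 2, the last factor from [theta_doubling] with L = 9. *)
Definition near_const := 2 * @weak_const R n A a K * (Ct * (A * (9 / 2) ^+ n)).

Definition morrey_const := near_const + 2 * far_const.

Lemma weak_const_ge0 : 0 <= @weak_const R n A a K.
Proof.
have l2c := ltW (@L2_const_gt0 R n a K a0 K0).
have cc := ltW (@count_const_gt0 R n 5 a ltac:(lra) a0).
have A0' := ltW A0; have K0' := ltW K0.
rewrite /weak_const; apply: addr_ge0; first apply: addr_ge0.
- by rewrite mulr_ge0 ?exprn_ge0.
- apply: mulr_ge0 => //; apply: mulr_ge0 => //.
  rewrite /L2w_const; apply: mulr_ge0; first exact: mulr_ge0.
  by apply: mulr_ge0 => //; exact: exprn_ge0.
- apply: mulr_ge0 => //; rewrite /bad_const; apply: mulr_ge0 => //.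
  apply: mulr_ge0; last exact: powR_ge0.
  by apply: mulr_ge0 => //; apply: mulr_ge0 => //; exact: exprn_ge0.
Qed.

Lemma near_const_ge0 : 0 <= near_const.
Proof.
have w1 := weak_const_ge0.
rewrite /near_const; apply: mulr_ge0; first exact: mulr_ge0.
apply: mulr_ge0; first exact: ltW.
by apply: mulr_ge0; [exact: ltW|exact: exprn_ge0].
Qed.

Lemma far_const_ge0 : 0 <= far_const.
Proof.
have cc := ltW (@count_const_gt0 R n 5 far_exp ltac:(lra) far_exp_gt0).
rewrite /far_const; apply: mulr_ge0 => //.
exact: far_factor_ge0.
Qed.

(** On the cube the far part of the square sum is at most V^2. If sigma <= 2 V, the trivial bound by
    w of the whole cube is good enough. Otherwise V^2 < sigma^2 / 4, so the near part exceeds (sigma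
    / 2)^2 and the weak type bound applies. *)
Lemma morrey_cube_le (sigma : R) : 0 < sigma ->
  sigma * \int[lam]_x (\1_(cube x0 r0 `&`
     [set y | sigma ^+ 2 < square_sum s psi J f y]) x * w x) <=
  morrey_const * M * theta (wcube w x0 r0).
Proof.
move=> sigma0; set S := _ `&` _.
have w0 x : 0 <= w x by case: wP => /(_ x)/ltW.
have iw c (r : R) : 0 < r -> L1 (fun x => \1_(cube c r) x * w x).
  by case: wP => _ _ + _; apply.
have mw : measurable_fun [set: lebesgue_type n] w by case: wP.
have W0 := wcube_gt0 wP x0 r00.
have th0 := theta0 W0.
have r90 : 0 < 9 * r0 by rewrite mulr_gt0.
have mS : measurable (S : set (lebesgue_type n)).
  apply: measurableI; first exact: measurable_cube.
  rewrite (_ : [set _ | _] = square_sum s psi J f @^-1` `]sigma ^+ 2, +oo[%classic).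
    by rewrite -[X in measurable X]setTI; exact: square_sum_measurable.
  by apply/seteqP; split => x /=; rewrite in_itv/= andbT.
have iS : L1 (fun x => \1_S x * w x).
  apply: (L1_le _ (iw x0 r0 r00)).
    by apply: (measurable_funM _ mw); exact: measurable_indicT.
  move=> x; rewrite ger0_norm ?mulr_ge0 ?indic_ge0// ler_wpM2r//.
  by apply: indic_sub => y [].
set V := far_const * M * (theta (wcube w x0 r0) / wcube w x0 r0).
have V0 : 0 <= V.
  rewrite /V; apply: mulr_ge0; last by rewrite divr_ge0 ?ltW.
  by apply: mulr_ge0 => //; exact: far_const_ge0.
have VW : V * wcube w x0 r0 = far_const * M * theta (wcube w x0 r0).
  by rewrite /V; field; rewrite gt_eqF.
have nc0 : 0 <= near_const * M * theta (wcube w x0 r0).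
  apply: mulr_ge0; last exact: ltW.
  by apply: mulr_ge0 => //; exact: near_const_ge0.
have fc0 : 0 <= far_const * M * theta (wcube w x0 r0).
  apply: mulr_ge0; last exact: ltW.
  by apply: mulr_ge0 => //; exact: far_const_ge0.
rewrite (_ : morrey_const * M * _ = near_const * M * theta (wcube w x0 r0) +
  2 * (far_const * M * theta (wcube w x0 r0))); last by rewrite /morrey_const; ring.
have [sV|Vs] := leP sigma (2 * V).
  have SW : \int[lam]_x (\1_S x * w x) <= wcube w x0 r0.
    apply: I_le => //; first exact: iw.
    by move=> x; rewrite ler_wpM2r//; apply: indic_sub => y [].
  have S0 : 0 <= \int[lam]_x (\1_S x * w x).
    by apply: I_ge0 => x; rewrite mulr_ge0 ?indic_ge0.
  have : sigma * \int[lam]_x (\1_S x * w x) <= 2 * V * wcube w x0 r0.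
    by apply: ler_pM => //; exact: ltW.
  rewrite -[2 * V * _]mulrA VW; lra.
have s20 : 0 < sigma / 2 by rewrite divr_gt0.
have fni j : L1 (near_part j) by exact: fl.
have l2n : l2 J near_part = fun x => \1_B2 x * F x.
  by apply/funext => x; exact: l2_indic.
have iFnw : L1 (fun x => l2 J near_part x * w x).
  rewrite l2n (_ : (fun _ => _) = fun x => \1_B2 x * (F x * w x)); first exact: iFw.
  by apply/funext => x; rewrite mulrA.
have supp j x : ~ B2 x -> near_part j x = 0.
  by move=> Bx; rewrite /near_part indic_notin// mul0r.
have [iN leN] := weak_type n0 A0 wP a0 K0 us psiP fni iFnw s20 r90 supp.
have key x : \1_S x <= \1_[set y | (sigma / 2) ^+ 2 < square_sum s psi J near_part y] x :> R.
  apply: indic_sub => {}x [] cx /= hx.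
  have far_le : \sum_(r <- s) \1_(star r) x * (\sum_(j < J) far_pair r j ^+ 2) <= V ^+ 2.
    apply: (@le_trans _ _ (\sum_(r <- s | touch r) (K / len r.1 ^+ n *
       \int[lam]_x (\1_(cube x0 (9 * len r.1)) x * F x)) ^+ 2)).
      rewrite [leRHS]big_mkcond /=; apply: ler_sum => r _.
      have [sx|sx] := pselect (star r x); last first.
        by rewrite indic_notin// mul0r; case: ifP => // _; exact: sqr_ge0.
      rewrite indic_in// mul1r; case: ifPn => [tr|/asboolPn ntr].
        exact: far_sqr_sum.
      have sub : star r `<=` B2.
        by apply: contrapT => nsub; apply: ntr; split => //; exists x.
      by rewrite big1// => j _; rewrite far_pair_eq0// expr0n.
    rewrite -big_filter; apply: (@le_trans _ _ ((\sum_(r <- [seq r <- s | touch r])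
      K / len r.1 ^+ n * \int[lam]_x (\1_(cube x0 (9 * len r.1)) x * F x)) ^+ 2)).
      apply: sum_sqr_le => r; rewrite mulr_ge0 ?divr_ge0 ?exprn_ge0 ?(ltW K0)//.
        exact/ltW/len_gt0.
      by apply: I_ge0 => y; rewrite mulr_ge0 ?indic_ge0 ?l2_ge0.
    rewrite big_filter; apply: lerXn2r; rewrite ?nnegrE//; last exact: far_sum_le.
    apply: sumr_ge0 => r _; rewrite mulr_ge0 ?divr_ge0 ?exprn_ge0 ?(ltW K0)//.
      exact/ltW/len_gt0.
    by apply: I_ge0 => y; rewrite mulr_ge0 ?indic_ge0 ?l2_ge0.
  have sum_le : square_sum s psi J f x <= 2 * (square_sum s psi J near_part x +
      \sum_(r <- s) \1_(star r) x * (\sum_(j < J) far_pair r j ^+ 2)).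
    rewrite /square_sum -big_split /= big_distrr /=; apply: ler_sum => r _.
    rewrite -mulrDr mulrCA ler_wpM2l ?indic_ge0//.
    rewrite -big_split /= big_distrr /=; apply: ler_sum => j _.
    rewrite /far_pair; set u := pair (f j) _; set v := pair (near_part j) _.
    have := sqr_ge0 (u - 2 * v); nra.
  have VV : V ^+ 2 < sigma ^+ 2 / 4.
    rewrite (_ : sigma ^+ 2 / 4 = (sigma / 2) ^+ 2); last by field.
    by rewrite ltr_pXn2r ?nnegrE ?(ltW s20)//; lra.
  rewrite (_ : (sigma / 2) ^+ 2 = sigma ^+ 2 / 4); last by field.
  lra.
have le1 : \int[lam]_x (\1_S x * w x) <= \int[lam]_x
    (\1_[set y | (sigma / 2) ^+ 2 < square_sum s psi J near_part y] x * w x).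
  by apply: I_le => // x; rewrite ler_wpM2r.
have le2 : \int[lam]_x (l2 J near_part x * w x) <=
    M * (Ct * (A * (9 / 2) ^+ n) * theta (wcube w x0 r0)).
  rewrite l2n (_ : (fun x => \1_B2 x * F x * w x) = fun x => \1_B2 x * (F x * w x)).
    apply: (le_trans (hM x0 r90)); rewrite ler_wpM2l//.
    by apply: theta_doubling; rewrite ?ler_nat.
  by apply/funext => x; rewrite mulrA.
apply: (@le_trans _ _ (near_const * M * theta (wcube w x0 r0))); last first.
  by rewrite lerDl mulr_ge0.
rewrite -ler_pdivlMl//; apply: (le_trans le1); apply: (le_trans leN).
have wc0 : 0 <= @weak_const R n A a K / (sigma / 2).
  by rewrite divr_ge0 ?weak_const_ge0 ?(ltW s20).
apply: (le_trans (ler_wpM2l wc0 le2)).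
rewrite /near_const le_eqVlt; apply/orP; left; apply/eqP; field.
by rewrite gt_eqF.
Qed.

End one_cube.
End morrey_cubes.

(** * Euclidean balls *)

(** The integral of a nonnegative function is the supremum over simple functions below it, hence
    monotone for arbitrary functions. This handles integrands such as [A_alpha], a supremum over an
    uncountable family. *)
Lemma ge0_le_lower_integral d (T : measurableType d) (R : realType)
    (mu : {measure set T -> \bar R}) (f g : T -> \bar R) :
  (forall x, 0 <= f x)%E -> (forall x, f x <= g x)%E ->
  (\int[mu]_x f x <= \int[mu]_x g x)%E.
Proof.
move=> f0 fg; have g0 x : (0 <= g x)%E by exact: le_trans (fg x).
rewrite !ge0_integralTE//; apply: ereal_sup_le => _ [h /= hf <-].
by exists h => //= x; exact: le_trans (fg x).
Qed.

Section euclidean.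
Context {R : realType} {n : nat}.
Local Notation Rn := 'rV[R]_n.
Local Notation lam := (@lebesgue_rV R n).
Local Notation L1 f := (lam.-integrable setT (EFin \o f)).
Implicit Types (x y z c : Rn).

(** Makes the bounds on [l2] available; that norm is indexed by naturals, hence [insub], whose
    default 0 is never reached for indices below n. *)
Lemma eucl_normE x : eucl_norm x = l2 n (fun j (x : 'I_n -> R) =>
  if insub j is Some i then x i else 0) (fun i => x ord0 i).
Proof. by rewrite /eucl_norm /l2; congr Num.sqrt; apply: eq_bigr => i _; rewrite valK. Qed.

Lemma eucl_norm_ge0 x : 0 <= eucl_norm x.
Proof. exact: sqrtr_ge0. Qed.

Lemma eucl_norm_ge x i : `|x ord0 i| <= eucl_norm x.
Proof.
have := @l2_ge R n _ (fun j (x : 'I_n -> R) =>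
  if insub j is Some i then x i else 0) (fun i => x ord0 i) i.
by rewrite -eucl_normE valK.
Qed.

Lemma eucl_norm_le x (d : R) : (forall i, `|x ord0 i| <= d) ->
  eucl_norm x <= n%:R * d.
Proof.
move=> xd; rewrite eucl_normE; apply: (le_trans (l2_le_sum _ _ _)).
apply: (@le_trans _ _ (\sum_(i < n) d)).
  by apply: ler_sum => i _; rewrite valK.
by rewrite sumr_const card_ord mulr_natl.
Qed.

Lemma measurable_eucl_norm c : measurable_fun [set: Rn] (fun y => eucl_norm (y - c)).
Proof.
apply: (measurableT_comp (continuous_measurable_fun (@sqrt_continuous R))).
apply: measurable_sum => i; apply: measurable_funX.
under [X in measurable_fun _ X]funext do rewrite !mxE.
apply: (measurable_funB _ (measurable_cst _)); exact: measurable_coord.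
Qed.

Lemma measurable_eball c (r : R) : measurable (eball c r : set (lebesgue_type n)).
Proof.
apply: borel_lebesgue_measurable.
rewrite (_ : eball c r = (fun y => eucl_norm (y - c)) @^-1` `]-oo, r[%classic).
  by rewrite -[X in measurable X]setTI; exact: measurable_eucl_norm.
by apply/seteqP; split => y /=; rewrite in_itv.
Qed.

Lemma eball_sub_cube c (r : R) : eball c r `<=` cube c r.
Proof.
move=> y /= yr i; have := le_lt_trans (eucl_norm_ge (y - c) i) yr.
by rewrite !mxE ltr_norml => /andP[h1 h2]; apply/andP; split; lra.
Qed.

(** The Euclidean norm is at most n r; the extra 4 makes the inequality strict and the ratio of
    radii at least 4, as [theta_doubling] requires. *)
Lemma cube_sub_eball c (r : R) : (0 < n)%N -> 0 < r -> cube c r `<=` eball c (4 * n%:R * r).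
Proof.
move=> n0 r0 y cy; apply: (@le_lt_trans _ _ (n%:R * r)).
  apply: eucl_norm_le => i; rewrite !mxE; have := supdist_le_sym (cube_supdist_le cy) i.
  by [].
have nr : 0 < n%:R * r by rewrite mulr_gt0// ltr0n.
by rewrite -mulrA; lra.
Qed.

Lemma locally_integrable_cube (f : Rn -> R) c (r : R) :
  locally_integrable_rV f -> L1 (fun x => \1_(cube c r) x * f x).
Proof.
move=> [mf fK]; have [K [cK mK sub]] := cube_compact c r.
apply/integrableP; split.
  apply/measurable_EFinP; apply: (measurable_funM _ mf).
  exact/measurable_indicT/measurable_cube.
apply: le_lt_trans (fK K cK); rewrite [leRHS]integral_mkcond.
apply: ge0_le_lower_integral => x //; rewrite patchE /=.
have [cx|cx] := pselect (cube c r x).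
  by rewrite indic_in// mul1r mem_set//; exact: sub.
by rewrite indic_notin// mul0r normr0; case: ifP => _; rewrite lee_fin.
Qed.

Variable w : Rn -> R.
Hypothesis n0 : (0 < n)%N.
Hypothesis wW : weight w.

Let w0 x : 0 < w x. Proof. by case: wW => /(_ x). Qed.
Let mw : measurable_fun [set: lebesgue_type n] w. Proof. by case: wW => _ []. Qed.

Lemma wmeas_indic (E : set Rn) : wmeas w E = (\int[lam]_x (\1_E x * w x)%:E)%E.
Proof. exact: integral_indicM. Qed.

Lemma wmeas_mono (E G : set Rn) : E `<=` G -> (wmeas w E <= wmeas w G)%E.
Proof.
move=> EG; rewrite !wmeas_indic; apply: ge0_le_lower_integral => x; rewrite lee_fin.
  by rewrite mulr_ge0 ?indic_ge0// ltW.
by rewrite ler_wpM2r ?indic_sub// ltW.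
Qed.

Lemma wmeas_cube c (r : R) : wmeas w (cube c r) = (wcube w c r)%:E.
Proof.
rewrite wmeas_indic -EFin_I//; apply: locally_integrable_cube.
by case: wW.
Qed.

Lemma wmeas_eball_fin c (r : R) : wmeas w (eball c r) \is a fin_num.
Proof.
rewrite ge0_fin_numE; last first.
  by rewrite wmeas_indic; apply: integral_ge0 => x _; rewrite lee_fin mulr_ge0 ?indic_ge0// ltW.
apply: le_lt_trans (wmeas_mono (@eball_sub_cube c r)) _.
by rewrite wmeas_cube ltry.
Qed.

Lemma wmeas_eball_le c (r : R) : fine (wmeas w (eball c r)) <= wcube w c r.
Proof.
rewrite -lee_fin (fineK (wmeas_eball_fin c r)) -wmeas_cube.
by apply: wmeas_mono; exact: eball_sub_cube.
Qed.

Lemma wcube_le_wmeas_eball c (r : R) : 0 < r ->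
  wcube w c r <= fine (wmeas w (eball c (4 * n%:R * r))).
Proof.
move=> r0; rewrite -lee_fin (fineK (wmeas_eball_fin _ _)) -wmeas_cube.
by apply: wmeas_mono; exact: cube_sub_eball.
Qed.

(** The cube of radius r lies in the ball of radius 4 n r, and the volume of that ball is at most
    that of its circumscribed cube, (8 n r)^n. *)
Lemma A1_A1_cube : A1 w -> exists2 A, 0 < A & A1_cube A w.
Proof.
move=> [C C0 CP].
have n0' : 0 < n%:R :> R by rewrite ltr0n.
exists (C * (2 * (4 * n%:R)) ^+ n); first by rewrite mulr_gt0// exprn_gt0// !mulr_gt0.
split => //; first by move=> c r _; apply: locally_integrable_cube; case: wW.
move=> c r r0; set B := eball c (4 * n%:R * r).
have rr : 0 < 4 * n%:R * r by rewrite !mulr_gt0.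
have mB : measurable (B : set (lebesgue_type n)) by exact: measurable_eball.
have lB0 : (lam (cube c r) <= lam B)%E.
  apply: le_measure; rewrite ?inE//; first exact: measurable_cube.
  exact: cube_sub_eball.
have lB1 : (lam B <= lam (cube c (4 * n%:R * r)))%E.
  apply: le_measure; rewrite ?inE//; first exact: measurable_cube.
  exact: eball_sub_cube.
rewrite lam_cube// in lB0; rewrite lam_cube// in lB1.
have fB : lam B \is a fin_num.
  rewrite ge0_fin_numE; last by apply: le_trans lB0; rewrite lee_fin exprn_ge0// mulr_ge0// ltW.
  by apply: le_lt_trans lB1 _; rewrite ltry.
have lBpos : 0 < fine (lam B).
  rewrite -lte_fin fineK//; apply: lt_le_trans lB0.
  by rewrite lte_fin exprn_gt0// mulr_gt0.
have lBle : fine (lam B) <= (2 * (4 * n%:R * r)) ^+ n by rewrite -lee_fin fineK.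
have := CP B (ex_intro _ c (ex_intro _ _ (conj rr erefl))).
rewrite -[wmeas w B]fineK ?wmeas_eball_fin// -EFinM => hB.
have := @ess_inf_le _ _ _ lam (patch (cst +oo%E) B (EFin \o w)).
apply: ae_lebesgue_imply => z hz cz.
have Bz : B z by exact: cube_sub_eball.
move: hz; rewrite /patch mem_set//= => hz.
have : ((fine (lam B))^-1 * fine (wmeas w B) <= C * w z).
  rewrite -lee_fin; apply: le_trans hB _; rewrite [leRHS]EFinM.
  by apply: lee_wpmul2l => //; rewrite lee_fin ltW.
rewrite ler_pdivrMl// => h.
apply: (le_trans (wcube_le_wmeas_eball c r0)); apply: (le_trans h).
apply: (@le_trans _ _ ((2 * (4 * n%:R * r)) ^+ n * (C * w z))).
  by rewrite ler_wpM2r// mulr_ge0// ltW.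
by rewrite !exprMn le_eqVlt; apply/orP; left; apply/eqP; ring.
Qed.

End euclidean.

(** * Domination of the intrinsic square function *)

Section intrinsic.
Context {R : realType} {n : nat}.
Local Notation Rn := 'rV[R]_n.
Local Notation lam := (@lebesgue_rV R n).
Local Notation L1 f := (lam.-integrable setT (EFin \o f)).
Implicit Types (x y z c : Rn).
Variable alpha : R.
Hypotheses (n0 : (0 < n)%N) (alpha0 : 0 < alpha) (alpha1 : alpha <= 1).

Let n0' : 1 <= n%:R :> R. Proof. by rewrite ler1n. Qed.

(** The 3 bounds the size of functions in [C_alpha], the n their Hoelder constant in sup
    distance. *)
Definition adapt_const : R := n%:R + 3.

Lemma adapt_const_gt0 : 0 < adapt_const.
Proof. by rewrite /adapt_const ltr_wpDl. Qed.

(** Moving x from the unit ball by 3 along one axis leads outside the support, so |phi x| <= 3^alpha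
    <= 3. *)
Lemma C_alpha_bound phi x : C_alpha alpha phi -> `|phi x| <= 3.
Proof.
move=> [phi0 _ phiH]; have [x1|x1] := ltP 1 (eucl_norm x).
  by rewrite phi0// normr0.
pose i0 := Ordinal n0.
pose x' : Rn := \row_i (x ord0 i + (i == i0)%:R * 3).
have h1 : 1 < eucl_norm x'.
  apply: lt_le_trans (eucl_norm_ge x' i0); rewrite mxE eqxx mul1r.
  have := le_trans (eucl_norm_ge x i0) x1; rewrite ler_norml => /andP[h _].
  by rewrite ger0_norm; lra.
have h2 : eucl_norm (x - x') = 3.
  rewrite /eucl_norm (bigD1 i0)//= big1 => [|i ii0].
    rewrite !mxE eqxx mul1r addr0 opprD addrA subrr sub0r sqrrN sqrtr_sqr.
    by rewrite ger0_norm.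
  by rewrite !mxE (negbTE ii0) mul0r addr0 subrr expr0n.
have := phiH x x'; rewrite (phi0 _ h1) subr0 h2 => /le_trans; apply.
by apply: ler1_powR => //; rewrite ler1n.
Qed.

Lemma C_alpha_hoelder phi x x' (d : R) : C_alpha alpha phi -> 0 < d ->
  supdist_le d x x' -> `|phi x - phi x'| <= n%:R * d `^ alpha.
Proof.
move=> [_ _ phiH] d0 xx'; apply: (le_trans (phiH x x')).
have h : eucl_norm (x - x') <= n%:R * d.
  by apply: eucl_norm_le => i; rewrite !mxE; exact: xx'.
apply: (@le_trans _ _ ((n%:R * d) `^ alpha)).
  apply: ge0_ler_powR => //; rewrite ?nnegrE ?eucl_norm_ge0 ?mulr_ge0 ?(ltW d0) ?(ltW alpha0)//.
rewrite powRM ?(ltW d0)// ler_wpM2r ?powR_ge0//.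
by apply: ler1_powR.
Qed.

Lemma C_alpha_measurable phi : C_alpha alpha phi -> measurable_fun [set: Rn] phi.
Proof.
move=> phiC; apply: measurable_unif => e e0.
have en : 0 < e / n%:R by rewrite divr_gt0// ltr0n.
exists ((e / n%:R) `^ alpha^-1); first by rewrite powR_gt0.
move=> z z' zz'; apply: (le_trans (C_alpha_hoelder phiC _ zz')).
  by rewrite powR_gt0.
rewrite -powRrM mulVf ?gt_eqF// powRr1 ?(ltW en)//.
by rewrite mulrC divfK// gt_eqF// ltr0n.
Qed.

Lemma C_alpha_L1 phi : C_alpha alpha phi -> L1 phi.
Proof.
move=> phiC; apply: (@L1_le _ (lebesgue_type n) R lam _
  (fun x => 3 * \1_(cube (0 : Rn) 2) x)).
- by apply: measurable_lebesgue_type; exact: C_alpha_measurable.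
- exact/L1Z/L1_cube.
move=> x; have [cx|cx] := pselect (cube (0 : Rn) 2 x).
  by rewrite indic_in// mulr1; exact: C_alpha_bound.
rewrite indic_notin// mulr0; case: phiC => phi0 _ _.
rewrite phi0 ?normr0// ltNge; apply/negP => x1; apply: cx.
apply: supdist_le_cube (_ : 1 < 2) _; first by rewrite ltr1n.
by move=> i; rewrite mxE sub0r normrN (le_trans (eucl_norm_ge x i)).
Qed.

(** Mean zero follows from the behaviour of Lebesgue measure under z |-> (y - z) / t; size and
    regularity from l < t, the support from t <= 2 l. *)
Lemma dilate_adapted phi y (t l : R) c : C_alpha alpha phi -> 0 < l -> l < t ->
  t <= 2 * l -> cube c l y ->
  adapted alpha adapt_const c l (fun z => dilate phi t (y - z)).
Proof.
move=> phiC l0 lt tl cy; have t0 : 0 < t by exact: lt_trans lt.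
have tn0 : 0 < t ^+ n by rewrite exprn_gt0.
have ln0 : 0 < l ^+ n by rewrite exprn_gt0.
have tln : (t ^+ n)^-1 <= (l ^+ n)^-1.
  by rewrite lef_pV2 ?posrE// lerXn2r ?nnegrE ?ltW.
have tln0 : 0 <= (t ^+ n)^-1 by rewrite invr_ge0 ltW.
have K0 := ltW adapt_const_gt0.
split.
- move=> z cz; rewrite /dilate; case: (phiC) => -> //; first by rewrite mulr0.
  rewrite ltNge; apply/negP => h; apply: cz.
  apply: (@supdist_le_cube _ _ _ (l + t)); first by lra.
  apply: supdist_le_trans (cube_supdist_le cy) _ => i.
  have := le_trans (eucl_norm_ge _ i) h; rewrite !mxE normrM ger0_norm ?invr_ge0 ?(ltW t0)//.
  by rewrite ler_pdivrMl// mulr1.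
- have mf : measurable_fun [set: Rn] (fun x => (t ^+ n)^-1 * phi x).
    by apply: (measurable_funM (measurable_cst _)); exact: C_alpha_measurable.
  have := @integral_reflect R n t y (fun x => ((t ^+ n)^-1 * phi x)%:E) t0.
  rewrite /Rintegral => -> //; first exact/measurable_EFinP.
  rewrite -EFin_I; last by apply: L1Z; exact: C_alpha_L1.
  rewrite IZ; last exact: C_alpha_L1.
  by case: phiC => _ p0 _; rewrite /Rintegral p0 /= mulr0.
- move=> z; rewrite /dilate normrM (ger0_norm tln0) mulrC.
  apply: ler_pM => //; rewrite /adapt_const.
  apply: (le_trans (C_alpha_bound _ phiC)); by rewrite lerDr.
- move=> z z' d d0 zz'; rewrite /dilate -mulrBr normrM (ger0_norm tln0).
  have dt0 : 0 < d / t by rewrite divr_gt0.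
  have h := @C_alpha_hoelder phi (t^-1 *: (y - z)) (t^-1 *: (y - z')) (d / t) phiC dt0.
  apply: (@le_trans _ _ ((l ^+ n)^-1 * (n%:R * (d / t) `^ alpha))).
    apply: ler_pM => //; apply: h => i.
    rewrite !mxE -mulrBr normrM ger0_norm ?invr_ge0 ?(ltW t0)// mulrC ler_pM2r ?invr_gt0//.
    have := zz' i; rewrite distrC => zi.
    by rewrite (_ : _ - _ = z' ord0 i - z ord0 i)//; ring.
  rewrite [_ * (n%:R * _)]mulrA [_ * n%:R]mulrC; apply: ler_pM.
  + by rewrite mulr_ge0 ?invr_ge0 ?(ltW ln0).
  + exact: powR_ge0.
  + by rewrite ler_wpM2r ?invr_ge0 ?(ltW ln0)// /adapt_const lerDl.
  apply: ge0_ler_powR; rewrite ?nnegrE ?(ltW alpha0) ?divr_ge0 ?(ltW d0) ?(ltW t0) ?(ltW l0)//.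
  by rewrite ler_pM2l// lef_pV2 ?posrE// ltW.
Qed.

Variable f : Rn -> R.
Hypothesis floc : locally_integrable_rV f.

Let fl c (r : R) : L1 (fun x => \1_(cube c r) x * f x).
Proof. exact: locally_integrable_cube. Qed.

Local Notation K := adapt_const.

Lemma adapted_loc_L1 c (l : R) psi : 0 < l -> adapted alpha K c l psi ->
  L1 (fun x => f x * psi x).
Proof.
move=> l0 psiP; rewrite (_ : (fun _ => _) =
    fun x => psi x * (\1_(cube c (4 * l)) x * f x)).
  exact: (adapted_mul_L1 alpha0 adapt_const_gt0 l0 psiP (fl c (4 * l))).
apply/funext => x; have [cx|cx] := pselect (cube c (4 * l) x).
  by rewrite indic_in//; ring.
by case: psiP => -> // _ _ _; rewrite mul0r mulr0.
Qed.

Lemma adapted_loc_le c (l : R) psi : 0 < l -> adapted alpha K c l psi ->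
  `|\int[lam]_x (f x * psi x)| <=
  K / l ^+ n * \int[lam]_x `|\1_(cube c (4 * l)) x * f x|.
Proof.
move=> l0 psiP; rewrite -IZ; last by apply: L1_norm; exact: fl.
apply: I_abs_le; first exact: adapted_loc_L1 l0 psiP.
  by apply: L1Z; apply: L1_norm; exact: fl.
move=> x; have [cx|cx] := pselect (cube c (4 * l) x); last first.
  case: psiP => -> // _ _ _; rewrite mulr0 normr0 mulr_ge0//.
  by rewrite divr_ge0 ?exprn_ge0 ?(ltW adapt_const_gt0) ?(ltW l0).
rewrite indic_in// mul1r normrM mulrC ler_wpM2r//.
by case: psiP.
Qed.

(** This class of test functions depends on the box alone, while the dilates of [C_alpha] vary with
    (y, t); one number thus serves for all (y, t) in the box. *)
Definition adapted_pairings (r : @idx n) : set R :=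
  [set `|\int[lam]_x (f x * psi x)| | psi in adapted alpha K (ctr r) (len r.1)].

Lemma adapted0 c (l : R) : 0 < l -> adapted alpha K c l (fun=> 0).
Proof.
move=> l0; have h : 0 <= K / l ^+ n.
  by rewrite divr_ge0 ?exprn_ge0 ?(ltW adapt_const_gt0) ?(ltW l0).
split => // [|z|z z' d _ _]; first exact: I0.
  by rewrite normr0.
by rewrite subrr normr0 mulr_ge0// powR_ge0.
Qed.

Definition sup_pairing (r : @idx n) : R := sup (adapted_pairings r).

Lemma has_sup_pairings r : has_sup (adapted_pairings r).
Proof.
split.
  by exists `|\int[lam]_x (f x * 0)|, (fun=> 0) => //; apply: adapted0; exact: len_gt0.
exists (K / len r.1 ^+ n * \int[lam]_x `|\1_(cube (ctr r) (4 * len r.1)) x * f x|).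
by move=> _ [psi psiP <-]; apply: adapted_loc_le => //; exact: len_gt0.
Qed.

Lemma sup_pairing_ge r psi : adapted alpha K (ctr r) (len r.1) psi ->
  `|\int[lam]_x (f x * psi x)| <= sup_pairing r.
Proof.
by move=> psiP; apply: sup_upper_bound; [exact: has_sup_pairings|exists psi].
Qed.

Lemma sup_pairing_ge0 r : 0 <= sup_pairing r.
Proof. by apply: le_trans (sup_pairing_ge (adapted0 _ (len_gt0 _))). Qed.

Lemma sup_pairing_attained r : exists2 psi,
  adapted alpha K (ctr r) (len r.1) psi &
  sup_pairing r <= 2 * `|\int[lam]_x (f x * psi x)|.
Proof.
have := sup_pairing_ge0 r; rewrite le_eqVlt => /predU1P[<-|s0].
  exists (fun=> 0); first exact/adapted0/len_gt0.
  by rewrite mulr_ge0.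
have s20 : 0 < sup_pairing r / 2 by rewrite divr_gt0.
have [_ [psi psiP <-] h] := sup_adherent s20 (has_sup_pairings r).
by exists psi => //; rewrite -/(sup_pairing r) in h; lra.
Qed.

Lemma A_alpha_le r y (t : R) : cube (ctr r) (len r.1) y -> len r.1 < t ->
  t <= 2 * len r.1 -> (A_alpha alpha f y t <= (sup_pairing r)%:E)%E.
Proof.
move=> cy lt tl; apply: ge_ereal_sup => _ [phi phiC <-].
have psiP := dilate_adapted phiC (len_gt0 _) lt tl cy.
have -> : (\int[lam]_z (dilate phi t (y - z) * f z)%:E)%E =
    (\int[lam]_x (f x * dilate phi t (y - x)))%:E.
  rewrite EFin_I; first by apply: eq_integral => x _; rewrite mulrC.
  exact: adapted_loc_L1 (len_gt0 _) psiP.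
by rewrite lee_fin; exact: sup_pairing_ge.
Qed.

Lemma A_alpha_ge0 y (t : R) : (0 <= A_alpha alpha f y t)%E.
Proof.
apply: le_trans (ereal_sup_ubound _); last first.
  exists (fun=> 0) => //; split => // [|x x']; first by rewrite integral0.
  by rewrite subrr normr0 powR_ge0.
exact: abse_ge0.
Qed.

Definition enum_idx (i : nat) : option (@idx n) := pickle_inv i.

(** The integral of [sup_pairing r ^+ 2] / len^(n+1) over a box of measure (2 len)^n len, whence
    2^n; the indicator records that the cone at x can meet the box. Numbers that code no box
    contribute 0. *)
Definition idx_term (i : nat) x : R :=
  if enum_idx i is Some r then
    2 ^+ n * (\1_(cube (ctr r) (4 * len r.1)) x * sup_pairing r ^+ 2)
  else 0.

Lemma idx_term_ge0 i x : 0 <= idx_term i x.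
Proof.
rewrite /idx_term; case: enum_idx => // r.
by rewrite mulr_ge0 ?exprn_ge0// mulr_ge0 ?indic_ge0 ?sqr_ge0.
Qed.

(* The dyadic boxes over which the cone integral is cut up. *)
Definition tent (r : @idx n) : set (@lebesgue_type R n * measurableTypeR R) :=
  cube (ctr r) (len r.1) `*` `]len r.1, 2 * len r.1]%classic.

Lemma measurable_tent r : measurable (tent r).
Proof. by apply: measurableX => //; exact: measurable_cube. Qed.

Lemma tent_measure r : (lam \x lebesgue_measure)%E (tent r) =
  ((2 * len r.1) ^+ n * len r.1)%:E.
Proof.
have l0 : 0 < len r.1 :> R by exact: len_gt0.
rewrite product_measure1E//; last exact: measurable_cube.
have /= -> := lam_cube (ctr r) l0.
rewrite lebesgue_measure_itv/= lte_fin ifT; last by lra.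
by rewrite -EFinB -EFinM; congr (_ * _)%:E; ring.
Qed.

(** The ceiling puts t in a half-open interval closed on the right, the floors give the lattice
    point below y. Boxes overlap, which is harmless for domination. *)
Lemma tent_cover y (t : R) : 0 < t -> exists r, tent r (y, t).
Proof.
move=> t0; have ln2 : 0 < ln (2 : R) by rewrite ln_gt0// ltr1n.
pose u := ln t / ln 2.
have tE : t = 2 `^ u.
  by rewrite /powR ifF ?pnatr_eq0// divfK ?lnK// gt_eqF.
pose k : int := Num.ceil u - 1.
have kl : len k < t.
  rewrite /len tE; apply: ltr_pow2.
  by have /andP[] := ceil_itv u.
have tk : t <= 2 * len k.
  have -> : 2 * len k = 2 `^ (k%:~R + 1) :> R.
    by rewrite powRD ?pnatr_eq0 ?implybT// powRr1// mulrC.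
  rewrite tE.
  apply: ler_powR; first by rewrite ler1n.
  by have /andP[_ h] := ceil_itv u; rewrite /k intrB; lra.
have l0 : 0 < len k :> R by exact: len_gt0.
exists (k, \row_i Num.floor (y ord0 i / len k)); split => /=; last first.
  by rewrite in_itv/= kl tk.
move=> i; rewrite !mxE.
have /andP[h1 h2] := floor_itv (y ord0 i / len k).
rewrite intrD in h2; rewrite ler_pdivlMr// in h1; rewrite ltr_pdivrMr// in h2.
rewrite mulrDl mul1r in h2; apply/andP; split; lra.
Qed.

(** A series of nonnegative multiples of indicators of boxes dominates the integrand on the cone and
    is integrated term by term. If the cone at x meets a box, x is within len + t <= 3 len of its
    centre. *)
Lemma S_alpha_sqr_le x :
  (S_alpha alpha f x ^+ 2 <= \sum_(0 <= i <oo) (idx_term i x)%:E)%E.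
Proof.
pose g i (p : @lebesgue_type R n * measurableTypeR R) : \bar R :=
  if enum_idx i is Some r then
    (\1_(cube (ctr r) (4 * len r.1)) x * sup_pairing r ^+ 2 / len r.1 ^+ n.+1 *
     \1_(tent r) p)%:E
  else 0%E.
have c0 (r : @idx n) : 0 <= \1_(cube (ctr r) (4 * len r.1)) x * sup_pairing r ^+ 2 / len r.1 ^+ n.+1.
  apply: divr_ge0; last by rewrite exprn_ge0// ltW// len_gt0.
  by apply: mulr_ge0; [exact: indic_ge0|exact: sqr_ge0].
have g0 i p : (0 <= g i p)%E.
  rewrite /g; case: enum_idx => // r; rewrite lee_fin mulr_ge0 ?indic_ge0//.
have mg i : measurable_fun setT (g i).
  rewrite /g; case: enum_idx => [r|]; last exact: measurable_cst.
  apply/measurable_EFinP; apply: (measurable_funM (measurable_cst _)).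
  by apply: measurable_indicT; exact: measurable_tent.
have Ig i : (\int[lam \x lebesgue_measure]_p g i p = (idx_term i x)%:E)%E.
  rewrite /g /idx_term; case: enum_idx => [r|]; last by rewrite integral0.
  under eq_integral do rewrite EFinM.
  rewrite ge0_integralZl//; last 2 first.
  - apply/measurable_EFinP; apply: measurable_indicT; exact: measurable_tent.
  - by rewrite lee_fin.
  rewrite integral_indic//; last exact: measurable_tent.
  have /= tE := tent_measure r; rewrite setIT tE -EFinM; congr EFin.
  rewrite exprMn [len r.1 ^+ n.+1]exprSr; field.
  by rewrite ?expf_neq0 gt_eqF ?len_gt0.
rewrite /S_alpha poweR12_sqrt; last first.
  apply: integral_ge0 => -[y t] [/= t0 _]; apply: mule_ge0.
    by apply: mule_ge0; exact: A_alpha_ge0.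
  by rewrite lee_fin invr_ge0 exprn_ge0// ltW.
rewrite sqr_sqrte; last first.
  apply: integral_ge0 => -[y t] [/= t0 _]; apply: mule_ge0.
    by apply: mule_ge0; exact: A_alpha_ge0.
  by rewrite lee_fin invr_ge0 exprn_ge0// ltW.
rewrite -(eq_eseriesr (fun i _ => Ig i)) -integral_nneseries//.
rewrite [leLHS]integral_mkcond; apply: ge0_le_lower_integral => -[y t].
  rewrite patchE; case: ifPn => // /set_mem [/= t0 _]; apply: mule_ge0.
    by apply: mule_ge0; exact: A_alpha_ge0.
  by rewrite lee_fin invr_ge0 exprn_ge0// ltW.
rewrite patchE; case: ifPn => [/set_mem [/= t0 xy]|_]; last first.
  by apply: nneseries_ge0.
have [r tr] := tent_cover y t0.
have [/= cy] := tr; rewrite in_itv/= => /andP[lt tl].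
have l0 : 0 < len r.1 :> R by exact: len_gt0.
have sx : cube (ctr r) (4 * len r.1) x.
  apply: (@supdist_le_cube _ _ _ (len r.1 + t)); first by lra.
  apply: supdist_le_trans (cube_supdist_le cy) _ => i.
  have := eucl_norm_ge (x - y) i; rewrite !mxE distrC => /le_trans; apply.
  exact: ltW.
(* The single term of a box containing (y, t) already dominates; len < t takes care of the power of
   t. *)
apply: (@le_trans _ _ (g (pickle r) (y, t))).
  have e2 : \1_(tent r) (y, t) = 1 :> R by rewrite indicE mem_set.
  rewrite /g /enum_idx pickleK_inv e2 indic_in// mul1r mulr1 EFinM.
  apply: lee_pmul; last by rewrite lee_fin lef_pV2 ?posrE ?exprn_gt0// lerXn2r ?nnegrE ?ltW.
  - by apply: mule_ge0; exact: A_alpha_ge0.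
  - by rewrite lee_fin invr_ge0 exprn_ge0// ltW.
  rewrite EFin_expe lee_sqr ?A_alpha_ge0 ?lee_fin ?sup_pairing_ge0//.
  exact: A_alpha_le.
have := @nneseries_lim_ge R (fun i => g i (y, t)) xpredT 0 (pickle r).+1
  (fun i _ _ => g0 i _).
apply: le_trans; rewrite big_nat_recr//= leeDr//.
by apply: sume_ge0 => i _.
Qed.

End intrinsic.

(** * From partial sums to the square function *)

Section final.
Context {R : realType} {n : nat}.
Local Notation Rn := 'rV[R]_n.
Local Notation lam := (@lebesgue_rV R n).
Local Notation L1 f := (lam.-integrable setT (EFin \o f)).

Lemma l2_le_l2_norm (f : nat -> Rn -> R) J x :
  ((l2 J f x)%:E <= l2_norm (fun j x => (f j x)%:E) x)%E.
Proof.
have S0 : (0 <= \sum_(0 <= j <oo) `|(f j x)%:E| ^+ 2)%E.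
  by apply: nneseries_ge0 => j _ _; exact: sqre_ge0.
rewrite /l2_norm poweR12_sqrt//.
have -> : (l2 J f x)%:E = sqrte (\sum_(0 <= j < J) `|(f j x)%:E| ^+ 2)%E.
  rewrite /l2 big_mkord (eq_bigr (fun j : 'I_J => (f j x ^+ 2)%:E)) ?sumEFin//.
  by move=> j _; rewrite abse_EFin -EFin_expe real_normK ?num_real.
rewrite lee_sqrt//; apply: nneseries_lim_ge => j _ _; exact: sqre_ge0.
Qed.

(* Only finitely many terms of a nonnegative double series are needed to exceed
   a given level. *)
Lemma double_series_level (c : nat -> nat -> R) (g : nat -> \bar R) (v : R) :
  (forall j i, 0 <= c j i) -> (forall j, 0 <= g j)%E ->
  (forall j, g j <= \sum_(0 <= i <oo) (c j i)%:E)%E ->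
  (v%:E < \sum_(0 <= j <oo) g j)%E ->
  exists N, v < \sum_(j < N) \sum_(0 <= i < N) c j i.
Proof.
move=> c0 g0 gc vg; apply: contrapT => nex.
have nle N : \sum_(j < N) \sum_(0 <= i < N) c j i <= v.
  by rewrite leNgt; apply/negP => h; apply: nex; exists N.
suff : (\sum_(0 <= j <oo) g j <= v%:E)%E by rewrite leNgt vg.
apply: lime_le; first by apply: is_cvg_nneseries => j _ _; exact: g0.
near=> J.
apply: (@le_trans _ _ (\sum_(0 <= j < J) \sum_(0 <= i <oo) (c j i)%:E)%E).
  by apply: lee_sum => j _; exact: gc.
rewrite -nneseries_sum_nat; last by move=> j i; rewrite lee_fin.
apply: lime_le.
  by apply: is_cvg_nneseries => i _ _; apply: sume_ge0 => j _; rewrite lee_fin.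
near=> I.
rewrite (eq_bigr (fun i => (\sum_(0 <= j < J) c j i)%:E)); last first.
  by move=> i _; rewrite sumEFin.
rewrite sumEFin lee_fin exchange_big /=.
apply: (le_trans _ (nle (maxn I J))); rewrite -(big_mkord xpredT (fun j => \sum_(0 <= i < maxn I J) c j i)).
rewrite [leRHS](big_cat_nat (n := J)) ?leq_maxr//=.
apply: ler_wpDr; first by apply: sumr_ge0 => j _; apply: sumr_ge0.
apply: ler_sum => j _; rewrite [leRHS](big_cat_nat (n := I)) ?leq_maxl//=.
by rewrite lerDl; apply: sumr_ge0.
Unshelve. all: by end_near. Qed.

Section level_sets.
Variable alpha : R.
Hypotheses (n0 : (0 < n)%N) (alpha0 : 0 < alpha) (alpha1 : alpha <= 1).
Variable f : nat -> Rn -> R.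
Hypothesis floc : forall j, locally_integrable_rV (f j).

Definition first_idx N : seq (@idx n) := pmap enum_idx (iota 0 N).

Lemma first_idx_uniq N : uniq (first_idx N).
Proof. by rewrite /first_idx (pmap_uniq (@pickle_invK _))// iota_uniq. Qed.

Variable psi : @idx n -> nat -> Rn -> R.
Hypothesis psiS : forall r j,
  sup_pairing alpha (f j) r <= 2 * `|\int[lam]_x (f j x * psi r j x)|.

Let sq N := square_sum (first_idx N) psi N f.

(** To 2^n from the boxes is added 2^2 from choosing, for each box and j, a pairing within a factor
    2 of the supremum. *)
Lemma idx_terms_le N x :
  \sum_(j < N) \sum_(0 <= i < N) idx_term alpha (f j) i x <= 2 ^+ n.+2 * sq N x.
Proof.
rewrite /sq /square_sum.
have -> : 2 ^+ n.+2 * (\sum_(r <- first_idx N) \1_(cube (ctr r) (4 * len r.1)) x *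
    \sum_(j < N) (\int[lam]_x0 (f j x0 * psi r j x0)) ^+ 2) =
  \sum_(j < N) \sum_(r <- first_idx N) 2 ^+ n.+2 * (\1_(cube (ctr r) (4 * len r.1)) x *
    (\int[lam]_x0 (f j x0 * psi r j x0)) ^+ 2).
  rewrite exchange_big /= big_distrr /=; apply: eq_bigr => r _.
  by rewrite -!big_distrr.
apply: ler_sum => j _; rewrite /first_idx big_pmap /index_iota subn0.
apply: ler_sum => i _; rewrite /idx_term; case: enum_idx => //= r.
rewrite [2 ^+ n.+2](_ : _ = 2 ^+ n * 2 ^+ 2); last by rewrite -exprD addn2.
rewrite -[leRHS]mulrA ler_wpM2l ?exprn_ge0// [leRHS]mulrCA ler_wpM2l ?indic_ge0//.
rewrite -[X in _ <= _ * X]real_normK ?num_real// -exprMn.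
by apply: lerXn2r; rewrite ?nnegrE ?mulr_ge0//; exact: sup_pairing_ge0.
Qed.

(** The level is divided by 2^(n+1) because 2^(n+2) <= (2^(n+1))^2 absorbs the constant of
    [idx_terms_le]. *)
Lemma level_set_sub (sigma : R) x : 0 < sigma ->
  (sigma%:E < `|l2_norm (fun j => S_alpha alpha (f j)) x|)%E ->
  exists N, (sigma / 2 ^+ n.+1) ^+ 2 < sq N x.
Proof.
move=> sigma0; have S0 : (0 <= \sum_(0 <= j <oo) `|S_alpha alpha (f j) x| ^+ 2)%E.
  by apply: nneseries_ge0 => j _ _; exact: sqre_ge0.
rewrite /l2_norm poweR12_sqrt// gee0_abs ?sqrte_ge0// => h.
have h2 : ((sigma ^+ 2)%:E < \sum_(0 <= j <oo) `|S_alpha alpha (f j) x| ^+ 2)%E.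
  rewrite EFin_expe -[ltRHS]sqr_sqrte//.
  by rewrite lte_sqr ?sqrte_ge0 ?lee_fin ?(ltW sigma0).
have [|||N hN] := double_series_level _ _ _ h2 (c := fun j i => idx_term alpha (f j) i x).
- by move=> j i; exact: idx_term_ge0.
- by move=> j; exact: sqre_ge0.
- move=> j; rewrite gee0_abs; first exact: S_alpha_sqr_le.
  by rewrite /S_alpha poweR_ge0.
exists N.
have := lt_le_trans hN (idx_terms_le N x) => h3.
have p0 : 0 < 2 ^+ n.+2 :> R by rewrite exprn_gt0.
rewrite -(ltr_pM2l p0); apply: le_lt_trans h3.
rewrite expr_div_n mulrCA -[leRHS]mulr1; apply: ler_wpM2l; first exact: sqr_ge0.
rewrite ler_pdivrMr ?exprn_gt0 ?exprn_gt0// mul1r -exprM.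
by rewrite ler_weXn2l ?ler1n// muln2 -addnn addSn addnS !ltnS leq_addr.
Qed.

(** Raising N adds boxes as well as functions; monotone convergence over the level sets relies on
    this. *)
Lemma sq_nondecreasing x : nondecreasing_seq (fun N => sq N x).
Proof.
apply/nondecreasing_seqP => N; rewrite /sq /square_sum /first_idx.
have -> : iota 0 N.+1 = iota 0 N ++ [:: N] by rewrite -addn1 iotaD.
rewrite pmap_cat big_cat /= ler_wpDr//.
  apply: sumr_ge0 => r _; rewrite mulr_ge0 ?indic_ge0//.
  by apply: sumr_ge0 => j _; exact: sqr_ge0.
apply: ler_sum => r _; rewrite ler_wpM2l ?indic_ge0// big_ord_recr /= lerDl.
exact: sqr_ge0.
Qed.

Lemma measurable_level N (v : R) :
  measurable ([set y | v < sq N y] : set (lebesgue_type n)).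
Proof.
rewrite (_ : [set _ | _] = sq N @^-1` `]v, +oo[%classic).
  by rewrite -[X in measurable X]setTI; exact: square_sum_measurable.
by apply/seteqP; split => x /=; rewrite in_itv/= andbT.
Qed.

Variable w : Rn -> R.
Hypothesis wW : weight w.

(** The level set is covered by an increasing union of measurable sets, and [wmeas] is monotone on
    arbitrary sets; the bound uniform in N passes to the limit by monotone convergence. *)
Lemma wmeas_level_le x0 (r0 sigma b : R) : 0 < r0 -> 0 < sigma ->
  (forall N, \int[lam]_x (\1_(cube x0 r0 `&`
     [set y | (sigma / 2 ^+ n.+1) ^+ 2 < sq N y]) x * w x) <= b) ->
  (wmeas w [set x | eball x0 r0 x /\
     sigma%:E < `|l2_norm (fun j => S_alpha alpha (f j)) x|] <= b%:E)%E.
Proof.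
move=> r00 sigma0 hb; have w0 x : 0 < w x by case: wW => /(_ x).
pose E N : set Rn := cube x0 r0 `&` [set y | (sigma / 2 ^+ n.+1) ^+ 2 < sq N y].
have mE N : measurable (E N : set (lebesgue_type n)).
  by apply: measurableI; [exact: measurable_cube|exact: measurable_level].
have mw : measurable_fun [set: lebesgue_type n] w by case: wW => _ [].
have sub : [set x | eball x0 r0 x /\
    (sigma%:E < `|l2_norm (fun j => S_alpha alpha (f j)) x|)%E] `<=` \bigcup_N E N.
  move=> x [Bx /(level_set_sub sigma0)[N hN]]; exists N => //; split => //.
  exact: eball_sub_cube.
apply: (le_trans (wmeas_mono wW sub)).
have ndE : {homo E : p q / (p <= q)%N >-> (p <= q)%O}.
  move=> p q pq; apply/subsetPset => x [cx hx]; split => //=.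
  exact: lt_le_trans hx (sq_nondecreasing x pq).
have cv := @ge0_nondecreasing_set_cvg_integral _ (lebesgue_type n) R E
  (fun x => (w x)%:E) lam ndE mE _ _.
have cv' := cv ltac:(move=> N; apply/measurable_EFinP; exact: measurable_funTS mw)
  ltac:(move=> N x _; rewrite lee_fin; exact: ltW).
rewrite /wmeas -(cvg_lim _ cv')//; apply: lime_le.
  by apply/cvg_ex; eexists; exact: cv'.
near=> N; rewrite integral_indicM -EFin_I ?lee_fin; first exact: hb.
apply: (@L1_le _ (lebesgue_type n) R lam _ (fun x => \1_(cube x0 r0) x * w x)).
- by apply: (measurable_funM _ mw); exact: measurable_indicT.
- by apply: locally_integrable_cube; case: wW.
move=> x; rewrite ger0_norm ?mulr_ge0 ?indic_ge0 ?(ltW (w0 x))//.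
by rewrite ler_wpM2r ?(ltW (w0 x))//; apply: indic_sub => y [].
Unshelve. all: by end_near. Qed.

End level_sets.
End final.

(** * Assembly, passing between Euclidean balls and cubes *)

Theorem theorem2p2 (R : realType) (n : nat) (n_gt0 : (0 < n)%N)
    (alpha : R) (alpha_gt0 : 0 < alpha) (alpha_le1 : alpha <= 1)
    (w : 'rV[R]_n -> R) (w_weight : weight w) (w_A1 : A1 w)
    (kappa : R) (kappa_ge0 : 0 <= kappa) (kappa_lt1 : kappa < 1)
    (theta : R -> R) (theta_D : D_kappa kappa theta) :
  exists2 C : R, 0 < C &
    forall f : nat -> 'rV[R]_n -> R,
      (forall j, locally_integrable_rV (f j)) ->
      (weak_morrey_norm theta w (l2_norm (fun j => S_alpha alpha (f j)))
       <= C%:E * morrey_norm theta w (l2_norm (fun j x => (f j x)%:E)))%E.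
Proof.
have [A A0 wP] := A1_A1_cube n_gt0 w_weight w_A1.
have [th0 thm [Ct Ct0 thD]] := theta_D.
pose L : R := 4 * n%:R.
have L4 : 4 <= L by rewrite /L ler_peMr// ler1n.
have L0 : 0 < L by apply: lt_le_trans L4.
pose D := Ct * (A * (L / 2) ^+ n).
have D0 : 0 <= D by rewrite /D !mulr_ge0 ?exprn_ge0 ?divr_ge0 ?(ltW Ct0) ?(ltW A0) ?(ltW L0).
have K0 : 0 < @adapt_const R n by exact: adapt_const_gt0.
pose mc := @morrey_const R n A kappa Ct alpha (@adapt_const R n).
have mc0 : 0 <= mc.
  apply: addr_ge0; first exact: near_const_ge0.
  by apply: mulr_ge0 => //; exact: far_const_ge0.
(* One [D] carries the Morrey bound from balls to cubes, the other carries [theta] back to the ball;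
   2^(n+1) is the loss in the level. *)
pose C0 := 2 ^+ n.+1 * (mc * D) * D.
have C00 : 0 <= C0.
  rewrite /C0; apply: mulr_ge0 => //; apply: mulr_ge0; last exact: mulr_ge0.
  exact: exprn_ge0.
exists (C0 + 1); first by rewrite ltr_wpDl.
move=> f floc; set Mn := morrey_norm _ _ _.
have wB0 x (r : R) : 0 < r -> 0 < fine (wmeas w (eball x r)).
  move=> r0; have rL : 0 < r / L by rewrite divr_gt0.
  apply: lt_le_trans (wcube_gt0 wP x rL) _.
  have := wcube_le_wmeas_eball n_gt0 w_weight x rL.
  by rewrite -/L mulrCA divff ?mulr1// gt_eqF.
have w0 x : 0 <= w x by case: w_weight => /(_ x)/ltW.
have Mn0 : (0 <= Mn)%E.
  apply: le_trans (ereal_sup_ubound _); last first.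
    by exists (eball 0 1) => //; exists 0, 1.
  apply: mule_ge0; first by rewrite lee_fin invr_ge0 ltW// th0// wB0.
  by apply: integral_ge0 => x _; rewrite mule_ge0// lee_fin.
(* An infinite right-hand side is settled by C > 0; hence [C0 + 1] rather than [C0]. *)
have [MnE|Mnf] := eqVneq Mn +oo%E.
  by rewrite MnE gt0_muley ?leey// lte_fin ltr_wpDl.
have [M M0 ME] : exists2 M : R, 0 <= M & Mn = M%:E.
  have fM : Mn \is a fin_num by rewrite ge0_fin_numE// ltey.
  by exists (fine Mn); [exact: fine_ge0|rewrite fineK].
have hball c (r : R) : 0 < r ->
    (\int[lebesgue_rV]_(x in eball c r) (`|l2_norm (fun j x => (f j x)%:E) x| * (w x)%:E)
      <= (M * theta (fine (wmeas w (eball c r))))%:E)%E.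
  move=> r0; have t0 := th0 _ (wB0 c r r0).
  have : ((theta (fine (wmeas w (eball c r))))^-1%:E *
      \int[lebesgue_rV]_(x in eball c r) (`|l2_norm (fun j x => (f j x)%:E) x| * (w x)%:E)
      <= M%:E)%E.
    by rewrite -ME; apply: ereal_sup_ubound; exists (eball c r) => //; exists c, r.
  move=> /(lee_wpmul2l (_ : 0%:E <= (theta (fine (wmeas w (eball c r))))%:E)%E).
  rewrite lee_fin => /(_ (ltW t0)); rewrite muleA -EFinM divff ?gt_eqF// mul1e.
  by rewrite -EFinM mulrC.
have thW c (r : R) : 0 < r -> theta (wcube w c (L * r)) <= D * theta (wcube w c r).
  by move=> r0; exact: (theta_doubling n_gt0 A0 wP kappa_lt1 Ct0 th0 thD c r0 L4).
have hcube J c (r : R) : 0 < r ->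
    (\int[lebesgue_rV]_x (\1_(cube c r) x * (l2 J f x * w x))%:E <=
     (D * M * theta (wcube w c r))%:E)%E.
  move=> r0; have Lr0 : 0 < L * r by rewrite mulr_gt0.
  (* The cube lies in the ball of radius L r, which lies in the cube of radius L r; monotonicity and
     doubling of [theta] lead back to the original cube. *)
  apply: (@le_trans _ _ (M * theta (fine (wmeas w (eball c (L * r)))))%:E).
    apply: le_trans (hball c _ Lr0); rewrite [leRHS]integral_mkcond.
    apply: ge0_le_lower_integral => x.
      by rewrite lee_fin !mulr_ge0 ?indic_ge0 ?l2_ge0.
    rewrite patchE; have [cx|cx] := pselect (cube c r x).
      rewrite mem_set; last exact: cube_sub_eball.
      rewrite indic_in// mul1r EFinM; apply: lee_wpmul2r; first by rewrite lee_fin.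
      apply: (le_trans (l2_le_l2_norm f J x)).
      by rewrite gee0_abs// poweR_ge0.
    rewrite indic_notin// mul0r; case: ifP => // _.
    by rewrite mule_ge0// lee_fin.
  rewrite lee_fin [D * M]mulrC -[leRHS]mulrA; apply: ler_wpM2l => //.
  apply: le_trans (thW c r r0); apply: thm; first exact: wB0.
  exact: wmeas_eball_le.
have fl j c (r : R) : 0 < r -> lebesgue_rV.-integrable [set: lebesgue_type n]
    (EFin \o (fun x => \1_(cube c r) x * f j x)).
  by move=> _; exact: locally_integrable_cube.
have mw : measurable_fun [set: lebesgue_type n] w by case: w_weight => _ [].
have iFw J c (r : R) : 0 < r -> lebesgue_rV.-integrable [set: lebesgue_type n]
    (EFin \o (fun x => \1_(cube c r) x * (l2 J f x * w x))).
  move=> r0; apply/integrableP; split.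
    apply/measurable_EFinP; apply: measurable_funM.
      by apply: measurable_indicT; exact: measurable_cube.
    apply: (measurable_funM _ mw); apply: l2_measurable => j.
    by case: (floc j).
  under eq_integral => x _.
    rewrite /= ger0_norm; last by rewrite !mulr_ge0 ?indic_ge0 ?l2_ge0.
    over.
  by apply: le_lt_trans (hcube J c r r0) _; rewrite ltry.
have hM J c (r : R) : 0 < r ->
    \int[lebesgue_rV]_x (\1_(cube c r) x * (l2 J f x * w x)) <=
    D * M * theta (wcube w c r).
  by move=> r0; rewrite -lee_fin EFin_I; [exact: hcube|exact: iFw].
(* The test functions are fixed once for all boxes and all j, so that the square sums increase with
   N. *)
have /choice[psi psiP] (p : @idx n * nat) : exists g,
    adapted alpha (@adapt_const R n) (ctr p.1) (len p.1.1) g /\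
    sup_pairing alpha (f p.2) p.1 <= 2 * `|\int[lebesgue_rV]_x (f p.2 x * g x)|.
  by have [g g1 g2] := sup_pairing_attained alpha_gt0 (floc p.2) p.1; exists g.
have D0M : 0 <= D * M by rewrite mulr_ge0.
apply: ge_ereal_sup => _ [B [x [r [r0 ->]]] <-].
apply: ge_ereal_sup => _ [sigma sigma0 <-].
set W := fine _; have W0 : 0 < theta W by apply: th0; exact: wB0.
pose v := sigma / 2 ^+ n.+1.
have v0 : 0 < v by rewrite divr_gt0 ?exprn_gt0.
(* The ball contains the cube of radius r / L, whose L-fold dilate is the cube of radius r. *)
have thB : theta (wcube w x r) <= D * theta W.
  have rL : 0 < r / L by rewrite divr_gt0.
  have LrL : L * (r / L) = r by rewrite mulrCA divff ?mulr1// gt_eqF.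
  have := thW x _ rL; rewrite LrL => h; apply: (le_trans h).
  apply: ler_wpM2l => //; apply: thm; first exact: (wcube_gt0 wP x rL).
  have := wcube_le_wmeas_eball n_gt0 w_weight x rL.
  by rewrite -/L LrL.
have lev N : \int[lebesgue_rV]_y (\1_(cube x r `&` [set y |
    v ^+ 2 < square_sum (first_idx N) (fun q j => psi (q, j)) N f y]) y * w y) <=
    mc * (D * M) * (D * theta W) / v.
  rewrite ler_pdivlMr// mulrC.
  have h := @morrey_cube_le R n A w n_gt0 A0 wP kappa Ct theta kappa_lt1 Ct0 th0 thD
    alpha (@adapt_const R n) alpha_gt0 K0 (first_idx N) (fun q j => psi (q, j))
    (first_idx_uniq N) (fun q j => (psiP (q, j)).1) N f fl (iFw N) (D * M) D0M
    (hM N) x r r0 v v0.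
  apply: (le_trans h); apply: ler_wpM2l thB; exact: mulr_ge0.
have := wmeas_level_le n_gt0 alpha_gt0 alpha_le1 floc (fun q j => (psiP (q, j)).2)
  w_weight r0 sigma0 lev.
move=> /(lee_wpmul2l (_ : 0%:E <= sigma%:E)%E); rewrite lee_fin => /(_ (ltW sigma0)).
have tW0 : (0%:E <= ((theta W)^-1)%:E)%E by rewrite lee_fin invr_ge0 ltW.
move=> /(lee_wpmul2l tW0) h; apply: (le_trans h).
rewrite ME -!EFinM lee_fin.
apply: (@le_trans _ _ (C0 * M)); last by apply: ler_wpM2r => //; rewrite lerDl.
rewrite le_eqVlt; apply/orP; left; apply/eqP; rewrite /C0 /v.
by field; rewrite !gt_eqF// exprn_gt0.
Qed.
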